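(* Let $G$ be a finite simple graph that is $\{\text{fork}, \text{antifork}\}$-free. Then $\mathrm{had}(G) \geq \chi(G)$.
   Context: Graphs are finite, loopless and without parallel edges. $\overline{G}$ denotes the complement of $G$ and $\chi(G)$ its chromatic number. For a set $S$ of graphs, $G$ is $S$-free if no induced subgraph of $G$ is isomorphic to a member of $S$. The fork is the 5-vertex graph obtained from the claw $K_{1,3}$ by subdividing one of its edges once; the antifork is the complement of the fork. A graph $H$ is a minor of $G$ if $H$ can be obtained from $G$ by deleting vertices and edges and contracting edges. The Hadwiger number $\mathrm{had}(G)$ is the maximum integer $n$ such that the complete graph $K_n$ is a minor of $G$. *)

(* Defs.v *)
From mathcomp Require Import all_boot.
From mathcomp Require Import boolp.

Set Implicit Arguments.
Unset Strict Implicit.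
Unset Printing Implicit Defensive.

Record sgraph := SGraph {
  vertex :> finType;
  adj : rel vertex;
  adj_sym : symmetric adj;
  adj_irrefl : irreflexive adj }.

Definition isomorphic (H G : sgraph) : Prop :=
  exists2 f : H -> G, bijective f & forall x y, adj (f x) (f y) = adj x y.

Section Complement.
Variable G : sgraph.
Definition compl_rel : rel G := fun x y => (x != y) && ~~ adj x y.
Lemma compl_sym : symmetric compl_rel.
Proof. by move=> x y; rewrite /compl_rel eq_sym adj_sym. Qed.
Lemma compl_irrefl : irreflexive compl_rel.
Proof. by move=> x; rewrite /compl_rel eqxx. Qed.
Definition complement : sgraph := SGraph compl_sym compl_irrefl.
End Complement.

Section Induced.
Variables (G : sgraph) (A : {set G}).
Definition induced_rel : rel {x : G | x \in A} := fun x y => adj (val x) (val y).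
Lemma induced_sym : symmetric induced_rel.
Proof. by move=> x y; rewrite /induced_rel adj_sym. Qed.
Lemma induced_irrefl : irreflexive induced_rel.
Proof. by move=> x; rewrite /induced_rel adj_irrefl. Qed.
Definition induced : sgraph := SGraph induced_sym induced_irrefl.
End Induced.

Definition free (S : sgraph -> Prop) (G : sgraph) : Prop :=
  forall H, S H -> forall A : {set G}, ~ isomorphic (induced A) H.

Section Complete.
Variable n : nat.
Definition complete_rel : rel 'I_n := fun x y => x != y.
Lemma complete_sym : symmetric complete_rel.
Proof. by move=> x y; rewrite /complete_rel eq_sym. Qed.
Lemma complete_irrefl : irreflexive complete_rel.
Proof. by move=> x; rewrite /complete_rel eqxx. Qed.
Definition complete : sgraph := SGraph complete_sym complete_irrefl.
End Complete.

(* The claw has centre 0 and leaves 1, 2, 4; its edge {0, 4} is subdivided by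
   the new vertex 3. *)
Definition fork_edges : seq (nat * nat) := [:: (0, 1); (0, 2); (0, 3); (3, 4)].
Definition fork_rel : rel 'I_5 := fun x y =>
  ((val x, val y) \in fork_edges) || ((val y, val x) \in fork_edges).
Lemma fork_sym : symmetric fork_rel.
Proof. by move=> x y; rewrite /fork_rel orbC. Qed.
Lemma fork_irrefl : irreflexive fork_rel.
Proof. by case=> [[|[|[|[|[|m]]]]] Hm]. Qed.
Definition fork : sgraph := SGraph fork_sym fork_irrefl.
Definition antifork : sgraph := complement fork.

Definition colorable (G : sgraph) (k : nat) : bool :=
  [exists f : {ffun G -> 'I_k}, forall x, forall y, adj x y ==> (f x != f y)].

Lemma colorable_ex (G : sgraph) : exists k, colorable G k.
Proof.
exists #|G|; apply/existsP; exists [ffun x => enum_rank x].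
apply/forallP=> x; apply/forallP=> y; apply/implyP=> xy.
rewrite !ffunE (inj_eq enum_rank_inj).
by apply: contraTneq xy => ->; rewrite adj_irrefl.
Qed.

Definition chi (G : sgraph) : nat := ex_minn (colorable_ex G).

Section MinorOperations.
Variable G : sgraph.

Definition del_vertex (v : G) : sgraph := induced [set~ v].

Section Edge.
Variables u v : G.

Definition del_edge_rel : rel G := fun x y =>
  [&& adj x y, (x, y) != (u, v) & (x, y) != (v, u)].
Lemma del_edge_sym : symmetric del_edge_rel.
Proof.
move=> x y; rewrite /del_edge_rel adj_sym !xpair_eqE.
by rewrite ![(y == _) && _]andbC [X in _ && X]andbC.
Qed.
Lemma del_edge_irrefl : irreflexive del_edge_rel.
Proof. by move=> x; rewrite /del_edge_rel adj_irrefl. Qed.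
Definition del_edge : sgraph := SGraph del_edge_sym del_edge_irrefl.

(* The vertex u stands for the merged vertex and v disappears; the loop at u
   and any parallel edges that arise are discarded. *)
Definition contract_rel : rel {x : G | x \in [set~ v]} := fun x y =>
  (x != y) && [|| adj (val x) (val y),
                  (val x == u) && adj v (val y)
                | (val y == u) && adj (val x) v].
Lemma contract_sym : symmetric contract_rel.
Proof.
move=> x y; rewrite /contract_rel eq_sym adj_sym; congr (_ && (_ || _)).
by rewrite orbC [adj _ v]adj_sym [adj v (val y)]adj_sym.
Qed.
Lemma contract_irrefl : irreflexive contract_rel.
Proof. by move=> x; rewrite /contract_rel eqxx. Qed.
Definition contract : sgraph := SGraph contract_sym contract_irrefl.
End Edge.
End MinorOperations.

Inductive minor (H : sgraph) : sgraph -> Prop :=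
| minor_iso (G : sgraph) : isomorphic H G -> minor H G
| minor_del_vertex (G : sgraph) (v : G) : minor H (del_vertex v) -> minor H G
| minor_del_edge (G : sgraph) (u v : G) : adj u v -> minor H (del_edge u v) -> minor H G
| minor_contract (G : sgraph) (u v : G) : adj u v -> minor H (contract u v) -> minor H G.

Lemma minor_card (H G : sgraph) : minor H G -> #|H| <= #|G|.
Proof.
elim=> {G} [G [f /bij_inj finj _]|G v _|G u v _ _ //|G u v _ _].
- exact: leq_card finj.
- by move/leq_trans; apply; apply: leq_card val_inj.
- by move/leq_trans; apply; apply: leq_card val_inj.
Qed.

Lemma minor_complete0 (G : sgraph) : minor (complete 0) G.
Proof.
have [n] := ubnP #|G|; elim: n G => // n IHn G ltGn.
have [v _|G0] := pickP (@predT G).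
  apply: (minor_del_vertex (v := v)); apply: IHn; rewrite ltnS in ltGn.
  apply: leq_trans ltGn; rewrite card_sig (@eq_card _ _ [set~ v]) //.
  by rewrite cardsC1 prednK //; apply/card_gt0P; exists v.
have no0 (x : 'I_0) : False by case: x.
have noG (x : G) : False by have := G0 x.
apply: minor_iso; exists (fun x : complete 0 => False_rect G (no0 x)).
  by exists (fun x : G => False_rect 'I_0 (noG x)) => x; [case: (no0 x)|case: (noG x)].
by move=> x; case: (no0 x).
Qed.

Lemma complete_minor_ex (G : sgraph) : exists n, `[< minor (complete n) G >].
Proof. by exists 0; apply/asboolP; apply: minor_complete0. Qed.

Lemma complete_minor_bound (G : sgraph) n :
  `[< minor (complete n) G >] -> n <= #|G|.
Proof. by move/asboolP/minor_card; rewrite card_ord. Qed.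

Definition had (G : sgraph) : nat :=
  ex_maxn (complete_minor_ex G) (@complete_minor_bound G).

(* Main.v *)
Require Import Defs.
From mathcomp Require Import all_boot.
From mathcomp Require Import fingroup perm.
From mathcomp Require Import boolp.

Set Implicit Arguments.
Unset Strict Implicit.
Unset Printing Implicit Defensive.

(* The antifork is the kite: two adjacent vertices with two nonadjacent common
   neighbours, one of which carries a pendant edge. Take a counterexample to
   "some [n] colours suffice and there is a [K_n] minor" with as few vertices as
   possible. A module that is not a clique could be replaced by a smaller
   clique, and a clique module yields a kite or a module that is not a clique;
   so the graph is prime. A prime fork- and kite-free graph is, up to
   complementation, claw- and diamond-free, i.e. the line graph of a
   triangle-free graph [H]. Having no clique cutset, the counterexample has a
   clique minor of size [omega + 1]: contract the complement of a largest clique.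
   - If the graph is [L(H)], Vizing's theorem colours it with [omega + 1] colours.
   - If it is the complement of [L(H)], two vertices of [H] with three private
     edges each can be deleted together with their edges, which lowers the
     chromatic number by at most 2 and provides two dominating branch sets.
     Otherwise [H] has maximum degree 2 after deleting one vertex or two adjacent
     ones, and the graph can be coloured with [omega + 1] colours. *)

(** * Connectivity and forbidden patterns *)

(** The fork and the kite are complementary and primeness is self-complementary, so structural facts
    about prime graphs hold in the graph and in its complement, although the Hadwiger bound itself
    does not dualise. Their source is [no_dom_anti]: a set of at least two vertices that is
    connected in the graph and in its complement cannot have both a vertex complete to it and a
    vertex anticomplete to it. Applied to a path on four vertices, this keeps codiamonds (an edge
    and two isolated vertices) out of neighbourhoods, hence diamonds out of non-neighbourhoods. A
    claw then grows into a stable set of which no outside vertex misses two elements, and such a set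
    leaves room neither for a triangle with an isolated vertex nor for a codiamond. The bound is
    carried as one number that is both a number of colours and the size of a clique minor. Replacing
    a module by a clique adds edges, so minimality has to range over all relations on fewer vertices
    and not only over induced subgraphs. *)

Definition co (T : finType) (e : rel T) : rel T := fun x y => (x != y) && ~~ e x y.

Ltac adjacency := first [ done | assumption | match goal with
  | es : symmetric ?e |- is_true (?e _ _) => rewrite es; assumption
  | es : symmetric ?e |- ?e _ _ = false => rewrite es; assumption end ].

Section CutConnectivity.
Variables (T : finType) (e : rel T).

(* Connectivity is phrased through cuts rather than paths: a set is connected
   when every nontrivial bipartition of it is crossed by an edge. *)
Definition conn (S : {set T}) : Prop := S != set0 /\
  forall U : {set T}, forall x y, x \in S -> x \in U -> y \in S -> y \notin U ->
    exists u v, [/\ u \in S :&: U, v \in S :\: U & e u v].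

Hypothesis es : symmetric e.

Lemma conn1 x : conn [set x].
Proof.
split=> [|U y z]; first by apply/set0Pn; exists x; rewrite inE.
by rewrite !inE => /eqP -> xU /eqP -> /negP.
Qed.

Lemma connU1 S v x : conn S -> x \in S -> e v x -> conn (v |: S).
Proof.
case=> S0 cS xS vx; split=> [|U y z]; first by apply/set0Pn; exists v; rewrite !inE eqxx.
move=> yS yU zS zU.
have [[a aS aU]|noU] : (exists2 a, a \in S & a \in U) \/ (forall a, a \in S -> a \notin U).
- by have [/exists_inP|/exists_inPn] := boolP [exists a in S, a \in U]; [left|right].
- have [[b bS bU]|allU] : (exists2 b, b \in S & b \notin U) \/ (forall b, b \in S -> b \in U).
  + have [/exists_inP|/exists_inPn H] := boolP [exists b in S, b \notin U]; [by left|right].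
    by move=> b /H; rewrite negbK.
  + have [u [w [uS wS uw]]] := cS U a b aS aU bS bU; exists u, w.
    by move: uS wS; rewrite !inE => /andP[-> ->] /andP[-> ->]; rewrite !orbT.
  have zv : z = v by apply/eqP; move: zS zU; rewrite !inE; case/orP=> [//|/allU ->].
  by exists x, v; rewrite -zv in vx *; rewrite !inE xS eqxx zU (allU _ xS) orbT es.
have yv : y = v by apply/eqP; move: yS yU; rewrite !inE; case/orP=> [//|/noU /negP].
by exists v, x; rewrite -yv in vx *; rewrite !inE xS eqxx yU (noU _ xS) orbT vx.
Qed.

Lemma conn_split S v : conn S ->
  (exists2 x, x \in S & e v x) -> (exists2 y, y \in S & ~~ e v y) ->
  exists p q, [/\ p \in S, q \in S, e p q, e v p & e v q = false].
Proof.
case=> _ cS [x xS vx] [y yS vy].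
have [| |p [q []]] := cS [set z | e v z] x y xS _ yS; rewrite ?inE //.
by move=> /andP[pS vp] /andP[/negbTE vq qS] pq; exists p, q.
Qed.

Lemma conn_nbr S x : conn S -> 1 < #|S| -> x \in S -> exists2 y, y \in S & e x y.
Proof.
case=> _ cS S1 xS.
have [y yS yx] : exists2 y, y \in S & y != x.
  have /card_gt0P[y] : 0 < #|S :\ x| by move: S1; rewrite (cardsD1 x) xS.
  by rewrite !inE => /andP[yx yS]; exists y.
have [| |u [v [uS vS uv]]] := cS [set x] x y xS _ yS; rewrite ?inE //.
by move: uS vS; rewrite !inE => /andP[_ /eqP ux] /andP[_ vS]; exists v; rewrite -?ux.
Qed.

End CutConnectivity.

Section Complement.
Variables (T : finType) (e : rel T).
Hypotheses (es : symmetric e) (ei : irreflexive e).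

Lemma co_sym : symmetric (co e).
Proof. by move=> x y; rewrite /co eq_sym es. Qed.

Lemma co_irr : irreflexive (co e).
Proof. by move=> x; rewrite /co eqxx. Qed.

Lemma coK : co (co e) =2 e.
Proof.
by move=> x y; rewrite /co; case: eqVneq => [->|_] /=; rewrite ?ei ?negbK.
Qed.

Lemma coE x y : e x y -> co e x y = false.
Proof. by rewrite /co => ->; rewrite andbF. Qed.

Lemma coF x y : co e x y -> e x y = false.
Proof. by case/andP=> _ /negbTE. Qed.

Lemma coN x y : x <> y -> e x y = false -> co e x y.
Proof. by move=> /eqP xy exy; rewrite /co xy exy. Qed.

Lemma coNe x y : x != y -> e x y = false -> co e x y.
Proof. by move=> xy exy; rewrite /co xy exy. Qed.

Lemma coneq x y : co e x y -> x != y.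
Proof. by case/andP. Qed.

Lemma cofalse x y : x != y -> co e x y = false -> e x y.
Proof. by rewrite /co => -> /= /negbFE. Qed.

End Complement.

Lemma conn_eq (T : finType) (e1 e2 : rel T) S : e1 =2 e2 -> conn e1 S -> conn e2 S.
Proof.
move=> E [S0 H]; split=> // U x y xS xU yS yU.
by have [u [v [uS vS uv]]] := H U x y xS xU yS yU; exists u, v; rewrite -E.
Qed.

Section Patterns.
Variables (T : finType) (e : rel T).

(** The prescribed adjacencies of an irreflexive relation separate every pair of vertices except the
    leaves [a] and [b], whence the equation as conclusion. In [kite_free] the pendant vertex [z]
    also separates [x] from [y], and the conclusion is [False]. *)
Definition fork_free := forall h a b c d,
  e h a -> e h b -> e h c -> e c d -> e a b = false -> e a c = false ->
  e b c = false -> e h d = false -> e a d = false -> e b d = false -> a = b.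

Definition kite_free := forall p q x y z,
  e p q -> e p x -> e p y -> e q x -> e q y -> e x y = false ->
  e z x -> e z y = false -> e z p = false -> e z q = false -> False.

Definition claw_free := forall v x y z,
  e v x -> e v y -> e v z -> e x y = false -> e x z = false -> e y z = false ->
  [\/ x = y, x = z | y = z].

Definition diamond_free := forall p q x y,
  e p q -> e p x -> e p y -> e q x -> e q y -> e x y = false -> x = y.

Definition is_module (X : {set T}) := forall v x y,
  v \notin X -> x \in X -> y \in X -> e v x -> e v y.

Definition prime_graph := 2 < #|T| /\
  forall X : {set T}, is_module X -> 1 < #|X| -> X = [set: T].

End Patterns.

Lemma module_co (T : finType) (e : rel T) X : is_module e X -> is_module (co e) X.
Proof.
move=> mX v x y vX xX yX /andP[vx nvx].
apply/andP; split; first by apply: contraNneq vX => ->.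
by apply: contra nvx; exact: mX.
Qed.

Section Duality.
Variables (T : finType) (e : rel T).
Hypotheses (es : symmetric e) (ei : irreflexive e).

(** In the complement of a fork the two leaves [a], [b] become the adjacent pair of the kite, and
    the centre [h] becomes its pendant vertex, attached to [d]. *)
Lemma fork_free_co : kite_free e -> fork_free (co e).
Proof.
move=> K h a b c d ha hb hc cd ab ac bc hd ad bd; apply/eqP/negPn/negP => nab.
have hnd : h != d by apply: contraTneq ha => ->; rewrite co_sym // ad.
have and_ : a != d by apply: contraFneq ac => ->; rewrite co_sym.
have bnd : b != d by apply: contraFneq bc => ->; rewrite co_sym.
have anc : a != c by apply: contraFneq ad => ->.
have bnc : b != c by apply: contraFneq bd => ->.
move: (coF ha) (coF hb) (coF hc) (coF cd) (cofalse nab ab) (cofalse anc ac).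
move: (cofalse bnc bc) (cofalse hnd hd) (cofalse and_ ad) (cofalse bnd bd) => *.
by apply: (K a b d c h); adjacency.
Qed.

Lemma kite_free_co : fork_free e -> kite_free (co e).
Proof.
move=> F p q x y z pq px py qx qy xy zx zy zp zq.
have nxy : x != y by apply: contraFneq zy => <-.
have nzy : z != y by apply: contraTneq zx => ->; rewrite co_sym // xy.
have nzp : z != p by apply: contraFneq zy => ->.
have nzq : z != q by apply: contraFneq zy => ->.
move: (coF pq) (coF px) (coF py) (coF qx) (coF qy) (cofalse nxy xy) (coF zx).
move: (cofalse nzy zy) (cofalse nzp zp) (cofalse nzq zq) => *.
by move/coneq: pq => /eqP; apply; apply: (F z p q y x); adjacency.
Qed.

Lemma prime_co : prime_graph e -> prime_graph (co e).
Proof.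
case=> T2 H; split=> // X mX X1; apply: H => // v x y vX xX yX.
by have := module_co mX vX xX yX; rewrite !coK.
Qed.

Lemma prime_split (X : {set T}) w : prime_graph e -> 1 < #|X| -> w \notin X ->
  exists v, [/\ v \notin X, exists2 x, x \in X & e v x & exists2 y, y \in X & ~~ e v y].
Proof.
move=> [_ P] X1 wX.
have [/exists_inP[v vX /andP[/exists_inP h1 /exists_inP h2]]|/exists_inPn H] :=
  boolP [exists v in ~: X, [exists x in X, e v x] && [exists x in X, ~~ e v x]].
  by exists v; rewrite -in_setC.
case/negP: (wX); rewrite (P X) ?inE // => v x y vX xX yX vx.
have := H v; rewrite inE => /(_ vX); apply: contraR => vy.
by apply/andP; split; apply/exists_inP; [exists x|exists y].
Qed.

(** Both sides of an uncrossed cut are modules, and one of them has at least two vertices because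
    [2 < #|T|]. *)
Lemma prime_conn : prime_graph e -> conn e [set: T].
Proof.
move=> [T2 P]; split=> [|U x y _ xU _ yU]; first by apply/set0Pn/card_gt0P; rewrite cardsT; case: #|T| T2.
have [/exists_inP[u uU /exists_inP[v vU uv]]|/exists_inPn H] :=
  boolP [exists u in U, [exists v in ~: U, e u v]].
  by exists u, v; rewrite !inE uU; move: vU; rewrite inE => ->.
have noe u v : u \in U -> v \notin U -> e u v = false.
  move=> uU vU; apply/negP => uv; case/negP: (H u uU).
  by apply/exists_inP; exists v; rewrite ?inE.
have [U1|U1] := ltnP 1 #|U|.
  by move: yU; rewrite (P U) ?inE // => v a b vU aU _; rewrite es (noe a).
have : x \in ~: U.
  rewrite (P (~: U)) ?inE //; first by move=> v a b; rewrite !inE negbK => vU aU _; rewrite noe.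
  by rewrite -(ltn_add2l #|U|) cardsC addn1 (leq_trans _ T2).
by rewrite inE xU.
Qed.

End Duality.

(** * Dominators and antidominators *)

Lemma ex_maxset (T : finType) (P : {set T} -> Prop) X : P X ->
  exists2 M, P M & forall Y, P Y -> #|Y| <= #|M|.
Proof.
move=> PX.
case: (@arg_maxnP _ X (fun Y => `[< P Y >]) (fun Y => #|Y|)); first exact/asboolP.
by move=> M /asboolP PM H; exists M => // Y PY; apply: H; apply/asboolP.
Qed.

Definition dom (T : finType) (e : rel T) (K : {set T}) h := forall x, x \in K -> e h x.

Definition mixed (T : finType) (e : rel T) (K : {set T}) v :=
  [/\ v \notin K, exists2 x, x \in K & e v x & exists2 y, y \in K & ~~ e v y].

Section DominatorHalf.
Variables (T : finType) (e : rel T).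
Hypotheses (es : symmetric e) (ei : irreflexive e).
Hypotheses (F : fork_free e) (G : kite_free e) (P : prime_graph e).

Variables (K : {set T}).
Hypotheses (cK : conn e K) (aK : conn (co e) K) (K1 : 1 < #|K|).

Lemma vertex_cases v :
  [\/ v \in K, dom e K v, dom (co e) K v | mixed e K v].
Proof.
have [vK|vK] := boolP (v \in K); first by constructor 1.
have [/exists_inP H1|/exists_inPn H1] := boolP [exists x in K, e v x]; last first.
  constructor 3 => x xK; apply: coNe; last exact/negbTE/H1.
  by apply: contraNneq vK => ->.
have [/exists_inP H2|/exists_inPn H2] := boolP [exists x in K, ~~ e v x].
  by constructor 4.
by constructor 2 => x /H2; rewrite negbK.
Qed.

Lemma mixed_edge v : mixed e K v ->
  exists p q, [/\ p \in K, q \in K, e p q, e v p & e v q = false].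
Proof. by case=> _; exact: conn_split. Qed.

Lemma mixed_nonedge v : mixed e K v ->
  exists p q, [/\ p \in K, q \in K, co e p q, e v p & e v q = false].
Proof.
case=> vK [x xK vx] [y yK vy]; have cs := co_sym es.
have [||p [q [pK qK pq vp vq]]] := conn_split (v := v) aK.
- exists y => //; apply: coNe; [by apply: contraNneq vK => ->|exact/negbTE].
- by exists x => //; rewrite /co vx andbF.
- exists q, p; split => //; [by rewrite cs| |exact: coF vp].
  by apply: cofalse vq; apply: contraNneq vK => ->.
Qed.

Hypotheses (h0 z0 : T) (dh0 : dom e K h0) (az0 : dom (co e) K z0).
(** [NZ] and [NH] are what a largest [K] provides, up to complementation; maximality enters this
    half only through them. *)
Hypothesis NZ : forall v z, mixed e K v -> dom (co e) K z -> e v z.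
Hypothesis NH : forall v h z, mixed e K v -> dom e K h -> dom (co e) K z ->
  e h z = false -> e v h = false.

Let antiF z x : dom (co e) K z -> x \in K -> e z x = false.
Proof. by move=> az xK; apply: coF; exact: az. Qed.

Let domK h : dom e K h -> h \notin K.
Proof. by move=> dh; apply/negP => /dh; rewrite ei. Qed.

Let antiK z : dom (co e) K z -> z \notin K.
Proof. by move=> dh; apply/negP => /dh; rewrite co_irr. Qed.

(** Otherwise primeness gives a vertex [v] that separates two antidominators [x] and [y]. By [NZ] it
    is not mixed, so it dominates [K]. A fork arises at a mixed vertex if [x] and [y] are not
    adjacent, and at [v] if they are. *)
Lemma anti_unique z : dom (co e) K z -> z = z0.
Proof.
move=> az; apply/eqP/negPn/negP => zz0.
pose Z := [set z | `[< dom (co e) K z >]].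
have inZ u : u \in Z <-> dom (co e) K u by rewrite inE; split=> /asboolP.
have Z1 : 1 < #|Z|.
  rewrite (cardD1 z) (cardD1 z0) !inE eq_sym zz0 /=.
  by have [-> ->] : `[< dom (co e) K z >] /\ `[< dom (co e) K z0 >] by split; apply/asboolP.
have h0Z : h0 \notin Z.
  apply/negP => /inZ H; have /set0Pn[x xK] := cK.1.
  by have := coF (H x xK); rewrite dh0.
have [v [vZ [x xZ vx] [y yZ vy]]] := prime_split P Z1 h0Z.
move/inZ: xZ => xZ; move/inZ: yZ => yZ.
case: (vertex_cases v) => [vK|dv|av|mv].
- by move: vx; rewrite es (antiF xZ).
- have /set0Pn[k kK] := cK.1.
  have [k' k'K kk'] := conn_nbr aK K1 kK.
  have xy : e x y.
    case exy: (e x y) => //.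
    have /set0Pn[w wN] : [set w | `[< mixed e K w >]] != set0.
      have [w mw] := prime_split P K1 (domK dh0).
      by apply/set0Pn; exists w; rewrite inE; apply/asboolP.
    move: wN; rewrite inE => /asboolP mw.
    have [p [q [pK qK pq wp wq]]] := mixed_edge mw.
    have xny : x = y; last by rewrite -xny vx in vy.
    move: (NZ mw xZ) (NZ mw yZ) (antiF xZ pK) (antiF xZ qK) (antiF yZ pK) (antiF yZ qK) => *.
    by apply: (F (h := w) (c := p) (d := q)); adjacency.
  have kk : k = k'.
    move: (dv k kK) (dv k' k'K) (coF kk') (antiF xZ kK) (antiF xZ k'K).
    move: (antiF yZ kK) (antiF yZ k'K) (negbTE vy) => *.
    by apply: (F (h := v) (c := x) (d := y)); adjacency.
  by move: kk'; rewrite kk co_irr.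
- by case/negP: vZ; apply/inZ.
- by rewrite NZ in vy.
Qed.

Let z0F x : x \in K -> e z0 x = false.
Proof. exact: antiF. Qed.

Let Nz v : mixed e K v -> e v z0.
Proof. by move=> mv; apply: NZ. Qed.

(** If [w] sees both ends of [pq], then [z0] hangs on [v] as the pendant vertex of a kite; if it
    sees neither, [z0], [w] and the path through [p] and [q] form a fork at [v]. *)
Lemma mixed_xor v p q w : mixed e K v -> p \in K -> q \in K -> w \in K ->
  e p q -> e v p -> e v q = false -> e v w -> w != p -> e w p = ~~ e w q.
Proof.
move=> mv pK qK wK pq vp vq vw wp.
move: (Nz mv) (z0F pK) (z0F qK) (z0F wK) => *.
case wpE: (e w p); case wqE: (e w q) => //.
- by case: (G (p := p) (q := w) (x := v) (y := q) (z := z0)); adjacency.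
- case/negP: (antiK az0); suff -> : z0 = w by [].
  by apply: (F (h := v) (c := p) (d := q)); adjacency.
Qed.

(** If [h] misses [z0], it misses a mixed [v] as well, and then each nonneighbour of [v] in [K] sees
    all or none of the neighbours of [v] in [K]. Connectivity in the complement provides one that
    sees none; connectivity in the graph gives an edge from such a vertex to one that sees all; this
    edge lies in a kite with [h] and pendant vertex [v]. *)
Lemma dom_adj_anti h : dom e K h -> e h z0.
Proof.
move=> dh; apply/negPn/negP => /negbTE hz.
have [v mv] := prime_split P K1 (domK dh).
have vh : e v h = false := NH mv dh az0 hz.
have [p [q [pK qK pq vp vq]]] := mixed_edge mv.
have sub p1 w : p1 \in K -> e v p1 -> forall q1, q1 \in K -> e v q1 = false -> e p1 q1 ->
    w \in K -> e v w -> w != p1 -> e w p1 = false /\ e w q1.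
  move=> p1K vp1 q1 q1K vq1 p1q1 wK vw wp1.
  have := mixed_xor mv p1K q1K wK p1q1 vp1 vq1 vw wp1.
  case wp1E: (e w p1); case wq1E: (e w q1) => // _.
  move: (Nz mv) (z0F p1K) (z0F q1K) (z0F wK) (dh _ p1K) (dh _ wK) => *.
  by case: (G (p := w) (q := p1) (x := v) (y := h) (z := z0)); adjacency.
pose Y1 := [set x in K | e v x].
have compl q1 : q1 \in K -> e v q1 = false -> (exists2 p1, p1 \in Y1 & e p1 q1) ->
    forall w, w \in Y1 -> e w q1.
  move=> q1K vq1 [p1]; rewrite inE => /andP[p1K vp1] p1q1 w; rewrite inE => /andP[wK vw].
  case: (eqVneq w p1) => [->//|wp1].
  by have [] := sub p1 w p1K vp1 q1 q1K vq1 p1q1 wK vw wp1.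
have pY : p \in Y1 by rewrite inE pK.
pose R := [set r in K | ~~ e v r & [forall w in Y1, ~~ e w r]].
have [r rR] : exists r, r \in R.
  have [|p' [r [p'Y rY p'r]]] := aK.2 Y1 p q pK pY qK; first by rewrite inE vq andbF.
  exists r; move: p'Y rY; rewrite !inE => /and3P[p'K _ vp'] /andP[].
  rewrite negb_and => /orP[/negP rK'|vr rK]; first by [].
  rewrite rK vr /=; apply/forall_inP => w wY; apply/negP => wr.
  have : e p' r by apply: (compl r rK (negbTE vr)); [exists w|rewrite inE p'K].
  by rewrite (coF p'r).
have pR : p \notin R by rewrite inE vp andbF.
have rK : r \in K by move: rR; rewrite inE => /andP[].
have [r1 [q1 [r1R q1R rq]]] := cK.2 R r p rK rR pK pR.
move: r1R q1R; rewrite !inE => /and4P[_ r1K vr1 /forall_inP r1Y] /andP[q1N q1K].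
have q1Y : q1 \notin Y1 by apply/negP => /r1Y; rewrite es rq.
have vq1 : e v q1 = false by move: q1Y; rewrite inE q1K => /negbTE.
have pq1 : e p q1.
  apply: (compl q1 q1K vq1 _ p pY).
  by move: q1N; rewrite q1K vq1 /= => /forall_inPn[w wY /negPn wq]; exists w.
have := r1Y _ pY; move: (dh _ q1K) (dh _ pK) (dh _ r1K) (negbTE vr1) => hq hp hr vr1' /negbTE pr1.
by apply: (G (p := q1) (q := h) (x := p) (y := r1) (z := v)); adjacency.
Qed.

Lemma dominator_half : False.
Proof.
have dz h : dom e K h -> e z0 h by move=> dh; rewrite es dom_adj_anti.
(* The non-dominators are not a module, so some dominator [h] sees one of them and misses another,
   [b]. This [b] is not in [K], and it is not the unique antidominator [z0], which sees [h]; so it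
   is mixed. *)
have [v [h [mv dh vh]]] : exists v h, [/\ mixed e K v, dom e K h & e v h = false].
  have T1 : 1 < #|~: [set h0]|.
    have [T2 _] := P; have := cardsC [set h0]; rewrite cards1 => E.
    by move: T2; rewrite -E.
  have h0T : h0 \notin ~: [set h0] by rewrite !inE eqxx.
  pose H := [set h | `[< dom e K h >]].
  have inH u : u \in H <-> dom e K u by rewrite inE; split=> /asboolP.
  have [x xK] : exists x, x \in K by apply/set0Pn; case: cK.
  have xH : x \in ~: H by rewrite inE; apply/negP => /inH /domK; rewrite xK.
  have h0H : h0 \notin ~: H by rewrite inE negbK; apply/inH.
  have H1 : 1 < #|~: H|.
    apply: leq_trans K1 (subset_leq_card _); apply/subsetP => k kK.
    by rewrite inE; apply/negP => /inH /domK; rewrite kK.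
  have [h [hH [a aH ha] [b bH hb]]] := prime_split P H1 h0H.
  have dh : dom e K h by apply/inH; move: hH; rewrite inE negbK.
  exists b, h; rewrite es (negbTE hb); split=> //.
  case: (vertex_cases b) => // [/dh|db|ab]; first by rewrite (negbTE hb).
    by move: bH; rewrite inE => /negP; case; apply/inH.
  by move: hb; rewrite (anti_unique ab) dom_adj_anti.
have zv : e z0 v by rewrite es Nz.
have zh := dz h dh.
have k1 j j' q : j \in K -> j' \in K -> q \in K -> e v j -> e v j' -> e v q = false ->
    e j j' -> e q j = false -> e q j' = false -> False.
  move=> jK j'K qK vj vj' vq jj qj qj'; move: (dh _ jK) (dh _ j'K) (dh _ qK) => *.
  by apply: (G (p := j) (q := j') (x := h) (y := v) (z := q)); adjacency.
have k2 p q r : p \in K -> q \in K -> r \in K -> e v p -> e v q = false -> e v r = false ->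
    e p q -> e q r -> e p r.
  move=> pK qK rK vp vq vr pq qr; apply/negPn/negP => /negbTE pr.
  move: (dh _ pK) (dh _ qK) (dh _ rK) => *.
  by apply: (G (p := h) (q := q) (x := p) (y := r) (z := v)); adjacency.
have [p [q [pK qK pq vp vq]]] := mixed_edge mv.
(* If two neighbours [j], [j'] of [v] in [K] are adjacent, no nonedge leaves the set [I] of common
   neighbours of [v] and [q] in [K]. If there is no such pair, no edge leaves the set [R] of common
   nonneighbours of [v] and [p]. Either way one of the two connectivities of [K] fails. *)
have [[j [j' [jK j'K vj vj' jj]]]|stab] :
    (exists j j', [/\ j \in K, j' \in K, e v j, e v j' & e j j']) \/
    (forall j j', j \in K -> j' \in K -> e v j -> e v j' -> e j j' = false).
- have [/exists_inP[j jK /exists_inP[j' j'K /and3P[? ? ?]]]|/exists_inPn H] :=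
    boolP [exists j in K, [exists j' in K, [&& e v j, e v j' & e j j']]].
    by left; exists j, j'.
  right=> j j' jK j'K vj vj'; apply: contraNF (H j jK) => jj.
  by apply/exists_inP; exists j' => //; apply/and3P.
- have xorj q1 : q1 \in K -> e v q1 = false -> e j q1 = ~~ e j' q1.
    move=> q1K vq1; have nj : j' != j by apply: contraTneq jj => ->; rewrite ei.
    case jq: (e j q1); case j'q: (e j' q1) => //.
      by have := mixed_xor mv jK q1K j'K jq vj vq1 vj' nj; rewrite es jj j'q.
    by case: (k1 j j' q1) => //; rewrite es.
  wlog jq : j j' jK j'K vj vj' jj xorj / e j q.
    move=> W; case jq: (e j q); first exact: (W j j').
    apply: (W j' j) => //; first by rewrite es.
    - by move=> q1 q1K vq1; rewrite (xorj q1) ?negbK.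
    - by move: (xorj q qK vq); rewrite jq => /esym/negbFE.
  have j'q : e j' q = false by move: (xorj q qK vq); rewrite jq; case: (e j' q).
  pose I := [set w in K | e v w && e w q].
  have IJ w w' : w \in I -> w' \in K -> e v w' -> w' != w -> e w' w = ~~ e w' q.
    rewrite inE => /and3P[wK vw wq] w'K vw' nw; exact: (mixed_xor mv wK qK w'K wq vw vq vw' nw).
  have [/exists_inP[r rK /and3P[/negbTE vr j'r _]]|/exists_inPn noQ2] :=
    boolP [exists r in K, [&& ~~ e v r, e j' r & true]].
    have jr : e j r = false by rewrite xorj // j'r.
    have qr : e q r = false.
      by apply: contraFF jr => qr; apply: (k2 j q r).
    have qr' : q = r; last by move: jq; rewrite qr' jr.
    move: (dh _ qK) (dh _ rK) (z0F qK) (z0F rK) => *.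
    by apply: (F (h := h) (c := z0) (d := v)); adjacency.
  have jI : j \in I by rewrite inE jK vj.
  have j'I : j' \notin I by rewrite inE j'q !andbF.
  have [a [b [aI bI ab]]] := aK.2 I j j' jK jI j'K j'I.
  move: aI bI; rewrite in_setI in_setD => /andP[aK' aI] /andP[bI bK].
  have va : e v a by move: aI; rewrite inE => /and3P[].
  have := coF ab; have nab : b != a by rewrite eq_sym (coneq ab).
  case vb: (e v b).
    rewrite es (IJ a b) // => /negbFE bq.
    by move: bI; rewrite inE bK vb bq.
  have jb : e j b by rewrite xorj //; have := noQ2 b bK; rewrite vb andbT.
  case: (eqVneq a j) => [->|naj]; first by rewrite jb.
  have aj : e a j = false by rewrite (IJ j a) //; move: aI; rewrite inE => /and3P[_ _ ->].
  by have := mixed_xor mv jK bK aK' jb vj vb va naj; rewrite aj => /esym/negbFE ->.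
- have compl p1 q1 w : p1 \in K -> e v p1 -> q1 \in K -> e v q1 = false -> e p1 q1 ->
      w \in K -> e v w -> e w q1.
    move=> p1K vp1 q1K vq1 p1q1 wK vw; case: (eqVneq w p1) => [->//|wp1].
    have := mixed_xor mv p1K q1K wK p1q1 vp1 vq1 vw wp1.
    by rewrite stab // => /esym/negbFE.
  pose Q := [set x in K | ~~ e v x & e p x].
  pose U := [set x in K | e v x].
  have [| |a [b [aU bU ab]]] := aK.2 U p q pK _ qK; rewrite ?inE ?pK ?vp ?vq ?andbF //.
  move: aU bU; rewrite in_setI in_setD => /andP[aK' aU] /andP[bU bK].
  have va : e v a by move: aU; rewrite inE => /andP[].
  have vb : e v b = false by move: bU; rewrite inE bK => /negbTE.
  pose R := [set x in K | ~~ e v x & ~~ e p x].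
  have bR : b \in R.
    rewrite inE bK vb /=; apply/negP => pb.
    by have := compl p b a pK vp bK vb pb aK' va; rewrite (coF ab).
  have pR : p \notin R by rewrite inE vp andbF.
  have [r [s [rR sR rs]]] := cK.2 R b p bK bR pK pR.
  move: rR sR; rewrite in_setI in_setD => /andP[rK rR] /andP[sR sK].
  have [vr pr] : e v r = false /\ e p r = false.
    by move: rR; rewrite inE => /and3P[_ /negbTE -> /negbTE ->].
  case vs: (e v s).
    by have := compl s r p sK vs rK vr; rewrite es rs pr => /(_ isT pK vp).
  have ps : e p s by move: sR; rewrite inE sK vs /= => /negPn.
  by have := k2 p s r pK sK rK vp vs vr ps; rewrite es rs pr => /(_ isT).
Qed.

End DominatorHalf.

Section DominatorAntidominator.
Variables (T : finType) (e : rel T).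
Hypotheses (es : symmetric e) (ei : irreflexive e).
Hypotheses (F : fork_free e) (G : kite_free e) (P : prime_graph e).

(* For [K] as large as possible, the mixed vertices are complete to all
   antidominators or anticomplete to all dominators; the second case is the
   first one in the complement. *)
Lemma no_dom_anti (K : {set T}) h z : conn e K -> conn (co e) K -> 1 < #|K| ->
  dom e K h -> dom (co e) K z -> False.
Proof.
pose good (K : {set T}) := [/\ conn e K, conn (co e) K, 1 < #|K|,
  exists h, dom e K h & exists z, dom (co e) K z].
move=> cK aK K1 dh az.
have [] := @ex_maxset _ good K; first by split; [| | |exists h|exists z].
move=> {cK aK K1 dh az h z} {}K [cK aK K1 [h dh] [z az]] max; have cs := co_sym es.
(* Otherwise [v] could join [K], with [h1] still complete and [z1] still anticomplete to it. *)
have grow v h1 z1 : mixed e K v -> dom e K h1 -> dom (co e) K z1 -> e v h1 -> e v z1.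
  move=> mv dh1 az1 vh; apply/negPn/negP => vz.
  case: (mv) => vK [x xK vx] [y yK vy].
  have : #|v |: K| <= #|K|; last by rewrite cardsU1 vK ltnn.
  apply: max; split; rewrite ?cardsU1 ?vK //.
  - exact: (connU1 es cK xK).
  - by apply: (connU1 cs aK yK); apply: coNe; [apply: contraNneq vK => -> | exact: negbTE].
  - exact: leq_trans K1 (leq_addl _ _).
  - by exists h1 => w; rewrite !inE => /orP[/eqP ->|/dh1 //]; rewrite es.
  - exists z1 => w; rewrite !inE => /orP[/eqP ->|/az1 //]; rewrite cs; apply: coNe; last exact: negbTE.
    by apply: contraTneq vx => ->; rewrite (coF (az1 _ xK)).
have adjz v h1 z1 : mixed e K v -> dom e K h1 -> dom (co e) K z1 -> e h1 z1 -> e v z1.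
  move=> mv dh1 az1 hz; case vh: (e v h1); first exact: (grow v h1).
  apply/negPn/negP => /negbTE vz.
  have [p [q [pK qK pq vp vq]]] := mixed_nonedge es aK mv.
  have zq : z1 = q.
    move: (coF (az1 _ pK)) (coF (az1 _ qK)) (dh1 _ pK) (dh1 _ qK) (coF pq) => *.
    by apply: (F (h := h1) (c := p) (d := v)); adjacency.
  by have := az1 _ qK; rewrite zq co_irr.
have nadjh v h1 z1 : mixed e K v -> dom e K h1 -> dom (co e) K z1 -> e h1 z1 = false ->
    e v h1 = false.
  move=> mv dh1 az1 hz; case vh: (e v h1) => //; have vz := grow v h1 z1 mv dh1 az1 vh.
  have [p [q [pK qK pq vp vq]]] := mixed_edge cK mv.
  move: (coF (az1 _ pK)) (coF (az1 _ qK)) (dh1 _ pK) (dh1 _ qK) => *.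
  by case: (G (p := h1) (q := p) (x := v) (y := q) (z := z1)); adjacency.
have [NZ|] := pselect (forall v z1, mixed e K v -> dom (co e) K z1 -> e v z1).
  exact: (dominator_half es ei F G P cK aK K1 dh az).
move=> /existsNP[v] /existsNP[z1] /not_implyP[mv] /not_implyP[az1] vz1.
(* By [adjz], one mixed vertex missing [z1] forces [z1] to miss every dominator; by [nadjh], every
   mixed vertex then misses every dominator, which is [NZ] for the complement. *)
have noh h1 : dom e K h1 -> e h1 z1 = false.
  by move=> dh1; apply/negP => hz; apply: vz1; exact: (adjz v h1).
have eK := coK ei.
have mixco w : mixed (co e) K w -> mixed e K w.
  case=> wK [x xK wx] [y yK wy]; split=> //.
    exists y => //; apply: cofalse; last exact/negbTE.
    by apply: contraNneq wK => ->.
  by exists x => //; rewrite (coF wx).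
have aK' : conn (co (co e)) K by apply: (conn_eq _ cK) => x y; rewrite eK.
have dh' : dom (co (co e)) K h by move=> x xK; rewrite eK dh.
apply: (@dominator_half _ (co e) cs (@co_irr _ e) (fork_free_co es G)
  (kite_free_co es F) (prime_co ei P) K aK aK' K1 z h az dh').
- move=> w h1 mw dh1; have mw' := mixco w mw.
  have dh1' : dom e K h1 by move=> x xK; rewrite -eK dh1.
  apply: coNe; last by apply: (nadjh w h1 z1) => //; exact: noh.
  by case: mw => wK [x xK wx] _; apply: contraTneq wx => ->; rewrite (coE (dh1' _ xK)).
- move=> w z2 h1 mw az2 dh1 z2h; have mw' := mixco w mw.
  have dh1' : dom e K h1 by move=> x xK; rewrite -eK dh1.
  apply: coE; apply: (adjz w h1) => //; rewrite es; apply: cofalse z2h.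
  apply: contraTneq isT => E; have /set0Pn[x xK] := cK.1.
  by have := coF (az2 _ xK); rewrite E dh1'.
Qed.

(** Grow [pq] to a largest connected set [K] in the neighbourhood of [h] that is anticomplete to [a]
    and [b]. A vertex [v] mixed on [K] must see [h] and exactly one of [a] and [b], say [a]. Then
    [a], [v], [p], [q] induce a path, which is connected in the graph and in its complement; [h]
    dominates it and [b] antidominates it. *)
Lemma nbhd_codiamond_free h p q a b : e h p -> e h q -> e h a -> e h b -> e p q ->
  e a b = false -> e p a = false -> e p b = false -> e q a = false -> e q b = false -> a = b.
Proof.
move=> hp hq ha hb pq ab pa pb qa qb; apply/eqP/negPn/negP => nab.
pose good (K : {set T}) := [/\ conn e K, 1 < #|K|, dom e K h, dom (co e) K a & dom (co e) K b].
have := @ex_maxset _ good [set p; q]; case.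
  split; rewrite ?cards2.
  - by apply: (connU1 es (conn1 _ q)); rewrite ?inE.
  - by case: eqVneq pq => // ->; rewrite ei.
  - by move=> x; rewrite !inE => /orP[]/eqP ->.
  - move=> x; rewrite !inE => /orP[]/eqP ->; apply: coNe; try adjacency.
    + by apply: contraTneq pq => <-; rewrite es qa.
    + by apply: contraTneq pq => <-; rewrite pa.
  - move=> x; rewrite !inE => /orP[]/eqP ->; apply: coNe; try adjacency.
    + by apply: contraTneq pq => <-; rewrite es qb.
    + by apply: contraTneq pq => <-; rewrite pb.
move=> K [cK K1 dK aK bK] max {p q hp hq pq pa pb qa qb}.
have hK : h \notin K by apply/negP => /dK; rewrite ei.
have [v [vK [x xK vx] [y yK vy]]] := prime_split P K1 hK.
have [p [q [pK qK pq vp vq]]] := mixed_edge cK (And3 vK (ex_intro2 _ _ x xK vx) (ex_intro2 _ _ y yK vy)).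
move: (coF (aK _ pK)) (coF (aK _ qK)) (coF (bK _ pK)) (coF (bK _ qK)) (dK _ pK) (dK _ qK).
move=> ap aq bp bq hp hq.
have onlyone : e v a -> e v b -> a = b.
  by move=> va vb; apply: (F (h := v) (c := p) (d := q)); adjacency.
case vh: (e v h); last first.
  case va: (e v a); case vb: (e v b).
  - by rewrite onlyone ?eqxx in nab.
  - have bq' : b = q by apply: (F (h := h) (c := a) (d := v)); adjacency.
    by have := bK _ qK; rewrite bq' co_irr.
  - have aq' : a = q by apply: (F (h := h) (c := b) (d := v)); adjacency.
    by have := aK _ qK; rewrite aq' co_irr.
  - by case/eqP: nab; apply: (F (h := h) (c := p) (d := v)); adjacency.
have nva : v != a by apply: contraTneq vp => ->; rewrite ap.
have nvb : v != b by apply: contraTneq vp => ->; rewrite bp.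
have vab : e v a || e v b.
  apply/negPn/negP; rewrite negb_or => /andP[/negbTE va /negbTE vb].
  have : #|v |: K| <= #|K|; last by rewrite cardsU1 vK ltnn.
  apply: max; split.
  - exact: (connU1 es cK pK).
  - by rewrite cardsU1 vK; exact: leq_trans K1 (leq_addl _ _).
  - by move=> w; rewrite !inE => /orP[/eqP ->|/dK //]; rewrite es.
  - by move=> w; rewrite !inE => /orP[/eqP ->|/aK //]; apply: coNe; rewrite 1?eq_sym; adjacency.
  - by move=> w; rewrite !inE => /orP[/eqP ->|/bK //]; apply: coNe; rewrite 1?eq_sym; adjacency.
clear max; clear good.
wlog va : a b ha hb ab nab aK bK ap aq bp bq onlyone nva nvb vab / e v a.
  move=> W; case/orP: (vab) => [va|vb]; first exact: (W a b).
  apply: (W b a) => //; try by adjacency.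
  - by rewrite eq_sym.
  - by move=> ? ?; rewrite onlyone.
  - by rewrite orbC.
have vb : e v b = false by apply/negP => /(onlyone va) ab'; rewrite ab' eqxx in nab.
have cs := co_sym es.
have nba : b != a by rewrite eq_sym.
have nbK w : w \in K -> b != w.
  by move=> wK; apply/negP => /eqP E; have := bK _ wK; rewrite E co_irr.
have nqv : q != v by apply: contraNneq vK => <-.
have naK w : w \in K -> w != a.
  by move=> wK; apply/negP => /eqP E; have := aK _ wK; rewrite E co_irr.
apply: (@no_dom_anti [set a; v; p; q] h b).
- rewrite -!setUA; apply: (@connU1 _ _ es _ _ v); rewrite ?inE ?eqxx ?orbT //; last by adjacency.
  apply: (@connU1 _ _ es _ _ p); rewrite ?inE ?eqxx ?orbT //.
  by apply: (connU1 es (conn1 _ q)); rewrite ?inE.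
- have -> : [set a; v; p; q] = p |: (a |: (q |: [set v])).
    by apply/setP => w; rewrite !inE; do !case: eqP.
  apply: (@connU1 _ _ cs _ _ a); rewrite ?inE ?eqxx ?orbT //; last by apply: coNe; [exact: naK|adjacency].
  apply: (@connU1 _ _ cs _ _ q); rewrite ?inE ?eqxx ?orbT //; last by apply: coNe; [rewrite eq_sym naK|adjacency].
  by apply: (connU1 cs (conn1 _ v)); rewrite ?inE //; apply: coNe; adjacency.
- by apply: leq_trans (subset_leq_card (_ : [set a; v] \subset _)); rewrite ?cards2 1?eq_sym ?nva //; apply/subsetP => w; rewrite !inE => /orP[] ->; rewrite ?orbT.
- by move=> w; rewrite !inE -!orbA => /or4P[]/eqP ->; adjacency.
- move=> w; rewrite !inE -!orbA => /or4P[]/eqP ->; apply: coNe; try by adjacency.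
  + by rewrite eq_sym.
  + exact: nbK.
  + exact: nbK.
Qed.

End DominatorAntidominator.

Section NonNeighbourhood.
Variables (T : finType) (e : rel T).
Hypotheses (es : symmetric e) (ei : irreflexive e).
Hypotheses (F : fork_free e) (G : kite_free e) (P : prime_graph e).

(** This is [nbhd_codiamond_free] in the complement. *)
Lemma non_nbhd_diamond_free z p q x y : co e z p -> co e z q -> co e z x -> co e z y ->
  e p q -> e p x -> e p y -> e q x -> e q y -> e x y = false -> x = y.
Proof.
move=> zp zq zx zy pq px py qx qy xy; apply/eqP/negPn/negP => nxy.
have := @nbhd_codiamond_free _ (co e) (co_sym es) (@co_irr _ e) (fork_free_co es G)
  (kite_free_co es F) (prime_co ei P) z x y p q zx zy zp zq.
move=> H; suff E : p = q by rewrite E ei in pq.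
by apply: H; [exact: coNe|exact: coE|..]; apply: coE; adjacency.
Qed.

End NonNeighbourhood.

(** * Wide stars *)

Ltac by_contra H := apply/negPn/negP => /negbTE H.

Lemma ex_third (T : finType) (S : {set T}) x y : 2 < #|S| ->
  exists s, [/\ s \in S, s != x & s != y].
Proof.
move=> S2; have : 0 < #|S :\ x :\ y|.
  move: S2; rewrite (cardsD1 x) (cardsD1 y (S :\ x)).
  by case: (x \in S); case: (y \in S :\ x); case: #|_|.
by case/card_gt0P=> s; rewrite !inE => /and3P[? ? ?]; exists s.
Qed.

Lemma ex_two_more (T : finType) (S : {set T}) x : 2 < #|S| ->
  exists s s', [/\ s \in S, s' \in S, s != x, s' != x & s != s'].
Proof.
move=> S2; have [s [sS sx _]] := ex_third x x S2.
have [s' [s'S s'x s's]] := ex_third x s S2.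
by exists s, s'; rewrite eq_sym in s's.
Qed.

Section WideStar.
Variables (T : finType) (e : rel T).
Hypotheses (es : symmetric e) (ei : irreflexive e).
Hypotheses (F : fork_free e) (G : kite_free e) (P : prime_graph e).

Definition stable (S : {set T}) := {in S &, forall x y, e x y = false}.

Definition star S h := [/\ stable S, 2 < #|S| & dom e S h].

(** Two missed leaves [x], [y] and the edge [vs] form a codiamond in the neighbourhood of [h] if [v]
    sees [h], and a fork at [h] otherwise. *)
Lemma star_trace S h v x y s : star S h -> x \in S -> y \in S -> s \in S ->
  e v s -> e v x = false -> e v y = false -> x = y.
Proof.
move=> [st _ dh] xS yS sS vs vx vy.
move: (dh _ xS) (dh _ yS) (dh _ sS) (st _ _ xS yS) (st _ _ xS sS) (st _ _ yS sS) => *.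
case vh: (e v h).
  by apply: (@nbhd_codiamond_free _ e es ei F G P h v s); adjacency.
by apply: (F (h := h) (c := s) (d := v)); adjacency.
Qed.

Definition misses_at_most_one (S : {set T}) := forall v x y, v \notin S ->
  x \in S -> y \in S -> e v x = false -> e v y = false -> x = y.

(* The anticomplete vertices [E] of a largest star [S] form a stable set
   together with [S]; if some vertex missed two elements of [S :|: E], then
   [S] minus one leaf would be a module. *)
Lemma wide_star : ~ claw_free e -> exists S : {set T}, [/\ stable S,
  misses_at_most_one S & 3 < #|S| \/ 2 < #|S| /\ exists h, dom e S h].
Proof.
move=> nclaw; pose good S := exists h, star S h.
have [S0 gS0] : exists S, good S.
  apply: contrapT => no; apply: nclaw => v x y z vx vy vz xy xz yz.
  apply: contrapT => ne; apply: no; exists [set x; y; z], v.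
  have nxy : x != y by apply: contra_not_neq ne => ->; constructor.
  have nxz : x != z by apply: contra_not_neq ne => ->; constructor.
  have nyz : y != z by apply: contra_not_neq ne => ->; constructor.
  split.
  - by move=> a b; rewrite !inE -!orbA => /or3P[]/eqP-> /or3P[]/eqP->; rewrite ?ei; adjacency.
  - by rewrite setUC cardsU1 !inE cards2 nxy negb_or ![z == _]eq_sym nxz nyz.
  - by move=> a; rewrite !inE -!orbA => /or3P[]/eqP->.
have [S [h hS] max] := ex_maxset gS0; have [st S2 dh] := hS.
have [E EP] : exists E : {set T}, forall v,
    (v \in E) = (v \notin S) && [forall s in S, ~~ e v s].
  by exists [set v | v \notin S & [forall s in S, ~~ e v s]] => v; rewrite inE.
have inE' v : v \in E -> v \notin S /\ forall s, s \in S -> e v s = false.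
  by rewrite EP => /andP[vS /forall_inP H]; split=> // s sS; apply/negbTE/H.
have nE v : v \notin S -> v \notin E -> exists2 s, s \in S & e v s.
  by move=> vS; rewrite EP vS /= => /forall_inPn[s sS /negPn vs]; exists s.
have [E0|En0] := eqVneq E set0.
  exists S; split=> //; last by right; split=> //; exists h.
  move=> v x y vS xS yS; have [|s sS vs] := nE v vS; first by rewrite E0 inE.
  exact: (star_trace hS xS yS sS vs).
have dis : [disjoint S & E].
  by apply/pred0P => x /=; apply/negP => /andP[xS /inE'[]]; rewrite xS.
pose link e0 w s0 := [/\ e0 \in E, s0 \in S, e w s0 = false, e w e0 &
  forall s, s \in S -> s != s0 -> e w s].
(* Being outside [E], the vertex [w] sees a leaf and so misses at most one. If it missed none,
   adding [e0] would give a larger star centred at [w]. *)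
have mklink e0 w : e0 \in E -> w \notin E -> e e0 w -> exists s0, link e0 w s0.
  move=> e0E wE ew; have [e0S e0a] := inE' _ e0E.
  have wS : w \notin S by apply: contraL ew => /e0a ->.
  have [s sS ws] := nE w wS wE.
  have [/exists_inP[s0 s0S /negbTE ws0]|/exists_inPn all_] := boolP [exists s in S, ~~ e w s].
    exists s0; split=> // [|s1 s1S ne]; first by adjacency.
    by apply: contraNT ne => /negbTE ws1; rewrite (star_trace hS s1S s0S sS ws ws1 ws0).
  have : #|e0 |: S| <= #|S|; last by rewrite cardsU1 e0S ltnn.
  apply: max; exists w; split.
  - move=> a b; rewrite !inE => /orP[/eqP->|aS] /orP[/eqP->|bS].
    + exact: ei.
    + exact: e0a.
    + by rewrite es e0a.
    + exact: st.
  - by rewrite cardsU1 e0S (leq_trans S2) ?leq_addl.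
  - move=> a; rewrite !inE => /orP[/eqP->|/all_ /negPn //]; by adjacency.
(* Exchanging the leaf [s0] for [e0] yields another star, centred at [w], to which [star_trace]
   applies again. *)
have lstar e0 w s0 : link e0 w s0 -> star (e0 |: S :\ s0) w.
  move=> [e0E s0S ws0 we0 ws]; have [e0S e0a] := inE' _ e0E.
  split.
  - move=> a b; rewrite !inE => /orP[/eqP->|/andP[_ aS]] /orP[/eqP->|/andP[_ bS]].
    + exact: ei.
    + exact: e0a.
    + by rewrite es e0a.
    + exact: st.
  - by rewrite cardsU1 !inE (negbTE e0S) andbF add1n -ltnS; move: S2; rewrite (cardsD1 s0) s0S.
  - by move=> a; rewrite !inE => /orP[/eqP->//|/andP[ne aS]]; exact: ws.
have iso e0 w e' : e0 \in E -> w \notin E -> e e0 w -> e' \in E -> e e0 e' = false.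
  move=> e0E wE ew e'E; apply/negP => ee'; have [s0 L] := mklink _ _ e0E wE ew.
  have [s [s' [sS s'S ss0 s's0 ss']]] := ex_two_more s0 S2.
  have [_ e'a] := inE' _ e'E; case/eqP: ss'.
  apply: (star_trace (lstar _ _ _ L) (v := e') (s := e0)); rewrite ?inE ?eqxx ?ss0 ?s's0 ?sS ?s'S ?orbT //;
    by [rewrite es|rewrite e'a].
have out e0 : e0 \in E -> exists2 w, w \notin E & e e0 w.
  move=> e0E; pose U := [set x in E | [forall w, (w \notin E) ==> ~~ e x w]].
  have [e0U|] := boolP (e0 \in U); last first.
    rewrite inE e0E /= => /forallPn[w]; rewrite negb_imply negbK => /andP[wE ew]; by exists w.
  have [s sS] : exists s, s \in S by apply/card_gt0P; apply: leq_trans S2.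
  have sU : s \notin U.
    by rewrite inE; apply/negP => /andP[sE]; move: (disjointFr dis sS); rewrite sE.
  have [u [v [uU vU uv]]] := (prime_conn es P).2 U e0 s (in_setT _) e0U (in_setT _) sU.
  move: uU vU; rewrite !inE /= andbT; case/andP=> uE /forallP uo.
  have [vE|vE] := boolP (v \in E); last by have := uo v; rewrite vE uv.
  rewrite /= => /forallPn[w]; rewrite negb_imply negbK => /andP[wE vw].
  by have := iso v w u vE wE vw uE; rewrite es uv.
have lk e0 : e0 \in E -> exists w s0, link e0 w s0.
  by move=> e0E; have [w wE ew] := out _ e0E; have [s0 L] := mklink _ _ e0E wE ew; exists w, s0.
have /set0Pn[e1 e1E] := En0; have [w1 [s1 L1]] := lk _ e1E.
have s1S : s1 \in S by case: L1.
have nES v : v \in E -> v \notin S by case/inE'.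
have Es v s : v \in E -> s \in S -> e v s = false by move=> /inE'[_ H]; exact: H.
have Est : stable E.
  move=> a b aE bE; have [w wE aw] := out _ aE; exact: iso aE wE aw bE.
have Sst : stable (S :|: E).
  move=> a b; rewrite !inE => /orP[aS|aE] /orP[bS|bE].
  - exact: st.
  - by rewrite es Es.
  - exact: Es.
  - exact: Est.
(* All links omit the same leaf. If [s0] differed from [s1], then [w] would miss two leaves, [e1]
   and [s0], of the exchanged star at [w1]; it misses [e1] by the maximality of [S]. *)
have same e0 w s0 : link e0 w s0 -> e0 != e1 -> s0 = s1.
  move=> L ne; have [e0E s0S ws0 we0 ws] := L; apply/eqP/negPn/negP => ns.
  have [s [sS ss0 ss1]] := ex_third s0 s1 S2.
  have we1 : e w e1 = false.
    apply/negP => we1; have : #|e1 |: (e0 |: S :\ s0)| <= #|S|.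
      apply: max; exists w; split.
      - move=> a b; rewrite !inE => Ha Hb; apply: Sst; rewrite !inE.
          by case/or3P: Ha => [/eqP->|/eqP->|/andP[_ ->]]; rewrite ?e1E ?e0E ?orbT.
        by case/or3P: Hb => [/eqP->|/eqP->|/andP[_ ->]]; rewrite ?e1E ?e0E ?orbT.
      - rewrite !cardsU1 !inE negb_or eq_sym ne (negbTE (nES _ e1E)) (negbTE (nES _ e0E)) !andbF.
        by rewrite /= !add1n !ltnS; move: S2; rewrite (cardsD1 s0) s0S => /ltnW.
      - move=> a; rewrite !inE => /or3P[/eqP->//|/eqP->//|/andP[na aS]]; exact: ws.
    rewrite !cardsU1 !inE negb_or eq_sym ne (negbTE (nES _ e1E)) (negbTE (nES _ e0E)) !andbF.
    by rewrite [X in _ <= X](cardsD1 s0) s0S !add1n ltnn.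
  have e1s0 : e1 = s0.
    apply: (star_trace (lstar _ _ _ L1) (v := w) (s := s)); rewrite ?inE ?eqxx ?ns ?s0S ?ss1 ?sS ?orbT //.
    exact: ws.
  by move: (nES _ e1E); rewrite e1s0 s0S.
pose C := S :\ s1.
have inC c : c \in C -> c \in S /\ c != s1 by rewrite !inE => /andP[ne cS].
have nS v c s : v \notin S -> v \notin E -> c \in S -> e v c = false -> s \in S -> s != c -> e v s.
  move=> vS vE cS vc sS sc; have [s' s'S vs'] := nE v vS vE.
  by apply: contraNT sc => /negbTE vs; rewrite (star_trace hS sS cS s'S vs').
have nT v c f : v \notin S -> v \notin E -> c \in C -> e v c = false -> f \in E -> e v f.
  move=> vS vE /inC[cS cs1] vc fE.
  have [w L] : exists w, link f w s1.
    have [w [s0 L]] := lk _ fE; have [E1|ne] := eqVneq f e1; first by exists w1; rewrite E1.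
    by exists w; rewrite -(same _ _ _ L ne).
  have [s [sS sc ss1]] := ex_third c s1 S2.
  by_contra vf; have cf : c = f.
    apply: (star_trace (lstar _ _ _ L) (v := v) (s := s)); rewrite ?inE ?eqxx ?cs1 ?cS ?ss1 ?sS ?orbT //.
    exact: (nS v c).
  by move: (nES _ fE); rewrite -cf cS.
(* A vertex missing some [c] in [C] is the centre of the star [E :|: S :\ c], and this is no larger
   than [S] only if [E] is a single vertex. *)
have E1 v c : v \notin S -> v \notin E -> c \in C -> e v c = false ->
    E = [set e1] /\ star (e1 |: S :\ c) v.
  move=> vS vE cC vc; have [cS cs1] := inC _ cC.
  have st1 : star (E :|: S :\ c) v.
    split.
    - move=> a b; rewrite !inE => Ha Hb; apply: Sst; rewrite !inE.
        by case/orP: Ha => [->|/andP[_ ->]]; rewrite ?orbT.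
      by case/orP: Hb => [->|/andP[_ ->]]; rewrite ?orbT.
    - apply: leq_trans S2 _; apply: leq_trans (_ : #|e1 |: S :\ c| <= _).
        by rewrite cardsU1 !inE (negbTE (nES _ e1E)) andbF (cardsD1 c S) cS.
      by apply/subset_leq_card/setSU; rewrite sub1set.
    - move=> a; rewrite !inE => /orP[aE|/andP[ac aS]]; first exact: (nT v c).
      exact: (nS v c).
  have EE : E = [set e1].
    apply/esym/eqP; rewrite eqEcard sub1set e1E cards1 /=.
    have : #|E :|: S :\ c| <= #|S| by apply: max; exists v.
    rewrite -(leq_add2r #|E :&: (S :\ c)|) cardsUI.
    have -> : E :&: (S :\ c) = set0.
      by apply/setP => x; rewrite !inE; apply/negP => /and3P[/nES /negP].
    by rewrite cards0 addn0 (cardsD1 c S) cS add1n -addn1 addnC leq_add2l.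
  by split=> //; rewrite -EE.
exists (S :|: E); split=> //; last first.
  left; apply: (@leq_trans #|S|.+1); first by rewrite ltnS.
  have := cardsUI S E.
  have -> : S :&: E = set0 by apply/setP => x; rewrite !inE; apply/negP => /andP[xS /nES /negP].
  by rewrite cards0 addn0 => ->; rewrite -addn1 leq_add2l card_gt0.
move=> u x y uSE xSE ySE ux uy; apply/eqP/negPn/negP => xy.
have /andP[uS uE] : (u \notin S) && (u \notin E) by rewrite -negb_or -in_setU.
have CT : C = [set: T].
  apply: P.2; last by rewrite -ltnS; move: S2; rewrite (cardsD1 s1) s1S.
  suff compl v : v \notin S -> v \notin E -> forall c, c \in C -> e v c.
    move=> v a b vC aC bC va; have [vSE|] := boolP (v \in S :|: E).
      have aSE : a \in S :|: E by rewrite inE (inC _ aC).1.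
      by rewrite (Sst _ _ vSE aSE) in va.
    by rewrite inE negb_or => /andP[vS vE]; exact: compl.
  move=> vS vE c cC; by_contra vc.
  have [EE stv] := E1 _ _ vS vE cC vc; have [cS cs1] := inC _ cC.
  have ue1 z : z \in S :|: E -> e u c = false -> z != c -> e u z.
    move=> zSE uc zc; move: zSE; rewrite inE => /orP[zS|zE]; first exact: (nS u c).
    exact: (nT u c).
  have [/eqP xc|xc] := boolP (x == c).
    by have := ue1 y ySE; rewrite -xc ux uy eq_sym xy => /(_ erefl isT).
  have [/eqP yc|yc] := boolP (y == c).
    by have := ue1 x xSE; rewrite -yc ux uy xy => /(_ erefl isT).
  have inT z : z \in S :|: E -> z != c -> z \in e1 |: S :\ c.
    by rewrite EE !inE => /orP[zS|->//] ->; rewrite zS orbT.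
  have [s sS us] : exists2 s, s \in S :\ c & e u s.
    have [a [b [aS bS ac bc ab]]] := ex_two_more c S2.
    have [ua|/negbTE ua] := boolP (e u a); first by exists a; rewrite // !inE ac.
    exists b; first by rewrite !inE bc.
    by apply: (nS u a) => //; rewrite eq_sym.
  case/eqP: xy; apply: (star_trace stv (inT _ xSE xc) (inT _ ySE yc) _ us ux uy).
  by rewrite inE sS orbT.
have : s1 \in C by rewrite CT inE.
by rewrite /C !inE eqxx.
Qed.

End WideStar.

(** * Excluding codiamonds and coclaws by means of a wide star *)

Definition coclaw_free (T : finType) (e : rel T) := forall v x y z,
  e x y -> e x z -> e y z -> e v x = false -> e v y = false -> e v z = false ->
  [\/ v = x, v = y | v = z].

Definition codiamond_free (T : finType) (e : rel T) := forall x y a b,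
  e x y -> e a b = false -> e x a = false -> e x b = false -> e y a = false -> e y b = false ->
  a = b.

Section WideStarStructure.
Variables (T : finType) (e : rel T).
Hypotheses (es : symmetric e) (ei : irreflexive e).
Hypotheses (F : fork_free e) (G : kite_free e) (P : prime_graph e).

Section HousePlusHub.
Variables (t a b u w i : T).
Hypotheses (tu : e t u) (tw : e t w) (uw : e u w) (ub : e u b) (wa : e w a)
  (ia : e i a) (ib : e i b).
Hypotheses (ta : e t a = false) (tb : e t b = false) (ab : e a b = false)
  (it : e i t = false) (ua : e u a = false) (wb : e w b = false)
  (iu : e i u = false) (iw : e i w = false).

(** The six vertices of the section are the 5-cycle [u], [w], [a], [i], [b] and a vertex [t] forming
    a triangle with the edge [uw]. They arise from a coclaw (the triangle [t], [u], [w] and the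
    vertex [i]) that meets a three-element wide star [t], [a], [b]. *)
Lemma house_hub h : e h t -> e h a -> e h b -> [/\ e h i, e h u & e h w].
Proof.
move=> ht ha hb.
have nhi : h <> i by move=> E; rewrite E it in ht.
have hi : e h i.
  by_contra hi; have hu : e h u = false.
    by apply/negP => hu; apply: (G (p := h) (q := u) (x := b) (y := t) (z := i)); adjacency.
  have hw : e h w.
    by_contra hw; case: nhi; apply: (F (h := a) (c := w) (d := u)); adjacency.
  by apply: (G (p := h) (q := w) (x := a) (y := t) (z := i)); adjacency.
split=> //.
  by_contra hu; apply: (G (p := h) (q := i) (x := b) (y := a) (z := u)); adjacency.
by_contra hw; apply: (G (p := h) (q := i) (x := a) (y := b) (z := w)); adjacency.
Qed.


Lemma house_cover h v : e h t -> e h a -> e h b -> v != h -> e h v = false ->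
  (e v t || e v a) -> (e v t || e v b) ->
  [/\ e v t, e v a, e v b & [/\ e v u, e v w & e v i]].
Proof.
move=> ht ha hb nvh hv mta mtb; have [hi hu hw] := house_hub ht ha hb.
have nvi : v <> i by move=> E; rewrite E hi in hv.
have nvu : v <> u by move=> E; rewrite E hu in hv.
have nvw : v <> w by move=> E; rewrite E hw in hv.
have nta : t <> a by move=> E; move: tu; rewrite E es ua.
have ntb : t <> b by move=> E; move: tw; rewrite E es wb.
have nab : a <> b by move=> E; move: ub; rewrite -E ua.
have vt : e v t.
  by_contra vt; move: mta mtb; rewrite vt /= => va vb.
  have iv : e i v = false.
    by apply/negP => iv; apply: (G (p := a) (q := i) (x := h) (y := v) (z := t)); adjacency.
  have wv : e w v by by_contra wv; case: nvi; apply/esym; apply: (F (h := a) (c := w) (d := t)); adjacency.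
  have uv : e u v by by_contra uv; case: nvi; apply/esym; apply: (F (h := b) (c := u) (d := t)); adjacency.
  by apply: (G (p := u) (q := w) (x := h) (y := v) (z := i)); adjacency.
have va : e v a.
  by_contra va.
  have vb : e v b by by_contra vb; case: nab; apply: (F (h := h) (c := t) (d := v)); adjacency.
  have uv : e u v = false.
    by apply/negP => uv; apply: (G (p := t) (q := u) (x := h) (y := v) (z := a)); adjacency.
  have iv : e i v by by_contra iv; case: nvu; apply/esym; apply: (F (h := b) (c := i) (d := a)); adjacency.
  have wv : e w v.
    by by_contra wv; apply: (G (p := b) (q := i) (x := h) (y := v) (z := w)); adjacency.
  by apply: (G (p := t) (q := w) (x := v) (y := u) (z := i)); adjacency.
have vb : e v b.
  by_contra vb.
  have wv : e w v = false.
    by apply/negP => wv; apply: (G (p := t) (q := w) (x := h) (y := v) (z := b)); adjacency.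
  have iv : e i v by by_contra iv; case: nvw; apply/esym; apply: (F (h := a) (c := i) (d := b)); adjacency.
  have uv : e u v.
    by by_contra uv; apply: (G (p := a) (q := i) (x := h) (y := v) (z := u)); adjacency.
  by apply: (G (p := t) (q := u) (x := v) (y := w) (z := i)); adjacency.
have vi : e v i.
  by_contra vi.
  have uv : e u v = false.
    by apply/negP => uv; apply: (G (p := t) (q := u) (x := h) (y := v) (z := i)); adjacency.
  have wv : e w v = false.
    by apply/negP => wv; apply: (G (p := t) (q := w) (x := h) (y := v) (z := i)); adjacency.
  by case: nvi; apply/esym; apply: (F (h := a) (c := w) (d := u)); adjacency.
split=> //; split=> //.
- by by_contra vu; apply: (G (p := a) (q := i) (x := h) (y := v) (z := u)); adjacency.
- by by_contra vw; apply: (G (p := b) (q := i) (x := h) (y := v) (z := w)); adjacency.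
Qed.

(** By [house_cover], a nonneighbour of a vertex complete to all six is again complete to all six.
    So the set [D] of these vertices is a union of components of the complement; it contains [h] but
    not [t], and the complement is connected. *)
Lemma no_house_hub h : e h t -> e h a -> e h b ->
  (forall v, (v == t) || (v == a) || (v == b) || ((e v t || e v a) && (e v t || e v b))) -> False.
Proof.
move=> ht ha hb miss.
pose K := [set t; a; b; u; w; i].
pose D := [set x | [forall k in K, e x k]].
have [hi hu hw] := house_hub ht ha hb.
have hD : h \in D.
  by rewrite inE; apply/forall_inP => k; rewrite !inE -!orbA; case/or4P => [/eqP->|/eqP->|/eqP->|/or3P[]/eqP->].
have tD : t \notin D.
  by rewrite inE; apply/forall_inPn; exists t; rewrite ?ei // !inE eqxx.
have [x [v [xD vD xv]]] := (prime_conn (co_sym es) (prime_co ei P)).2 D h t (in_setT _) hD (in_setT _) tD.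
have {}xD : forall k, k \in K -> e x k by move: xD; rewrite !inE /= => /forall_inP.
have [xt xa xb] : [/\ e x t, e x a & e x b] by split; apply: xD; rewrite !inE eqxx ?orbT.
have := miss v; case/orP => [H|/andP[m1 m2]].
  by move/coF: xv; case/orP: H => [/orP[]|] /eqP ->; rewrite ?xt ?xa ?xb.
have nvx : v != x by rewrite eq_sym (coneq xv).
have [vt va vb [vu vw vi]] := house_cover xt xa xb nvx (coF xv) m1 m2.
move: vD; rewrite !inE andbT => /negP; apply; apply/forall_inP => k.
by rewrite !inE -!orbA; case/or4P => [/eqP->|/eqP->|/eqP->|/or3P[]/eqP->].
Qed.

End HousePlusHub.

Variable S : {set T}.
Hypotheses (st : stable e S) (S2 : 2 < #|S|) (ms : misses_at_most_one e S).

Let nedge x y : e x y -> x \in S -> y \notin S.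
Proof. by move=> xy xS; apply: contraTN xy => yS; rewrite st. Qed.

Let hit v x y : v \notin S -> x \in S -> y \in S -> e v x = false -> y != x -> e v y.
Proof.
by move=> vS xS yS vx; apply: contraNT => /negbTE vy; rewrite (ms vS yS xS vy vx).
Qed.

(** If [u] and [v] were adjacent, both would see every other element of [S], and two such elements
    would complete a diamond in the non-neighbourhood of [s]. *)
Lemma missing_stable s u v : s \in S -> u \notin S -> v \notin S ->
  e u s = false -> e v s = false -> e u v = false.
Proof.
move=> sS uS vS us vs; apply/negP => uv.
have [x [y [xS yS xs ys xy]]] := ex_two_more s S2.
have Hc z : z \notin S -> e z s = false -> co e s z.
  by move=> zS zs; apply: coNe; [apply: contraNneq zS => <-|adjacency].
case/eqP: xy; apply: (non_nbhd_diamond_free es ei F G P (z := s) (p := u) (q := v)) => //.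
- exact: Hc.
- exact: Hc.
- by apply: coNe; [rewrite eq_sym|rewrite st].
- by apply: coNe; [rewrite eq_sym|rewrite st].
- exact: (hit uS sS).
- exact: (hit uS sS).
- exact: (hit vS sS).
- exact: (hit vS sS).
- exact: st.
Qed.

Lemma wide_star_codiamond_free : codiamond_free e.
Proof.
move=> a b f g ab fg af ag bf bg; apply/eqP/negPn/negP => nfg.
have one f1 g1 : f1 \in S -> f1 != g1 -> e f1 g1 = false -> e a f1 = false -> e a g1 = false ->
    e b f1 = false -> e b g1 = false -> g1 \notin S -> False.
  move=> fS nfg1 fg1 af1 ag1 bf1 bg1 gS.
  have [aS|aS] := boolP (a \in S).
    have fa : f1 = a by apply: (ms gS) => //; adjacency.
    by move: ab; rewrite -fa es bf1.
  have [bS|bS] := boolP (b \in S).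
    have fb : f1 = b by apply: (ms gS) => //; adjacency.
    by move: ab; rewrite -fb af1.
  by move: ab; rewrite (missing_stable fS aS bS).
have [fS|fS] := boolP (f \in S); have [gS|gS] := boolP (g \in S).
- have [aS|aS] := boolP (a \in S).
    by case/eqP: nfg; apply: (ms (nedge ab aS)).
  by case/eqP: nfg; apply: (ms aS).
- exact: (one f g).
- by apply: (one g f) => //; rewrite 1?eq_sym; adjacency.
have end1 x y : e x y -> x \in S -> e x f = false -> e x g = false -> e y f = false ->
    e y g = false -> False.
  move=> xy xS xf xg yf yg; have yS := nedge xy xS.
  have [s [sS sx ys]] : exists s, [/\ s \in S, s != x & e y s].
    have [s [s' [sS s'S sx s'x ss']]] := ex_two_more x S2.
    case ys: (e y s); first by exists s.
    by exists s'; split=> //; apply: (hit yS sS s'S ys); rewrite eq_sym.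
  have fs : e f s by apply: (hit fS xS) => //; adjacency.
  have gs : e g s by apply: (hit gS xS) => //; adjacency.
  have sx' := st sS xS.
  by case/eqP: nfg; apply: (F (h := s) (c := y) (d := x)); adjacency.
have [aS|aS] := boolP (a \in S); first exact: (end1 a b).
have [bS|bS] := boolP (b \in S); first by apply: (end1 b a) => //; adjacency.
have fork2 s x y : s \in S -> e f s -> e g s -> e x s -> e x y -> e y s = false ->
    e x f = false -> e x g = false -> e y f = false -> e y g = false -> False.
  move=> sS fs gs xs xy ys xf xg yf yg.
  by case/eqP: nfg; apply: (F (h := s) (c := x) (d := y)); adjacency.
have key s : s \in S -> e f s = false \/ e g s = false.
  move=> sS; case fs: (e f s); case gs: (e g s); try by [left|right].
  case sa: (e a s); case sb: (e b s).
  - by case/eqP: nfg; apply: (nbhd_codiamond_free es ei F G P (h := s) (p := a) (q := b)); adjacency.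
  - by case: (fork2 s a b).
  - by case: (fork2 s b a); adjacency.
  - by move: ab; rewrite (missing_stable sS).
have [s0 [sS0 _ _]] := ex_third a a S2.
have [x [y [xS yS xs ys xy]]] := ex_two_more s0 S2.
(* Pigeonhole: each of three elements of [S] is missed by [f] or by [g], so one of these misses two
   of them. *)
case: (key s0 sS0) (key x xS) (key y yS) => [f0|g0] [f1|g1] [f2|g2].
- by case/eqP: xs; apply: (ms fS).
- by case/eqP: xs; apply: (ms fS).
- by case/eqP: ys; apply: (ms fS).
- by case/eqP: xy; apply: (ms gS).
- by case/eqP: xy; apply: (ms fS).
- by case/eqP: ys; apply: (ms gS).
- by case/eqP: xs; apply: (ms gS).
- by case/eqP: xs; apply: (ms gS).
Qed.

Hypothesis hub : 3 < #|S| \/ exists h, dom e S h.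

Let coclaw i x y z := [/\ e x y, e x z & e y z] /\ [/\ i != x, i != y & i != z] /\
  [/\ e i x = false, e i y = false & e i z = false].

Let no_coclaw_in i x y z : i \in S -> coclaw i x y z -> False.
Proof.
move=> iS [[xy xz yz] [_ [ix iy iz]]].
have bad a b : e a b -> e i a = false -> e i b = false -> a \notin S -> b \notin S -> False.
  by move=> ab ia ib aS bS; move: ab; rewrite (missing_stable iS aS bS) //; adjacency.
have [xS|xS] := boolP (x \in S); first exact: (bad y z yz iy iz (nedge xy xS) (nedge xz xS)).
have [yS|yS] := boolP (y \in S); last exact: (bad x y).
by apply: (bad x z) => //; apply: (nedge yz yS).
Qed.

(** Any other element of [S] is missed by [y] or by [z], for otherwise it forms a kite with [x],
    [y], [z] and the pendant vertex [i]. Hence [S] has exactly three elements, [hub] supplies a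
    common neighbour, and the configuration of [no_house_hub] appears. *)
Let no_coclaw_triangle i x y z : x \in S -> coclaw i x y z -> False.
Proof.
move=> xS C; have [[xy xz yz] [[nx ny nz] [ix iy iz]]] := C.
have [iS|iS] := boolP (i \in S); first exact: (no_coclaw_in iS C).
have yS := nedge xy xS; have zS := nedge xz xS.
have key s : s \in S -> s != x -> [/\ e i s, e x s = false & e y s = false \/ e z s = false].
  move=> sS sx; have is_ := hit iS xS sS ix sx; have xs := st xS sS; split=> //.
  case ys: (e y s); case zs: (e z s); try by [left|right].
  by case: (G (p := y) (q := z) (x := s) (y := x) (z := i)); adjacency.
have [s [s' [sS s'S sx s'x ss']]] := ex_two_more x S2.
have [is_ xs k1] := key s sS sx; have [is' xs' k2] := key s' s'S s'x.
wlog [ys zs'] : s s' sS s'S sx s'x ss' is_ xs k1 is' xs' k2 / e y s = false /\ e z s' = false.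
  move=> W; case: (k1) (k2) => [ys|zs] [ys'|zs'].
  - by case/eqP: ss'; apply: (ms yS).
  - exact: (W s s').
  - by apply: (W s' s) => //; rewrite eq_sym.
  - by case/eqP: ss'; apply: (ms zS).
have SE r : r \in S -> [|| r == x, r == s | r == s'].
  move=> rS; apply/negPn/negP; rewrite !negb_or => /and3P[rx rs rs'].
  by have [_ _ [yr|zr]] := key r rS rx; [case/eqP: rs; apply: (ms yS)|case/eqP: rs'; apply: (ms zS)].
have [h dh] : exists h, dom e S h.
  case: hub => // S3; have : #|S| <= #|[set x; s; s']|.
    by apply/subset_leq_card/subsetP => r /SE; rewrite !inE orbA.
  by rewrite leqNgt (leq_trans _ S3) // ltnS -setUA cardsU1 cards2; case: (_ \notin _); case: (_ != _).
have ys' : e y s' by apply: (hit yS sS s'S ys); rewrite eq_sym.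
have zs : e z s by apply: (hit zS s'S sS zs').
have ss : e s s' = false by rewrite st.
have Hs v : (v == x) || (v == s) || (v == s') || ((e v x || e v s) && (e v x || e v s')).
  have [vS|vS] := boolP (v \in S); first by case/or3P: (SE v vS) => ->; rewrite ?orbT.
  case vx: (e v x) => /=; first by rewrite !orbT.
  by rewrite (hit vS xS sS vx sx) (hit vS xS s'S vx s'x) !orbT.
by apply: (@no_house_hub x s s' y z i _ _ _ _ _ _ _ _ _ _ _ _ _ _ _ h _ _ _ Hs); try adjacency; apply: dh.
Qed.

(** Adjacent vertices do not miss the same element of [S], so two vertices of the triangle see [s].
    The third one sees [s] as well, because of the kite if [i] sees [s] and of the diamond missed by
    [i] if not. Finally, if [i] missed [s], then [s], [x], [y] would be the triangle of a coclaw
    that meets [S]. *)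
Let no_coclaw_miss i x y z : i \notin S -> coclaw i x y z ->
  forall s, s \in S -> [/\ e i s, e x s, e y s & e z s].
Proof.
move=> iS C; have [[xy xz yz] [[nx ny nz] [ix iy iz]]] := C.
have yx : e y x by adjacency.
have zx : e z x by adjacency.
have zy : e z y by adjacency.
have xS : x \notin S by apply/negP => xS; apply: (no_coclaw_triangle xS C).
have yS : y \notin S.
  by apply/negP => yS; apply: (no_coclaw_triangle (i := i) (y := x) (z := z) yS).
have zS : z \notin S.
  by apply/negP => zS; apply: (no_coclaw_triangle (i := i) (y := x) (z := y) zS).
move=> s sS.
have two a b : a \notin S -> b \notin S -> e a b -> e a s || e b s.
  move=> aS bS ab; apply/negPn/negP; rewrite negb_or => /andP[/negbTE as_ /negbTE bs].
  by move: ab; rewrite (missing_stable sS aS bS).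
have three a b c : e a b -> e a c -> e b c -> e i a = false -> e i b = false -> e i c = false ->
    i != a -> i != b -> i != c -> c \notin S -> e a s -> e b s -> e c s.
  move=> ab ac bc ia ib ic nia nib nic cS as_ bs; by_contra cs.
  case is_: (e i s); first by apply: (G (p := a) (q := b) (x := s) (y := c) (z := i)); adjacency.
  have nis : i != s by apply: contraNneq iS => ->.
  have sc : s = c.
    by apply: (non_nbhd_diamond_free es ei F G P (z := i) (p := a) (q := b)); rewrite ?coNe //; adjacency.
  by move: cS; rewrite -sc sS.
have [xs ys zs] : [/\ e x s, e y s & e z s].
  case/orP: (two x y xS yS xy) => [xs|ys].
    case/orP: (two y z yS zS yz) => [ys|zs].
      by split=> //; apply: (three x y z).
    by split=> //; apply: (three x z y).
  case/orP: (two x z xS zS xz) => [xs|zs].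
    by split=> //; apply: (three x y z).
  by split=> //; apply: (three y z x).
split=> //; by_contra is_.
have nis : i != s by apply: contraNneq iS => ->.
by apply: (@no_coclaw_triangle i s x y sS); split; [split|split; split]; adjacency.
Qed.

(* In the complement, a coclaw at [i] is a claw all of whose vertices miss the
   clique [S]; the fork then confines the component of [i] in the complement to
   distance 3 and away from [S]. *)
Let no_coclaw i x y z : coclaw i x y z -> False.
Proof.
move=> C; have [iS|iS] := boolP (i \in S); first exact: (no_coclaw_in iS C).
have [[xy xz yz] [[nx ny nz] [ix iy iz]]] := C.
pose full v := forall s, s \in S -> e v s.
have full_cc a b c : coclaw i a b c -> [/\ full i, full a, full b & full c].
  by move=> C'; have H := no_coclaw_miss iS C'; split=> s sS; have [] := H s sS.
have [fi fx fy fz] := full_cc _ _ _ C.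
have two s : s \in S -> exists s', [/\ s' \in S, s' != s & e s s' = false].
  by move=> sS; have [s' [s'S ss' _]] := ex_third s s S2; exists s'; split=> //; rewrite st.
have notS v : full v -> v \notin S.
  by move=> fv; apply/negP => vS; have := fv v vS; rewrite ei.
pose miss w := exists2 s, s \in S & (w \notin S) && ~~ e w s.
have miss_or v : v \in S \/ full v \/ miss v.
  have [vS|vS] := boolP (v \in S); first by left.
  right; have [/exists_inP[s sS vs]|/exists_inPn H] := boolP [exists s in S, ~~ e v s].
    by right; exists s; rewrite ?vS.
  by left=> s /H; rewrite negbK.
have triple a b c w : e a b -> e a c -> e b c -> e i a = false -> e i b = false -> e i c = false ->
    full a -> full b -> full c -> miss w -> e i w.
  move=> ab ac bc ia ib ic fa fb fc [s sS /andP[wS /negbTE ws]]; by_contra iw.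
  have pair u v : e u v -> full u -> full v -> e i u = false -> e i v = false ->
      e w u -> e w v -> False.
    move=> uv fu fv iu iv wu wv; move: (fu s sS) (fv s sS) (fi s sS) => *.
    by apply: (G (p := u) (q := v) (x := s) (y := w) (z := i)); adjacency.
  have [s' [s'S s's _]] := two s sS; have ws' := hit wS sS s'S ws s's.
  have pair' u v : e u v -> full u -> full v -> e i u = false -> e i v = false ->
      e w u = false -> e w v = false -> False.
    move=> uv fu fv iu iv wu wv; move: (fu s' s'S) (fv s' s'S) (fi s' s'S) => *.
    have iw' : i = w.
      by apply: (nbhd_codiamond_free es ei F G P (h := s') (p := u) (q := v)); adjacency.
    by have := fi s sS; rewrite iw' ws.
  case wa: (e w a); case wb: (e w b); case wc: (e w c).
  - exact: (pair a b).
  - exact: (pair a b).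
  - exact: (pair a c).
  - exact: (pair' b c).
  - exact: (pair b c).
  - exact: (pair' a c).
  - exact: (pair' a b).
  - exact: (pair' a b).
have im w : miss w -> e i w by apply: (triple x y z).
pose Y := [set v | co e i v].
have YP v : v \in Y -> [/\ i != v, e i v = false & full v].
  rewrite inE => iv; have ivF := coF iv; split=> //; first exact: coneq iv.
  case: (miss_or v) => [vS|[//|mv]]; first by rewrite fi in ivF.
  by rewrite im in ivF.
have inY v : i != v -> e i v = false -> v \in Y by move=> nv iv; rewrite inE coNe.
have [xY yY zY] : [/\ x \in Y, y \in Y & z \in Y] by split; apply: inY.
have third a b c j : coclaw i a b c -> j \in Y -> j != c -> e j a -> e j b -> e j c.
  move=> [[ab ac bc] [[na nb nc] [ia ib ic]]] jY njc ja jb; have [nij ij _] := YP j jY.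
  by_contra jc; case/eqP: njc.
  by apply: (non_nbhd_diamond_free es ei F G P (z := i) (p := a) (q := b)); rewrite ?coNe //; adjacency.
have edge_hit a b j : a \in Y -> b \in Y -> e a b -> j \in Y -> e j a || e j b || (j == a) || (j == b).
  move=> aY bY ab jY; have [nia ia fa] := YP a aY; have [nib ib fb] := YP b bY.
  have [nij ij fj] := YP j jY; apply/negPn/negP; rewrite !negb_or -!andbA.
  move=> /and4P[/negbTE ja /negbTE jb _ _]; have [s [sS _ _]] := ex_third x x S2.
  move: (fa s sS) (fb s sS) (fj s sS) (fi s sS) => *.
  case/eqP: nij; apply: (nbhd_codiamond_free es ei F G P (h := s) (p := a) (q := b)); adjacency.
have complT a b c j : coclaw i a b c -> j \in Y -> [|| j == a, j == b, j == c | [&& e j a, e j b & e j c]].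
  move=> C' jY; have [[ab ac bc] [[na nb nc] [ia ib ic]]] := C'.
  have [aY bY cY] : [/\ a \in Y, b \in Y & c \in Y] by split; apply: inY.
  have [ba ca cb] : [/\ e b a, e c a & e c b] by split; adjacency.
  have [//|nja] := eqVneq j a; have [//|njb] := eqVneq j b; have [//|njc] := eqVneq j c.
  have C1 : coclaw i a c b by [].
  have C2 : coclaw i b c a by [].
  have := edge_hit a b j aY bY ab jY; have := edge_hit a c j aY cY ac jY.
  have := edge_hit b c j bY cY bc jY; rewrite (negbTE nja) (negbTE njb) (negbTE njc) !orbF /=.
  have := third a b c j C' jY njc; have := third a c b j C1 jY njb; have := third b c a j C2 jY nja.
  case: (e j a); case: (e j b); case: (e j c) => //=; by [move=> /(_ isT isT)|move=> _ /(_ isT isT)|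
    move=> _ _ /(_ isT isT)].
(* A vertex of [Y] outside the triangle sees all three of its vertices and can take the place of the
   third; [complT] for the new triangle then compares it with the rest of [Y]. *)
have Ycl : {in Y &, forall a b, a != b -> e a b}.
  move=> a b aY bY nab.
  have cl1 j : j \in Y -> j \notin [:: x; y; z] -> [/\ e j x, e j y & e j z].
    by move=> jY; have := complT x y z j C jY; rewrite !inE; do 3 case: eqP => //=; move=> *; apply/and3P.
  have cl2 j k : j \in Y -> k \in Y -> j != k -> j \notin [:: x; y; z] -> e j k.
    move=> jY kY njk jn; have [jx jy jz] := cl1 j jY jn; have [nij ij _] := YP j jY.
    have [xj yj] : e x j /\ e y j by split; adjacency.
    have Cj : coclaw i x y j by [].
    have := complT x y j k Cj kY; rewrite [k == j]eq_sym (negbTE njk).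
    case/or4P => // [/eqP->|/eqP->|/and3P[_ _ kj]] //; by adjacency.
  have [an|an] := boolP (a \notin [:: x; y; z]); first exact: cl2.
  have [bn|bn] := boolP (b \notin [:: x; y; z]); first by rewrite es cl2 // eq_sym.
  move: an bn nab; rewrite !negbK !inE => /or3P[]/eqP-> /or3P[]/eqP->; rewrite ?eqxx // => _; by adjacency.
have Y2 : 2 < #|Y|.
  have : #|[set x; y; z]| <= #|Y|.
    by apply/subset_leq_card/subsetP => v; rewrite !inE -orbA => /or3P[]/eqP->; rewrite coNe.
  apply: leq_trans; rewrite setUC cardsU1 !inE cards2.
  have nxy : x != y by apply: contraTneq xy => ->; rewrite ei.
  have nxz : z != x by apply: contraTneq xz => ->; rewrite ei.
  have nyz : z != y by apply: contraTneq yz => ->; rewrite ei.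
  by rewrite nxy negb_or nxz nyz.
have Ym j w : j \in Y -> miss w -> e j w.
  move=> jY mw; have [s sS /andP[wS /negbTE ws]] := mw; by_contra jw.
  have [s' [s'S s's ss']] := two s sS; have ws' := hit wS sS s'S ws s's.
  have [nij ij fj] := YP j jY; have iw := im w mw.
  have wu u : u \in Y -> u != j -> e w u.
    move=> uY uj; have [niu iu fu] := YP u uY; have ju := Ycl j u jY uY; rewrite eq_sym uj in ju.
    have {}ju := ju isT; by_contra wu.
    move: (fj s sS) (fj s' s'S) (fu s sS) (fu s' s'S) => *.
    by apply: (G (p := j) (q := u) (x := s') (y := s) (z := w)); adjacency.
  have [u [v [uY vY uj vj uv]]] := ex_two_more j Y2.
  have [_ iu _] := YP u uY; have [_ iv _] := YP v vY.
  move: (wu u uY uj) (wu v vY vj) (Ycl u v uY vY uv) (Ycl u j uY jY uj) (Ycl v j vY jY vj) => *.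
  by apply: (G (p := u) (q := v) (x := w) (y := j) (z := i)); adjacency.
pose Z := [set v | (e i v) && [exists j in Y, ~~ e v j]].
have ZP v : v \in Z -> [/\ e i v, full v & exists a b, [/\ a \in Y, b \in Y, a != b, e v a = false & e v b = false]].
  rewrite inE => /andP[iv /exists_inP[j jY /negbTE vj]].
  have [nij ij fj] := YP j jY; split=> //.
    case: (miss_or v) => [vS|[//|mv]]; first by rewrite es fj in vj.
    by rewrite es Ym in vj.
  have [a [b [aY bY aj bj ab]]] := ex_two_more j Y2.
  have [nia ia _] := YP a aY; have [nib ib _] := YP b bY.
  case va: (e v a); last by exists j, a; rewrite jY aY eq_sym aj.
  case vb: (e v b); last by exists j, b; rewrite jY bY eq_sym bj.
  move: (Ycl a b aY bY ab) (Ycl a j aY jY aj) (Ycl b j bY jY bj) => *.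
  by case: (G (p := a) (q := b) (x := v) (y := j) (z := i)); adjacency.
(* In the complement, [Y] and [Z] are the vertices at distance one and two from [i], and [U] is the
   ball of radius three. No nonedge leaves [U], and the element [s] of [S] lies outside. *)
pose U := [set v | [|| v == i, v \in Y, v \in Z | [exists u in Z, co e u v]]].
have iU : i \in U by rewrite !inE eqxx.
have [s [sS _ _]] := ex_third x x S2.
have sU : s \notin U.
  rewrite inE !negb_or; apply/and4P; split.
  - by apply: contraNneq iS => <-.
  - by apply/negP => sY; have [_ _ /notS/negP] := YP s sY.
  - by apply/negP => sZ; have [_ /notS/negP] := ZP s sZ.
  - by apply/exists_inPn => u uZ; have [_ fu _] := ZP u uZ; rewrite coE ?fu.
have [u [v [uU vU uv]]] := (prime_conn (co_sym es) (prime_co ei P)).2 U i s (in_setT _) iU (in_setT _) sU.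
move: uU vU; rewrite in_setI in_setD !in_setT /= andbT => uU.
rewrite [v \in U]inE !negb_or => /and4P[nvi vY vZ /exists_inPn v3].
have iv : e i v.
  by apply: cofalse; rewrite 1?eq_sym //; move: vY; rewrite inE => /negbTE.
have vYc j : j \in Y -> e v j.
  move=> jY; move: vZ; rewrite inE iv /= => /exists_inPn /(_ j jY).
  by rewrite negbK.
have uvF := coF uv.
move: uU; rewrite inE; case/or4P => [/eqP E|uY|uZ|/exists_inP[j jZ ju]].
- by rewrite E iv in uvF.
- by rewrite es vYc in uvF.
- by case/negP: (v3 u uZ).
- case uZ: (u \in Z); first by case/negP: (v3 u uZ).
  have [ij fj [a [b [aY bY ab ja jb]]]] := ZP j jZ.
  have ncov : e j v.
    apply: cofalse; last by apply/negbTE/v3.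
    by apply: contraFneq ja => ->; rewrite vYc.
  have uYc k : k \in Y -> e u k.
    move=> kY; by_contra uk; case iu: (e i u).
      by move/negP: uZ; case; rewrite inE iu; apply/exists_inP; exists k; rewrite ?uk.
    have uY : u \in Y.
      apply: inY => //; apply: contraTneq iv => ->.
      by rewrite uvF.
    by rewrite es vYc in uvF.
  move: (Ycl a b aY bY ab) (coF ju) (uYc a aY) (uYc b bY) (vYc a aY) (vYc b bY) => *.
  by apply: (G (p := a) (q := b) (x := v) (y := u) (z := j)); adjacency.
Qed.

Lemma wide_star_coclaw_free : coclaw_free e.
Proof.
move=> i x y z xy xz yz ix iy iz; apply: contrapT => ne.
apply: (@no_coclaw i x y z); split; [by split|split; last by split].
by split; apply: contra_not_neq ne => ->; constructor.
Qed.

End WideStarStructure.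

(** * Structure of prime graphs *)

Section DiamondCodiamond.
Variables (T : finType) (e : rel T).
Hypotheses (es : symmetric e) (ei : irreflexive e).
Hypotheses (CF : claw_free e) (CCF : coclaw_free e).

Let clawF v x y z : e v x -> e v y -> e v z -> e x y = false -> e x z = false ->
  e y z = false -> x <> y -> x <> z -> y <> z -> False.
Proof. by move=> vx vy vz xy xz yz; case: (CF vx vy vz xy xz yz). Qed.

Let coclawF v x y z : e v x = false -> e v y = false -> e v z = false -> e x y -> e x z ->
  e y z -> False.
Proof.
move=> vx vy vz xy xz yz; case: (CCF xy xz yz vx vy vz) => E.
- by rewrite E xy in vy.
- by rewrite E es xy in vx.
- by rewrite E es xz in vx.
Qed.

Let neq_row x y k : e x k -> e y k = false -> x <> y.
Proof. by move=> xk yk E; rewrite E yk in xk. Qed.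

Let neq_row' x y k : e x k = false -> e y k -> x <> y.
Proof. by move=> xk yk E; rewrite E yk in xk. Qed.

Ltac adjacency_or_neq := first [adjacency | match goal with k : _ |- ?x <> ?y =>
  solve [apply: (@neq_row x y k); adjacency | apply: (@neq_row' x y k); adjacency] end].

Section Diamond.
Variables (a b c d p q f g : T).
Hypotheses (ab : e a b) (ac : e a c) (ad : e a d) (bc : e b c) (bd : e b d)
  (cd : e c d = false) (ncd : c <> d).
Hypotheses (pq : e p q) (fg : e f g = false) (pf : e p f = false) (pg : e p g = false)
  (qf : e q f = false) (qg : e q g = false) (nfg : f <> g).

(** [not_both], [not_none] and [not_matched] exclude the ways in which the adjacent middle vertices
    [a], [b] of a diamond can see the isolated vertices [f], [g] of a codiamond: one of [f], [g] is
    seen by both, one of [a], [b] sees neither, or the two pairs are matched. Up to symmetry these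
    are all. *)
Lemma not_both : e a f -> e b f -> False.
Proof.
move=> af bf.
case ap : (e a p).
- have ag : e a g = false by apply/negP => n; apply: (@clawF a p f g); adjacency_or_neq.
  have bg : e b g by by_contra n; apply: (@coclawF g a b f); adjacency_or_neq.
  have aq : e a q = false by apply/negP => n; apply: (@coclawF g a p q); adjacency_or_neq.
  have bq : e b q by by_contra n; apply: (@coclawF q a b f); adjacency_or_neq.
  by apply: (@clawF b a q g); adjacency_or_neq.
- have bp : e b p by by_contra n; apply: (@coclawF p a b f); adjacency_or_neq.
  have bg : e b g = false by apply/negP => n; apply: (@clawF b p f g); adjacency_or_neq.
  have ag : e a g by by_contra n; apply: (@coclawF g a b f); adjacency_or_neq.
  have aq : e a q = false by apply/negP => n; apply: (@clawF a q f g); adjacency_or_neq.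
  have bq : e b q by by_contra n; apply: (@coclawF q a b f); adjacency_or_neq.
  by apply: (@coclawF g b p q); adjacency_or_neq.
Qed.

Lemma not_none : e a f = false -> e a g = false -> False.
Proof.
move=> af ag.
case cf : (e c f).
- case cg : (e c g).
  - have cp : e c p = false by apply/negP => n; apply: (@clawF c p f g); adjacency_or_neq.
    have cq : e c q = false by apply/negP => n; apply: (@clawF c q f g); adjacency_or_neq.
    case bf : (e b f).
    - have bp : e b p by by_contra n; apply: (@coclawF p b c f); adjacency_or_neq.
      have bq : e b q by by_contra n; apply: (@coclawF q b c f); adjacency_or_neq.
      have bg : e b g by by_contra n; apply: (@coclawF g b p q); adjacency_or_neq.
      by apply: (@clawF b p f g); adjacency_or_neq.
    - have df : e d f by by_contra n; apply: (@coclawF f a b d); adjacency_or_neq.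
      have bg : e b g by by_contra n; apply: (@clawF c b f g); adjacency_or_neq.
      have bp : e b p by by_contra n; apply: (@coclawF p b c g); adjacency_or_neq.
      have ap : e a p = false by apply/negP => n; apply: (@coclawF f a b p); adjacency_or_neq.
      have dp : e d p = false by apply/negP => n; apply: (@clawF d a p f); adjacency_or_neq.
      by apply: (@clawF b c d p); adjacency_or_neq.
  - have bg : e b g by by_contra n; apply: (@coclawF g a b c); adjacency_or_neq.
    have dg : e d g by by_contra n; apply: (@clawF b c d g); adjacency_or_neq.
    case df : (e d f).
    - have dp : e d p = false by apply/negP => n; apply: (@clawF d p f g); adjacency_or_neq.
      have bp : e b p by by_contra n; apply: (@coclawF p b d g); adjacency_or_neq.
      have ap : e a p by by_contra n; apply: (@clawF b a p g); adjacency_or_neq.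
      by apply: (@clawF d a f g); adjacency_or_neq.
    - have bf : e b f by by_contra n; apply: (@coclawF f a b d); adjacency_or_neq.
      by apply: (@clawF b a f g); adjacency_or_neq.
- have bf : e b f by by_contra n; apply: (@coclawF f a b c); adjacency_or_neq.
  have df : e d f by by_contra n; apply: (@clawF b c d f); adjacency_or_neq.
  case dg : (e d g).
  - have dp : e d p = false by apply/negP => n; apply: (@clawF d p f g); adjacency_or_neq.
    have bp : e b p by by_contra n; apply: (@coclawF p b d f); adjacency_or_neq.
    have ap : e a p by by_contra n; apply: (@clawF b a p f); adjacency_or_neq.
    by apply: (@clawF d a f g); adjacency_or_neq.
  - have bg : e b g by by_contra n; apply: (@coclawF g a b d); adjacency_or_neq.
    by apply: (@clawF b a f g); adjacency_or_neq.
Qed.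

Lemma not_matched : e a f -> e b f = false -> e a g = false -> e b g -> False.
Proof.
move=> af bf ag bg.
case ap : (e a p).
- have bp : e b p by by_contra n; apply: (@clawF a b p f); adjacency_or_neq.
  have aq : e a q = false by apply/negP => n; apply: (@coclawF g a p q); adjacency_or_neq.
  have bq : e b q = false by apply/negP => n; apply: (@clawF b a q g); adjacency_or_neq.
  have cq : e c q by by_contra n; apply: (@coclawF q a b c); adjacency_or_neq.
  have dq : e d q by by_contra n; apply: (@coclawF q a b d); adjacency_or_neq.
  have cg : e c g = false by apply/negP => n; apply: (@clawF c a q g); adjacency_or_neq.
  have cp : e c p = false by apply/negP => n; apply: (@coclawF g a c p); adjacency_or_neq.
  have cf : e c f = false by apply/negP => n; apply: (@coclawF g a c f); adjacency_or_neq.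
  have df : e d f by by_contra n; apply: (@clawF a c d f); adjacency_or_neq.
  by apply: (@clawF d b q f); adjacency_or_neq.
- have bp : e b p = false by apply/negP => n; apply: (@clawF b a p g); adjacency_or_neq.
  have cp : e c p by by_contra n; apply: (@coclawF p a b c); adjacency_or_neq.
  have dp : e d p by by_contra n; apply: (@coclawF p a b d); adjacency_or_neq.
  have cg : e c g = false by apply/negP => n; apply: (@clawF c a p g); adjacency_or_neq.
  have cf : e c f = false by apply/negP => n; apply: (@coclawF g a c f); adjacency_or_neq.
  have df : e d f by by_contra n; apply: (@clawF a c d f); adjacency_or_neq.
  by apply: (@clawF d b p f); adjacency_or_neq.
Qed.

End Diamond.

Lemma diamond_or_codiamond_free : diamond_free e \/ codiamond_free e.
Proof.
apply: contrapT => /not_orP[nd]; apply => p q f g pq fg pf pg qf qg.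
apply: contrapT => nfg; apply: nd => a b c d ab ac ad bc bd cd.
apply: contrapT => ncd; have [ba qp gf] : [/\ e b a, e q p & e g f = false] by split; adjacency.
have ngf : g <> f by move=> E; apply: nfg.
case af: (e a f); case bf: (e b f); case ag: (e a g); case bg: (e b g).
- by apply: (not_both (a := a) (b := b) (p := p) (q := q) (f := f) (g := g)).
- by apply: (not_both (a := a) (b := b) (p := p) (q := q) (f := f) (g := g)).
- by apply: (not_both (a := a) (b := b) (p := p) (q := q) (f := f) (g := g)).
- by apply: (not_both (a := a) (b := b) (p := p) (q := q) (f := f) (g := g)).
- by apply: (not_both (a := a) (b := b) (p := p) (q := q) (f := g) (g := f)).
- by apply: (not_none (a := b) (b := a) (c := c) (d := d) (p := p) (q := q) (f := f) (g := g)).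
- by apply: (not_matched (a := a) (b := b) (c := c) (d := d) (p := p) (q := q) (f := f) (g := g)).
- by apply: (not_none (a := b) (b := a) (c := c) (d := d) (p := p) (q := q) (f := f) (g := g)).
- by apply: (not_both (a := a) (b := b) (p := p) (q := q) (f := g) (g := f)).
- by apply: (not_matched (a := b) (b := a) (c := c) (d := d) (p := p) (q := q) (f := f) (g := g)).
- by apply: (not_none (a := a) (b := b) (c := c) (d := d) (p := p) (q := q) (f := f) (g := g)).
- by apply: (not_none (a := a) (b := b) (c := c) (d := d) (p := p) (q := q) (f := f) (g := g)).
- by apply: (not_both (a := a) (b := b) (p := p) (q := q) (f := g) (g := f)).
- by apply: (not_none (a := b) (b := a) (c := c) (d := d) (p := p) (q := q) (f := f) (g := g)).
- by apply: (not_none (a := a) (b := b) (c := c) (d := d) (p := p) (q := q) (f := f) (g := g)).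
- by apply: (not_none (a := a) (b := b) (c := c) (d := d) (p := p) (q := q) (f := f) (g := g)).
Qed.

End DiamondCodiamond.

Section PrimeStructure.
Variables (T : finType) (e : rel T).
Hypotheses (es : symmetric e) (ei : irreflexive e).

Lemma coclaw_free_co : coclaw_free e -> claw_free (co e).
Proof.
move=> H v x y z vx vy vz xy xz yz; apply: contrapT => ne.
have nxy : x != y by apply: contra_not_neq ne => ->; constructor.
have nxz : x != z by apply: contra_not_neq ne => ->; constructor.
have nyz : y != z by apply: contra_not_neq ne => ->; constructor.
have [] := H v x y z (cofalse nxy xy) (cofalse nxz xz) (cofalse nyz yz) (coF vx) (coF vy) (coF vz).
- by move=> E; move/coneq: vx; rewrite E eqxx.
- by move=> E; move/coneq: vy; rewrite E eqxx.
- by move=> E; move/coneq: vz; rewrite E eqxx.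
Qed.

Lemma codiamond_free_of_co : codiamond_free (co e) -> diamond_free e.
Proof.
move=> H p q x y pq px py qx qy xy; apply: contrapT => nxy.
have E := H x y p q (coN nxy xy) (coE pq).
suff pq' : p = q by rewrite pq' ei in pq.
by apply: E; apply: coE; adjacency.
Qed.

Lemma codiamond_free_co : codiamond_free e -> diamond_free (co e).
Proof.
move=> H p q x y pq px py qx qy xy; apply/eqP/negPn/negP => nxy.
have := H x y p q (cofalse nxy xy) (coF pq).
rewrite ![e x _]es ![e y _]es (coF px) (coF py) (coF qx) (coF qy) => /(_ erefl erefl erefl erefl) E.
by move/coneq: pq; rewrite E eqxx.
Qed.

Hypotheses (F : fork_free e) (G : kite_free e) (P : prime_graph e).

(** A claw in the graph or in its complement produces a wide star there, which settles the matter.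
    If neither has a claw, the graph has neither claw nor coclaw, and [diamond_or_codiamond_free]
    decides between the two outcomes. *)
Theorem prime_structure : claw_free e /\ diamond_free e \/
  claw_free (co e) /\ diamond_free (co e).
Proof.
have half (r : rel T) : symmetric r -> irreflexive r -> fork_free r -> kite_free r -> prime_graph r ->
    claw_free r \/ coclaw_free r /\ codiamond_free r.
  move=> rs ri Fr Gr Pr; have [|nc] := pselect (claw_free r); first by left.
  have [S [st ms hub]] := wide_star rs ri Fr Gr Pr nc.
  have S2 : 2 < #|S| by case: hub => [/ltnW|[]].
  have hub' : 3 < #|S| \/ exists h, dom r S h by case: hub => [|[]]; [left|right].
  right; split; first exact: (wide_star_coclaw_free rs ri Fr Gr Pr st S2 ms hub').
  exact: (wide_star_codiamond_free rs ri Fr Gr Pr st S2 ms).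
have [c1|[c1 c2]] := half e es ei F G P; last first.
  by right; split; [exact: coclaw_free_co|exact: codiamond_free_co].
have cs := co_sym es.
have [d1|[d1 d2]] := half (co e) cs (@co_irr _ e) (fork_free_co es G) (kite_free_co es F) (prime_co ei P);
  last first.
  by left; split=> //; apply: codiamond_free_of_co.
have cc : coclaw_free e.
  move=> v x y z xy xz yz vx vy vz; apply: contrapT => ne.
  have nvx : v <> x by move=> E; apply: ne; rewrite E; constructor.
  have nvy : v <> y by move=> E; apply: ne; rewrite E; constructor.
  have nvz : v <> z by move=> E; apply: ne; rewrite E; constructor.
  have [] := d1 v x y z (coN nvx vx) (coN nvy vy) (coN nvz vz) (coE xy) (coE xz) (coE yz).
  - by move=> E; rewrite E ei in xy.
  - by move=> E; rewrite E ei in xz.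
  - by move=> E; rewrite E ei in yz.
have [|cd] := diamond_or_codiamond_free es c1 cc; first by left.
by right; split=> //; apply: codiamond_free_co.
Qed.

End PrimeStructure.

(** * Colourings and clique minors *)

Definition touch (T : finType) (e : rel T) (A B : {set T}) :=
  exists x y, [/\ x \in A, y \in B & e x y].

Definition col (T : finType) (e : rel T) (A : {set T}) n :=
  exists2 f : T -> nat, forall x, x \in A -> f x < n &
    {in A &, forall x y, e x y -> f x <> f y}.

Definition model (T : finType) (e : rel T) (A : {set T}) n :=
  exists2 B : nat -> {set T}, forall i, i < n -> conn e (B i) /\ B i \subset A &
    forall i j, i < n -> j < n -> i <> j -> [disjoint B i & B j] /\ touch e (B i) (B j).

(** A common [n] expresses that the chromatic number is at most the Hadwiger number without
    mentioning either extremum. *)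
Definition hadwiger (T : finType) (e : rel T) (A : {set T}) :=
  exists2 n, col e A n & model e A n.

Lemma col_le (T : finType) (e : rel T) A m n : m <= n -> col e A m -> col e A n.
Proof. by move=> mn [f fm fe]; exists f => // x /fm xm; apply: leq_trans mn. Qed.

Lemma model_le (T : finType) (e : rel T) A m n : m <= n -> model e A n -> model e A m.
Proof.
move=> mn [B B1 B2]; exists B => [i im|i j im jm]; first by apply: B1; apply: leq_trans mn.
by apply: B2; [apply: leq_trans mn|apply: leq_trans mn].
Qed.

(** Used with branch sets as [C] to undo the replacement of a module by a clique, and with
    singletons as [C] to leave a subtype. *)
Lemma model_blowup (T' T : finType) (r : rel T') (e : rel T) (C : T' -> {set T})
    (A' : {set T'}) (A : {set T}) n :
  (forall x, x \in A' -> conn e (C x) /\ C x \subset A) ->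
  {in A' &, forall x y, x <> y -> [disjoint C x & C y]} ->
  {in A' &, forall x y, r x y -> touch e (C x) (C y)} ->
  model r A' n -> model e A n.
Proof.
move=> C1 C2 C3 [B B1 B2]; exists (fun i => \bigcup_(x in B i) C x) => [i iN|i j iN jN ij].
  have [[Bn0 cB] BA] := B1 i iN; have {}BA x : x \in B i -> x \in A' by apply: subsetP.
  split; last by apply/bigcupsP => x /BA /C1[].
  split=> [|U a b].
    have /set0Pn[x xB] := Bn0; have [[/set0Pn[y yC] _] _] := C1 x (BA x xB).
    by apply/set0Pn; exists y; apply/bigcupP; exists x.
  move=> /bigcupP[x xB ax] aU /bigcupP[y yB bY] bU.
  have cross z u v : z \in B i -> u \in C z -> u \in U -> v \in C z -> v \notin U ->
      exists u' v', [/\ u' \in (\bigcup_(x in B i) C x) :&: U,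
        v' \in (\bigcup_(x in B i) C x) :\: U & e u' v'].
    move=> zB uC uU vC vU; have [[_ cz] _] := C1 z (BA z zB).
    have [u' [v' [u'U v'U uv]]] := cz U u v uC uU vC vU.
    exists u', v'; move: u'U v'U; rewrite !inE => /andP[u'C ->] /andP[-> v'C].
    by split=> //=; rewrite ?andbT; apply/bigcupP; exists z.
  pose V := [set z | [exists u in C z, u \in U]].
  have xV : x \in V by rewrite inE; apply/exists_inP; exists a.
  have [yV|yV] := boolP (y \in V).
    by move: yV; rewrite inE => /exists_inP[u uC uU]; exact: (cross y u b).
  have [u [v [uV vV uv]]] := cB V x y xB xV yB yV.
  move: uV vV; rewrite !inE => /andP[uB /exists_inP[u1 u1C u1U]] /andP[/exists_inPn vU vB].
  have [a' [b' [a'C b'C ab]]] := C3 u v (BA u uB) (BA v vB) uv.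
  have [a'U|a'U] := boolP (a' \in U); last exact: (cross u u1 a').
  exists a', b'; rewrite !inE a'U vU //; split=> //=; rewrite ?andbT; apply/bigcupP.
    by exists u.
  by exists v.
have [_ BiA] := B1 i iN; have [_ BjA] := B1 j jN; have [dis [x [y [xB yB xy]]]] := B2 i j iN jN ij.
split.
  apply/pred0P => z /=; apply/negP => /andP[/bigcupP[u uB zu] /bigcupP[v vB zv]].
  have uv : u <> v by move=> E; move: (disjointFr dis uB); rewrite E vB.
  have := C2 u v (subsetP BiA u uB) (subsetP BjA v vB) uv.
  by move=> /disjointFr /(_ zu); rewrite zv.
have [u [v [uC vC uv]]] := C3 x y (subsetP BiA x xB) (subsetP BjA y yB) xy.
by exists u, v; split=> //; apply/bigcupP; [exists x|exists y].
Qed.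

Lemma model_sub (T : finType) (e : rel T) (A A' : {set T}) n :
  A \subset A' -> model e A n -> model e A' n.
Proof.
move=> sA [B B1 B2]; exists B => // i /B1[cB BA]; split=> //.
exact: subset_trans BA sA.
Qed.

Lemma model_clique (T : finType) (e : rel T) (K : {set T}) :
  {in K &, forall x y, x <> y -> e x y} -> model e K #|K|.
Proof.
move=> cl; have [K0|K0] := posnP #|K|; first by rewrite K0; exists (fun _ => set0).
have [x0 x0K] := card_gt0P K0.
exists (fun i => [set nth x0 (enum K) i]) => [i iN|i j iN jN ij].
  split; first exact: conn1.
  by rewrite sub1set -mem_enum mem_nth // -cardE.
have nij : nth x0 (enum K) i <> nth x0 (enum K) j.
  by move/eqP; rewrite nth_uniq -?cardE ?enum_uniq // => /eqP.
split; first by rewrite disjoints1 inE; apply/eqP.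
exists (nth x0 (enum K) i), (nth x0 (enum K) j); rewrite !inE !eqxx; split=> //.
by apply: cl => //; rewrite -mem_enum mem_nth // -cardE.
Qed.

Lemma col_card (T : finType) (e : rel T) (A : {set T}) : irreflexive e -> col e A #|A|.
Proof.
move=> ei; exists (fun x => index x (enum A)) => [x xA|x y xA yA exy E].
  by rewrite cardE index_mem mem_enum.
have xy : x = y by apply: (@index_inj _ x (enum A)) E; rewrite ?mem_enum.
by rewrite xy ei in exy.
Qed.

(** Vertices outside [A] are isolated instead of removed, which keeps the vertex type. As neither
    the fork nor the kite has an isolated vertex, being free of them has the same meaning as on the
    subtype. *)
Definition restr (T : finType) (e : rel T) (A : {set T}) : rel T :=
  fun x y => [&& x \in A, y \in A & e x y].

Lemma restr_fork_free (T : finType) (e : rel T) A : fork_free e -> fork_free (restr e A).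
Proof.
move=> F h a b c d; rewrite /restr.
move=> /and3P[hA aA ha] /and3P[_ bA hb] /and3P[_ cA hc] /and3P[_ dA cd].
by rewrite hA aA bA cA dA; exact: F.
Qed.

Lemma restr_kite_free (T : finType) (e : rel T) A : kite_free e -> kite_free (restr e A).
Proof.
move=> G p q x y z; rewrite /restr.
move=> /and3P[pA qA pq] /and3P[_ xA px] /and3P[_ yA py] /and3P[_ _ qx] /and3P[_ _ qy] xy.
by move=> /and3P[zA _ zx]; move: xy; rewrite pA qA xA yA zA => xy; exact: (G p q x y z).
Qed.

(** Two colourings are injective on a clique; renaming the colours of one makes them agree there, so
    that colourings can be glued along a clique cutset. *)
Lemma perm_match (T : finType) (C : finType) (f g : T -> C) (K : seq T) :
  {in K &, injective f} -> {in K &, injective g} ->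
  exists s : {perm C}, {in K, forall x, s (f x) = g x}.
Proof.
elim: K => [|x K IH] fi gi; first by exists 1%g.
have [|y z yK zK|s sP] := IH; first by move=> y z yK zK; apply: fi; rewrite inE ?yK ?zK orbT.
  by apply: gi; rewrite inE ?yK ?zK orbT.
have [xK|xK] := boolP (x \in K).
  by exists s => y; rewrite inE => /orP[/eqP->|]; exact: sP.
exists (s * tperm (s (f x)) (g x))%g => y; rewrite inE permM => /orP[/eqP->|yK].
  by rewrite tpermL.
have yx : y != x by apply: contraNneq xK => <-.
rewrite (sP y yK) tpermD //.
- rewrite -(sP y yK) (inj_eq perm_inj); apply: contraNneq yx => E.
  by apply/eqP/fi; rewrite ?inE ?eqxx ?yK ?orbT.
- apply: contraNneq yx => E.
  by apply/eqP/gi; rewrite ?inE ?eqxx ?yK ?orbT.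
Qed.

(** * Minimal counterexamples *)

Section MinimalCounterexample.
Variables (T : finType) (e : rel T).
Hypotheses (es : symmetric e) (ei : irreflexive e).
Hypotheses (F : fork_free e) (G : kite_free e).
Hypothesis IH : forall (r : rel T) (A : {set T}), symmetric r -> irreflexive r ->
  A <> [set: T] -> fork_free (restr r A) -> kite_free (restr r A) -> hadwiger r A.
Hypothesis nH : ~ hadwiger e [set: T].

Lemma proper_hadwiger (A : {set T}) x : x \notin A -> hadwiger e A.
Proof.
move=> xA; apply: IH => //; [|exact: restr_fork_free|exact: restr_kite_free].
by move=> E; rewrite E inE in xA.
Qed.

(** The rest of the graph has a colouring and a clique minor of a common size [n] by minimality. The
    set [S] adds [w] to both: [w] new colours, and [w] branch sets that touch every branch set of
    the rest because they dominate it. *)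
Lemma dominating_reduction (S : {set T}) (B : nat -> {set T}) w x0 : x0 \in S ->
  col e S w ->
  (forall i, i < w -> conn e (B i) /\ B i \subset S) ->
  (forall i j, i < w -> j < w -> i <> j -> [disjoint B i & B j] /\ touch e (B i) (B j)) ->
  (forall i x, i < w -> x \notin S -> exists2 y, y \in B i & e x y) -> False.
Proof.
move=> x0S [f fw fe] B1 B2 B3; apply: nH.
have [n [g gn ge] [C C1 C2]] : hadwiger e (~: S) by apply: (@proper_hadwiger _ x0); rewrite inE x0S.
have dom i j : i < w -> j < n -> [disjoint B i & C j] /\ touch e (B i) (C j).
  move=> iw jn; have [_ BS] := B1 i iw; have [[/set0Pn[x xC] _] CS] := C1 j jn; split.
    apply/pred0P => z /=; apply/negP => /andP[/(subsetP BS) zS /(subsetP CS)].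
    by rewrite inE zS.
  have [|y yB xy] := B3 i x iw; first by rewrite -in_setC (subsetP CS).
  by exists y, x; rewrite es.
exists (w + n).
  exists (fun x => if x \in S then f x else w + g x) => [x _|x y _ _ exy].
    case: ifP => xS; first by rewrite (leq_trans (fw x xS)) ?leq_addr.
    by rewrite ltn_add2l gn // inE xS.
  have ltf u v : u \in S -> f u <> w + g v.
    by move=> /fw fu E; rewrite E ltnNge leq_addr in fu.
  case: ifP => xS; case: ifP => yS; first exact: fe.
  - exact: ltf.
  - by move/esym; exact: ltf.
  - by move/addnI; apply: ge => //; rewrite inE ?xS ?yS.
exists (fun i => if i < w then B i else C (i - w)) => [i iN|i j iN jN ij].
  case: ltnP => iw; first by have [? _] := B1 i iw; split=> //; exact: subsetT.
  have [|? _] := C1 (i - w); last by split=> //; exact: subsetT.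
  by rewrite ltn_subLR.
have sub k : k < w + n -> w <= k -> k - w < n by move=> kN wk; rewrite ltn_subLR.
case: ltnP => iw; case: ltnP => jw.
- exact: B2.
- by apply: dom => //; exact: sub.
- have [] := dom j (i - w) jw (sub i iN iw); rewrite disjoint_sym => ? [x [y [? ? ?]]].
  by split=> //; exists y, x; rewrite es.
- apply: C2; try exact: sub.
  by move=> E; apply: ij; rewrite -(subnKC iw) -(subnKC jw) E.
Qed.

(** Compare the number [n] for the graph without [x] with the degree of [x]. If [n] exceeds the
    degree, a colour is left for [x]; otherwise [x] and its neighbours form a clique on at least
    [n.+1] vertices. *)
Lemma no_simplicial x : ~ {in [set y | e x y] &, forall a b, a <> b -> e a b}.
Proof.
move=> cl; apply: nH; have [|n [f fn fe] M] := @proper_hadwiger (~: [set x]) x; first by rewrite !inE eqxx.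
pose N := [set y | e x y]; have clx : {in x |: N &, forall a b, a <> b -> e a b}.
  move=> a b; rewrite !inE => /orP[/eqP->|xa] /orP[/eqP->|xb] // ab; first by rewrite es.
  by apply: cl; rewrite ?inE.
have xN : x \notin N by rewrite inE ei.
have [nN|Nn] := leqP n #|N|.
  exists n.+1.
    exists (fun y => if y == x then n else f y) => [y _|y z _ _ yz].
      by case: eqVneq => // yx; rewrite ltnS ltnW // fn // !inE.
    case: (eqVneq y x) => [yx|yx]; case: (eqVneq z x) => [zx|zx].
    - by rewrite yx zx ei in yz.
    - by move=> E; have := fn z; rewrite -E !inE zx ltnn => /(_ isT).
    - by move=> E; have := fn y; rewrite E !inE yx ltnn => /(_ isT).
    - by apply: fe; rewrite ?inE.
  apply: (model_le (n := #|x |: N|)); first by rewrite cardsU1 xN add1n ltnS.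
  exact: model_sub (subsetT _) (model_clique clx).
exists n; last exact: model_sub (subsetT _) M.
have [c cn cN] : exists2 c, c < n & forall y, y \in N -> f y <> c.
  pose used := [seq f y | y <- enum N].
  have [/allP all_used|/allPn[c]] := boolP (all (mem used) (iota 0 n)); last first.
    rewrite mem_iota add0n => /andP[_ cn] cu; exists c => // y yN E; case/negP: cu.
    by apply/mapP; exists y; rewrite ?mem_enum.
  have := uniq_leq_size (iota_uniq 0 n) all_used.
  by rewrite size_iota size_map -cardE leqNgt Nn.
exists (fun y => if y == x then c else f y) => [y _|y z _ _ yz].
  by case: eqVneq => // yx; rewrite fn // !inE.
case: (eqVneq y x) => [yx|yx]; case: (eqVneq z x) => [zx|zx].
- by rewrite yx zx ei in yz.
- by move/esym; apply: cN; rewrite inE -yx.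
- by apply: cN; rewrite inE es -zx.
- by apply: fe; rewrite ?inE.
Qed.

Lemma card_gt2 : 2 < #|T|.
Proof.
rewrite ltnNge; apply/negP => T2.
have [T0|/card_gt0P[x _]] := posnP #|T|.
  apply: nH; exists 0; last by exists (fun _ => set0).
  by exists (fun _ => 0) => // x; have := card0_eq T0 x; rewrite !inE.
apply: (@no_simplicial x) => a b; rewrite !inE => xa xb ab.
have : #|[set x; a; b]| <= #|T| by exact: max_card.
rewrite -setUA cardsU1 cards2 !inE.
have -> : a != b by apply/eqP.
have -> : (x == a) = false by apply: contraTF xa => /eqP->; rewrite ei.
have -> : (x == b) = false by apply: contraTF xb => /eqP->; rewrite ei.
by move=> T3; have := leq_trans T3 T2.
Qed.

(* If [X] has a colouring with [m] colours and a [K_m] minor, then replacing the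
   module [X] by a clique on [m] of its vertices keeps the graph fork- and kite-free, and both colourings and clique
   minors of the new graph lift back; no optimality of [m] is needed. *)
Lemma module_clique (X : {set T}) : is_module e X -> X <> [set: T] -> 1 < #|X| ->
  {in X &, forall a b, a <> b -> e a b}.
Proof.
move=> mX XT X1 a b aX bX nab; apply: contrapT => /negP/negbTE ab; apply: nH.
have [x0 x0X] : exists x0, x0 \notin X.
  apply: contrapT => no; apply: XT; apply/setP => x; rewrite inE.
  by apply: contrapT => /negP xX; apply: no; exists x.
have [m [f fm fe] [B B1 B2]] := proper_hadwiger x0X.
have m0 : 0 < m by apply: leq_ltn_trans (fm a aX).
(* One representative of each branch set; the default [x0] is never taken since branch sets are
   nonempty. *)
pose g (k : 'I_m) : T := if [pick x in B k] is Some x then x else x0.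
have gB (k : 'I_m) : g k \in B k.
  rewrite /g; case: pickP => // H; have [[/set0Pn[x xB] _] _] := B1 k (ltn_ord k).
  by have := H x; rewrite xB.
have BX (k : 'I_m) : B k \subset X by have [] := B1 k (ltn_ord k).
have Bdis (k l : 'I_m) y : y \in B k -> y \in B l -> k = l.
  move=> yk yl; apply/val_inj/eqP/negPn/negP => /eqP kl.
  by have [/disjointFr/(_ yk)] := B2 k l (ltn_ord k) (ltn_ord l) kl; rewrite yl.
have gi : injective g by move=> k l E; apply: (Bdis k l (g k)) => //; rewrite E.
pose X' := [set g k | k : 'I_m].
have X'X : X' \subset X by apply/subsetP => _ /imsetP[k _ ->]; exact: subsetP (BX k) _ (gB k).
have X'm : #|X'| = m by rewrite card_imset // card_ord.
(* If all of [X] were representatives, every branch set would be a single vertex, and [a] and [b]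
   would be adjacent because branch sets touch. *)
have [y0 y0X y0X'] : exists2 y, y \in X & y \notin X'.
  apply: contrapT => no; have XX' y : y \in X -> y \in X'.
    by move=> yX; apply: contrapT => /negP yX'; apply: no; exists y.
  have /imsetP[k _ ak] := XX' a aX; have /imsetP[l _ bl] := XX' b bX.
  have one (i : 'I_m) y : y \in B i -> y = g i.
    move=> yB; have /imsetP[j _ yj] := XX' y (subsetP (BX i) y yB).
    by rewrite yj; congr g; apply: (Bdis j i y); rewrite // yj.
  have kl : val k <> val l by move=> /val_inj E; apply: nab; rewrite ak bl E.
  have [_ [x [y [/one -> /one ->]]]] := B2 k l (ltn_ord k) (ltn_ord l) kl.
  by rewrite -ak -bl ab.
pose r : rel T := fun x y => e x y || [&& x \in X', y \in X' & x != y].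
pose A := ~: X :|: X'.
have rs : symmetric r by move=> x y; rewrite /r es [y == x]eq_sym andbCA.
have ri : irreflexive r by move=> x; rewrite /r ei eqxx !andbF.
have AX y : y \in A -> y \notin X' -> y \notin X by rewrite !inE => /orP[//|->].
pose R := restr r A.
have Rs : symmetric R by move=> x y; rewrite /R /restr rs andbCA.
have Rin x y : x \in X' -> y \in X' -> x <> y -> R x y.
  by move=> xX yX /eqP xy; rewrite /R /restr /r !inE xX yX xy !orbT.
have RA x y : R x y -> x \in A /\ y \in A by case/and3P.
have Rirr x : R x x = false by rewrite /R /restr ri !andbF.
have Rmod x y z : z \in A -> R x z -> R y z = false -> x \in X' -> y \in X' -> z \in X'.
  move=> zA xz yz xX' yX'; apply/negPn/negP => zX'; have zX := AX z zA zX'.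
  move: xz yz; rewrite /R /restr /r (negbTE zX') !andbF !orbF zA.
  have -> : x \in A by rewrite inE xX' orbT.
  have -> : y \in A by rewrite inE yX' orbT.
  rewrite /= => xz yz; suff : e z y by rewrite es yz.
  apply: (mX z x y zX (subsetP X'X x xX') (subsetP X'X y yX')).
  by rewrite es.
have inA x : x \in X' -> x \in A by move=> xX'; rewrite inE xX' orbT.
have twoIn x y : x \in X' -> y \in X' -> R x y = false -> x = y.
  by move=> xX' yX' xy; apply: contrapT => n; rewrite Rin in xy.
have Re x y : R x y -> ~~ ((x \in X') && (y \in X')) -> e x y.
  by move=> /and3P[_ _]; rewrite /r => /orP[//|/and3P[-> ->]].
have Rne x y : x \in A -> y \in A -> R x y = false -> e x y = false.
  by move=> xA yA; rewrite /R /restr xA yA /= /r => /norP[/negbTE].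
have tw x y z : x \in X' -> y \in X' -> R x z -> R y z = false -> y = z.
  move=> xX' yX' xz yz; apply: twoIn => //; have [_ zA] := RA _ _ xz; exact: (Rmod x y).
have eR x y : R x y -> (x \in X' -> y \in X' -> False) -> e x y.
  by move=> xy no; apply: Re => //; apply/negP => /andP[]; exact: no.
have FR : fork_free R.
  move=> h u v c d hu hv hc cd uv uc vc hd ud vd.
  have [hA uA] := RA _ _ hu; have [_ vA] := RA _ _ hv; have [cA dA] := RA _ _ cd.
  apply: contrapT => nuv.
  have e1 : e h u by apply: eR => // hX uX; apply: nuv; exact: (tw h u v).
  have e2 : e h v by apply: eR => // hX vX; apply: nuv; apply/esym/(tw h v u) => //; rewrite Rs.
  have e3 : e h c.
    apply: eR => // hX cX; have E : c = u by apply: (tw h c u) => //; rewrite Rs.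
    by rewrite -E cd in ud.
  have e4 : e c d.
    apply: eR => // cX dX; have E : d = h by apply: (tw c d h) => //; rewrite Rs.
    by rewrite E Rs hu in ud.
  by apply: nuv; apply: (F (h := h) (c := c) (d := d)) => //; apply: Rne.
have GR : kite_free R.
  move=> p q x y z pq px py qx qy xy zx zy zp zq.
  have [pA qA] := RA _ _ pq; have [_ xA] := RA _ _ px; have [_ yA] := RA _ _ py.
  have [zA _] := RA _ _ zx.
  have nxy : x <> y by move=> E; rewrite E zy in zx.
  have xno w : R w x -> R w y -> w \in X' -> x \in X' -> False.
    by move=> wx wy wX xX; apply: nxy; apply: (tw w x y).
  have yno w : R w x -> R w y -> w \in X' -> y \in X' -> False.
    by move=> wx wy wX yX; apply/nxy/esym/(tw w y x) => //; rewrite Rs.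
  have e1 : e p x by apply: eR => //; apply: xno.
  have e2 : e p y by apply: eR => //; apply: yno.
  have e3 : e q x by apply: eR => //; apply: xno.
  have e4 : e q y by apply: eR => //; apply: yno.
  have zno : z \in X' -> x \in X' -> False.
    move=> zX xX; have E : z = p by apply: (tw x z p) => //; rewrite Rs.
    by rewrite E pq in zq.
  have e5 : e z x by apply: eR.
  have n1 := Rne _ _ xA yA xy; have n2 := Rne _ _ zA yA zy; have n3 := Rne _ _ zA pA zp.
  have n4 := Rne _ _ zA qA zq.
  (* An edge [pq] inside [X'] may be new. It is replaced by an edge [uv] of the graph between the
     two branch sets; [x], [y] and [z] lie outside the module and do not see the difference. *)
  have [/andP[pX' qX']|npq] := boolP ((p \in X') && (q \in X')); last first.
    by apply: (G (p := p) (q := q) (x := x) (y := y) (z := z)) => //; exact: Re.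
  have [k _ pk] := imsetP pX'; have [l _ ql] := imsetP qX'.
  have kl : val k <> val l.
    by move=> /val_inj E; move: pq; rewrite pk ql E Rirr.
  have [_ [u [v [uB vB uv]]]] := B2 k l (ltn_ord k) (ltn_ord l) kl.
  have uX := subsetP (BX k) u uB; have vX := subsetP (BX l) v vB.
  have xX' : x \notin X' by apply/negP => xX'; exact: (xno p).
  have yX' : y \notin X' by apply/negP => yX'; exact: (yno p).
  have zX' : z \notin X'.
    apply/negP => zX'; have E : z = p; last by rewrite E pq in zq.
    by apply: twoIn.
  have pX := subsetP X'X p pX'.
  have sw w c : w \notin X -> c \in X -> e w c = e w p.
    by move=> wX cX; apply/idP/idP; apply: (mX w).
  have xX := AX x xA xX'; have yX := AX y yA yX'; have zX := AX z zA zX'.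
  apply: (G (p := u) (q := v) (x := x) (y := y) (z := z)) => //.
  - by rewrite es sw // es.
  - by rewrite es sw // es.
  - by rewrite es sw // es.
  - by rewrite es sw // es.
  - by rewrite sw.
  - by rewrite sw.
have AT : A <> [set: T].
  by move=> E; have := in_setT y0; rewrite -E !inE y0X (negbTE y0X').
have [n [f' fn' fe'] M] := IH rs ri AT FR GR.
have gX' (k : 'I_m) : g k \in X' by apply/imsetP; exists k.
have f'inj (k l : 'I_m) : f' (g k) = f' (g l) -> k = l.
  move=> E; apply/eqP/negPn/negP => kl; apply: (fe' (g k) (g l)) E; try exact: inA.
  by rewrite /r !gX' (inj_eq gi) kl orbT.
have fX x : x \in X -> {k : 'I_m | val k = f x} by move=> xX; exists (Ordinal (fm x xX)).
(* A vertex of [X] whose colour is [k] is identified with the representative [g k] and receives its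
   new colour. *)
pose rep x := if pselect (x \in X) is left xX then g (sval (fX x xX)) else x.
have repN x : x \notin X -> rep x = x by move=> nX; rewrite /rep; case: pselect => // xX; case/negP: nX.
have repX x : x \in X -> exists2 k : 'I_m, val k = f x & rep x = g k.
  by rewrite /rep; case: pselect => // xX _; exists (sval (fX x xX)); rewrite ?(svalP (fX x xX)).
have repA x : rep x \in A.
  have [xX|xX] := boolP (x \in X); last by rewrite repN // !inE xX.
  by have [k _ ->] := repX x xX; exact: inA.
exists n.
  exists (fun x => f' (rep x)) => [x _|x y _ _ xy]; first exact: fn'.
  have [xX|xX] := boolP (x \in X); have [yX|yX] := boolP (y \in X).
  - have [k kx ->] := repX x xX; have [l ly ->] := repX y yX.
    by move/f'inj => kl; apply: (fe x y xX yX xy); rewrite -kx -ly kl.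
  - apply: fe' => //; rewrite (repN y) // /r; have [k _ ->] := repX x xX.
    by rewrite es (mX y x) // ?(subsetP X'X) // es.
  - apply: fe' => //; rewrite (repN x) // /r; have [k _ ->] := repX y yX.
    by rewrite (mX x y) // (subsetP X'X).
  - by apply: fe' => //; rewrite !repN // /r xy.
pose C x := if [pick k : 'I_m | g k == x] is Some k then B k else [set x].
have CX (k : 'I_m) : C (g k) = B k.
  by rewrite /C; case: pickP => [l /eqP/gi -> //|/(_ k)]; rewrite eqxx.
have CN x : x \notin X' -> C x = [set x].
  by rewrite /C; case: pickP => // k /eqP <-; rewrite gX'.
apply: (model_blowup (C := C)) M => [x xA|x y xA yA xy|x y xA yA xy].
- split; last exact: subsetT.
  have [/imsetP[k _ ->]|xX'] := boolP (x \in X'); last by rewrite CN //; exact: conn1.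
  by rewrite CX; have [] := B1 k (ltn_ord k).
- have dis1 (k : 'I_m) z : z \in A -> z \notin X' -> [disjoint B k & [set z]].
    move=> zA zX'; rewrite disjoint_sym disjoints1; apply/negP => /(subsetP (BX k)).
    by apply/negP; apply: AX.
  have [/imsetP[k _ xk]|xX'] := boolP (x \in X'); have [/imsetP[l _ yl]|yX'] := boolP (y \in X').
  + rewrite xk yl !CX; have kl : val k <> val l by move=> /val_inj E; apply: xy; rewrite xk yl E.
    by have [] := B2 k l (ltn_ord k) (ltn_ord l) kl.
  + by rewrite xk CX CN //; exact: dis1.
  + by rewrite yl CX CN // disjoint_sym; exact: dis1.
  + by rewrite !CN // disjoints1 inE; apply/eqP.
- have t1 (k : 'I_m) z : z \in A -> z \notin X' -> e z (g k) -> exists2 u, u \in B k & e z u.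
    move=> zA zX' zk; exists (g k) => //.
  have [/imsetP[k _ xk]|xX'] := boolP (x \in X'); have [/imsetP[l _ yl]|yX'] := boolP (y \in X').
  + rewrite xk yl !CX; have kl : val k <> val l.
      by move=> /val_inj E; move: xy; rewrite xk yl E ri.
    by have [] := B2 k l (ltn_ord k) (ltn_ord l) kl.
  + move: xy; rewrite xk /r (negbTE yX') andbF orbF => ky; rewrite CX CN //.
    by exists (g k), y; rewrite inE.
  + move: xy; rewrite yl /r (negbTE xX') orbF => ky; rewrite CX CN //.
    by exists x, (g l); rewrite inE.
  + move: xy; rewrite /r (negbTE xX') orbF => xy; rewrite !CN //.
    by exists x, y; rewrite !inE.
Qed.

(** A proper module with two vertices is a clique, so it contains adjacent twins [x] and [x']. Since
    [x] is not simplicial, it has nonadjacent neighbours [a] and [b]. A largest set [M] of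
    neighbours of [x] that contains them and is connected in the complement is a module: a vertex
    mixed on it would be the pendant vertex of a kite with middle edge [xx']. But [M] is not a
    clique. *)
Lemma min_prime : prime_graph e.
Proof.
split; first exact: card_gt2.
move=> X mX X1; apply: contrapT => XT; have cl := module_clique mX XT X1.
have [x [x' [xX x'X xx']]] : exists x x', [/\ x \in X, x' \in X & x != x'].
  by move/card_gt1P: X1 => [x [x' [? ? ?]]]; exists x, x'.
have exx : e x x' by apply: cl => //; apply/eqP.
have tw v : v \notin X -> e v x = e v x' by move=> vX; apply/idP/idP; apply: (mX v).
pose N := [set y | e x y].
have xN : x \notin N by rewrite inE ei.
have x'N w : w \in N -> w != x' -> e x' w.
  rewrite inE => xw wx'; have [wX|wX] := boolP (w \in X); last by rewrite es -tw // es.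
  by apply: cl => // E; rewrite E eqxx in wx'.
apply: (@no_simplicial x) => a b aN bN nab; apply/negPn/negP => /negbTE ab.
have cs := co_sym es; have coab : co e a b by apply: coN.
pose good M := [/\ conn (co e) M, M \subset N, a \in M & b \in M].
have [|M [cM MN aM bM] max] := @ex_maxset _ good [set a; b].
  split; rewrite ?inE ?eqxx ?orbT //.
    by apply: (connU1 cs (conn1 _ b)); rewrite ?inE.
  by apply/subsetP => y /set2P[] ->.
have M1 : 1 < #|M| by apply/card_gt1P; exists a, b; split=> //; apply/eqP.
have x'M : x' \notin M.
  apply/negP => x'M; have [y yM] := conn_nbr cM M1 x'M.
  case/andP=> x'y; rewrite x'N //; first exact: subsetP MN y yM.
  by rewrite eq_sym.
have xM : x \notin M by apply/negP => /(subsetP MN); rewrite (negbTE xN).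
have clos v : v \in N -> v \notin M -> forall y, y \in M -> e v y.
  move=> vN vM y yM; apply/negPn/negP => /negbTE vy.
  have : #|v |: M| <= #|M|; last by rewrite cardsU1 vM ltnn.
  apply: max; split; rewrite ?inE ?aM ?bM ?orbT //.
    apply: (connU1 cs cM yM); apply: coNe => //; apply: contraNneq vM => -> //.
  by apply/subsetP => z; rewrite !inE => /orP[/eqP->|/(subsetP MN)]; [move: vN|]; rewrite inE.
have mM : is_module e M.
  move=> v y z vM yM zM vy; have [vN|vN] := boolP (v \in N); first exact: clos.
  have [->|vx] := eqVneq v x; first by have := subsetP MN z zM; rewrite inE.
  have vxF : e v x = false by move: vN; rewrite inE es => /negbTE.
  have vX : v \notin X by apply/negP => vX; move: vxF; rewrite cl //; exact/eqP.
  have vx'F : e v x' = false by rewrite -tw.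
  apply/negPn/negP => vz.
  have [||q [p [qM pM qp vq vp]]] := conn_split (v := v) cM.
  - by exists z => //; apply: coNe; [apply: contraNneq vM => ->|exact: negbTE].
  - by exists y => //; rewrite /co vy andbF.
  have evp : e v p by apply: cofalse vp; apply: contraNneq vM => ->.
  have inN c : c \in M -> e x c by move/(subsetP MN); rewrite inE.
  have x'c c : c \in M -> e x' c.
    by move=> cM'; apply: x'N; [exact: (subsetP MN)|apply: contraNneq x'M => <-].
  have pq := coF qp; have vq' := coF vq.
  move: (inN p pM) (inN q qM) (x'c p pM) (x'c q qM) => *.
  by apply: (G (p := x) (q := x') (x := p) (y := q) (z := v)); adjacency.
have MT : M <> [set: T] by move=> E; move: xM; rewrite E inE.
by have := module_clique mM MT M1 aM bM nab; rewrite ab.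
Qed.

Lemma clique_model (K : {set T}) : {in K &, forall x y, x <> y -> e x y} ->
  model e [set: T] #|K|.+1.
Proof.
move=> cl; pose R := ~: K.
have R0 : R != set0.
  apply/eqP => R0; have KT : K = [set: T] by rewrite -[K]setCK -/R R0 setC0.
  apply: nH; exists #|K|; first by rewrite KT; exact: col_card.
  exact: model_sub (subsetT _) (model_clique cl).
have nbr x : x \in K -> exists2 y, y \in R & e x y.
  move=> xK; apply: contrapT => no; apply: (@no_simplicial x) => a b; rewrite !inE => xa xb.
  have inK c : e x c -> c \in K.
    by move=> xc; apply: contrapT => cK; apply: no; exists c; rewrite ?inE //; apply/negP.
  by apply: cl; exact: inK.
have cR : conn e R.
  split=> // U x y xR xU yR yU; apply: contrapT => no; apply: nH.
  have noe u v : u \in R -> u \in U -> v \in R -> v \notin U -> e u v = false.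
    move=> uR uU vR vU; apply/negP => uv; apply: no; exists u, v.
    by rewrite in_setI in_setD uR uU vR vU.
  have [|n1 C1 M1] := @proper_hadwiger (K :|: (R :&: U)) y.
    by move: yR; rewrite !inE (negbTE yU) andbF orbF.
  have [|n2 C2 M2] := @proper_hadwiger (K :|: (R :\: U)) x.
    by move: xR; rewrite !inE xU /= orbF.
  pose n := maxn n1 n2; have {C1} [f fn fe] := col_le (leq_maxl n1 n2) C1.
  have {C2} [g gn ge] := col_le (leq_maxr n1 n2) C2.
  have xA : x \in K :|: (R :&: U) by rewrite in_setU in_setI xR xU orbT.
  have n0 : 0 < n by apply: leq_ltn_trans (fn x xA).
  have En : n = n.-1.+1 by rewrite prednK.
  pose f1 z : 'I_n.-1.+1 := inord (f z); pose g1 z : 'I_n.-1.+1 := inord (g z).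
  have KA z (W : {set T}) : z \in K -> z \in K :|: W by move=> zK; rewrite inE zK.
  have f1E z : z \in K :|: (R :&: U) -> val (f1 z) = f z.
    by move=> /fn zn; rewrite /f1 /= inordK // -En.
  have g1E z : z \in K :|: (R :\: U) -> val (g1 z) = g z.
    by move=> /gn zn; rewrite /g1 /= inordK // -En.
  (* A cut of [R] makes [K] a clique cutset. After the colours of [g] are permuted to agree with [f]
     on [K], the two colourings combine to one of the whole graph. *)
  have [s sP] : exists s : {perm 'I_n.-1.+1}, {in enum K, forall z, s (g1 z) = f1 z}.
    apply: perm_match => u v; rewrite !mem_enum => uK vK E; apply: contrapT => uv.
      by apply: (ge u v) (cl u v uK vK uv) _; rewrite -?g1E ?E ?KA.
    by apply: (fe u v) (cl u v uK vK uv) _; rewrite -?f1E ?E ?KA.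
  exists n; last first.
    rewrite /n; case: leqP => _; [exact: model_sub (subsetT _) M2|exact: model_sub (subsetT _) M1].
  exists (fun z => if z \in K :|: (R :&: U) then f z else val (s (g1 z))) => [z _|u v _ _ uv].
    by case: ifP => [/fn //|_]; apply: leq_trans (ltn_ord _) _; rewrite -En.
  have cover z : z \notin K :|: (R :&: U) -> z \in R :\: U.
    by rewrite !inE; case: (z \in K); case: (z \in U).
  have gneq u' v' : u' \in K :|: (R :\: U) -> v' \in K :|: (R :\: U) -> e u' v' ->
      val (s (g1 u')) <> val (s (g1 v')).
    move=> u'A v'A uv' /val_inj/perm_inj E; apply: (ge u' v') => //.
    by rewrite -!g1E // E.
  have mix u' v' : u' \in K :|: (R :&: U) -> v' \notin K :|: (R :&: U) -> e u' v' ->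
      f u' <> val (s (g1 v')).
    move=> u'A v'A uv'; have v'R := cover v' v'A.
    have u'K : u' \in K.
      move: u'A; rewrite in_setU => /orP[//|]; rewrite in_setI => /andP[u'R u'U].
      by move: v'R; rewrite in_setD => /andP[v'U v'R]; rewrite noe in uv'.
    rewrite -f1E // -sP ?mem_enum //; apply: gneq => //; first exact: KA.
    by rewrite in_setU v'R orbT.
  case: ifP => uA; case: ifP => vA.
  - exact: fe.
  - by apply: mix; rewrite ?vA.
  - by move/esym; apply: mix; rewrite ?uA // es.
  - by apply: gneq; rewrite // in_setU cover ?orbT ?uA ?vA.
have [B B1 B2] := model_clique cl.
have dom i : i < #|K| -> [disjoint B i & R] /\ touch e (B i) R.
  move=> iK; have [[/set0Pn[x xB] _] BK] := B1 i iK; split.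
    by rewrite disjoints_subset setCK.
  by have [y yR xy] := nbr x (subsetP BK x xB); exists x, y.
exists (fun i => if i < #|K| then B i else R) => [i iN|i j iN jN ij].
  case: ltnP => iK; last by split=> //; exact: subsetT.
  by have [? _] := B1 i iK; split=> //; exact: subsetT.
case: ltnP => iK; case: ltnP => jK.
- exact: B2.
- exact: dom.
- by have [] := dom j jK; rewrite disjoint_sym => ? [x [y [? ? ?]]]; split=> //; exists y, x; rewrite es.
- by case: ij; apply/eqP; rewrite eqn_leq (leq_trans _ jK) ?(leq_trans _ iK).
Qed.

End MinimalCounterexample.

(** * Complements of line graphs *)

(* In a line graph, [line] collects the edges through the common endpoint of
   the adjacent edges [x] and [y], provided the root graph has no triangle. *)
Section Lines.
Variables (T : finType) (L : rel T).
Hypotheses (Ls : symmetric L) (Li : irreflexive L) (DF : diamond_free L).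

Definition clique (U : {set T}) := {in U &, forall x y, x <> y -> L x y}.

Definition linear (U : {set T}) := forall v x y,
  v \notin U -> x \in U -> y \in U -> L v x -> L v y -> x = y.

Definition line x y := [set w | [|| w == x, w == y | L w x && L w y]].

Lemma mem_line1 x y : x \in line x y.
Proof. by rewrite inE eqxx. Qed.

Lemma mem_line2 x y : y \in line x y.
Proof. by rewrite inE eqxx orbT. Qed.

Lemma mem_line3 x y z : L x z -> L y z -> z \in line x y.
Proof. by move=> xz yz; rewrite inE Ls xz Ls yz !orbT. Qed.

Lemma line_clique x y : L x y -> clique (line x y).
Proof.
move=> xy a b; rewrite !inE => /or3P[/eqP->|/eqP->|/andP[ax ay]] /or3P[/eqP->|/eqP->|/andP[bx by_]] ab //.
- by rewrite Ls.
- by rewrite Ls.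
- by rewrite Ls.
- by_contra nab; case: ab; apply: (DF (p := x) (q := y)); adjacency.
Qed.

Lemma line_linear x y : L x y -> linear (line x y).
Proof.
move=> xy v a b vU aU bU va vb; apply: contrapT => nab.
have cl := line_clique xy; have ab := cl a b aU bU nab.
have all_ p : p \in line x y -> L v p.
  move=> pU; have [->//|/eqP pa] := eqVneq p a; have [->//|/eqP pb] := eqVneq p b.
  have [pa' pb'] := (cl p a pU aU pa, cl p b pU bU pb).
  by_contra vp; case/negP: vU; suff -> : v = p by [].
  by apply: (DF (p := a) (q := b)); adjacency.
by case/negP: vU; rewrite inE !all_ ?orbT // ?mem_line1 ?mem_line2.
Qed.

Lemma linear_meet U V v a b : clique V -> linear U -> v \in V -> v \notin U ->
  a \in U -> a \in V -> b \in U -> b \in V -> a = b.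
Proof.
move=> cV lU vV vU aU aV bU bV; apply: (lU v) => //.
  by apply: cV => // E; rewrite E aU in vU.
by apply: cV => // E; rewrite E bU in vU.
Qed.

Hypothesis CF : claw_free L.

(** A neighbour of [x] on neither line would form a claw at [x] with one further vertex from each
    line. *)
Lemma two_lines U V x u v w : clique U -> linear U -> clique V -> linear V ->
  (forall z, z \in U -> z \in V -> z = x) -> x \in U -> x \in V ->
  u \in U -> u <> x -> v \in V -> v <> x -> L x w -> w \in U \/ w \in V.
Proof.
move=> cU lU cV lV UV xU xV uU ux vV vx xw.
apply: contrapT => /not_orP[/negP wU /negP wV].
have nvU : v \notin U by apply/negP => vU; exact: vx (UV v vU vV).
have xu := cU x u xU uU (nesym ux); have xv := cV x v xV vV (nesym vx).
have uv : L u v = false.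
  by apply/negP => uv; case: ux; apply: (lU v) => //; rewrite Ls.
have uw : L u w = false.
  by apply/negP => uw; case: ux; apply: (lU w) => //; rewrite Ls.
have vw : L v w = false.
  by apply/negP => vw; case: vx; apply: (lV w) => //; rewrite Ls.
case: (CF xu xv xw uv uw vw) => E.
- by rewrite -E uU in nvU.
- by rewrite -E uU in wU.
- by rewrite -E vV in wV.
Qed.

End Lines.

Section CoLineGraph.
Variables (T : finType) (e : rel T).
Hypotheses (es : symmetric e) (ei : irreflexive e).
Hypotheses (F : fork_free e) (G : kite_free e).
Hypothesis IH : forall (r : rel T) (A : {set T}), symmetric r -> irreflexive r ->
  A <> [set: T] -> fork_free (restr r A) -> kite_free (restr r A) -> hadwiger r A.
Hypothesis nH : ~ hadwiger e [set: T].
Hypotheses (CF : claw_free (co e)) (DF : diamond_free (co e)).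

Let L := co e.
Let Ls : symmetric L := co_sym es.
Let Li : irreflexive L := @co_irr _ e.

Let LN x y : x <> y -> L x y = false -> e x y.
Proof. by move=> /eqP; exact: cofalse. Qed.

(** By linearity the [L]-edges between the private parts [U :\: V] and [V :\: U] form a matching, so
    [p3] and [q1] can be chosen such that neither has an [L]-neighbour in the other private part
    except possibly each other. Exchanging them makes [p1], [p2], [q1] and [q2], [q3], [p3]
    connected in [e]. Each set keeps two vertices of its line, and a vertex outside the line misses
    at most one of them in [e]. *)
Lemma two_large_lines U V : clique L U -> linear L U -> clique L V -> linear L V ->
  2 < #|U :\: V| -> 2 < #|V :\: U| -> False.
Proof.
move=> cU lU cV lV UV VU.
have [p3 [q1 [[p3U p3V q1V q1U] [Hp Hq]]]] : exists p q,
    [/\ p \in U, p \notin V, q \in V & q \notin U] /\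
    (forall p', p' \in U -> p' \notin V -> p' <> p -> L p' q = false) /\
    (forall q', q' \in V -> q' \notin U -> q' <> q -> L p q' = false).
  have [/exists_inP[p pU /exists_inP[q qV pq]]|/exists_inPn no] :=
    boolP [exists p in U :\: V, [exists q in V :\: U, L p q]].
    move: pU qV; rewrite !inE => /andP[pV pU] /andP[qU qV]; exists p, q; do !split=> //.
      move=> p' p'U p'V ne; apply/negP => p'q; apply: ne.
      by apply: (lU q) => //; rewrite Ls.
    by move=> q' q'V q'U ne; apply/negP => pq'; apply: ne; apply: (lV p).
  have no' p q : p \in U -> p \notin V -> q \in V -> q \notin U -> L p q = false.
    move=> pU pV qV qU; have pUV : p \in U :\: V by rewrite inE pV.
    by apply: contraNF (no p pUV) => pq; apply/exists_inP; exists q; rewrite ?inE ?qU.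
  have /card_gt0P[p pU] : 0 < #|U :\: V| by apply: leq_trans UV.
  have /card_gt0P[q qV] : 0 < #|V :\: U| by apply: leq_trans VU.
  move: pU qV; rewrite !inE => /andP[pV pU] /andP[qU qV]; exists p, q.
  by split=> //; split=> *; apply: no'.
have [p1 [p2 []]] := ex_two_more p3 UV; rewrite !inE.
move=> /andP[p1V p1U] /andP[p2V p2U] /eqP p13 /eqP p23 /eqP p12.
have [q2 [q3 []]] := ex_two_more q1 VU; rewrite !inE.
move=> /andP[q2U q2V] /andP[q3U q3V] /eqP q21 /eqP q31 /eqP q23.
have ne p q : p \in U -> q \notin U -> p <> q by move=> pU qU E; rewrite -E pU in qU.
have e11 : e p1 q1 by apply: LN; [exact: ne|exact: Hp].
have e21 : e p2 q1 by apply: LN; [exact: ne|exact: Hp].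
have e32 : e p3 q2 by apply: LN; [exact: ne|exact: Hq].
have e33 : e p3 q3 by apply: LN; [exact: ne|exact: Hq].
pose B i := if i == 0 then [set p1; p2; q1] else [set q2; q3; p3].
have cB0 : conn e [set p1; p2; q1].
  rewrite -setUA; apply: (@connU1 _ _ es _ _ q1); rewrite ?inE ?eqxx ?orbT //.
  by apply: (connU1 es (conn1 _ q1)); rewrite ?inE.
have cB1 : conn e [set q2; q3; p3].
  rewrite -setUA; apply: (@connU1 _ _ es _ _ p3); rewrite ?inE ?eqxx ?orbT //; last by adjacency.
  by apply: (connU1 es (conn1 _ p3)); rewrite ?inE //; adjacency.
have dis : [disjoint [set p1; p2; q1] & [set q2; q3; p3]].
  apply/pred0P => z /=; apply/negP; rewrite !inE -!orbA => /andP[].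
  by move=> /or3P[]/eqP-> /or3P[]/eqP E;
    first [by apply: (ne _ _ _ _ E) | by apply: (ne _ _ _ _ (esym E)) | by move/esym: E].
have tch : touch e [set p1; p2; q1] [set q2; q3; p3].
  case p1q2: (L p1 q2); last first.
    by exists p1, q2; rewrite !inE !eqxx ?orbT; split=> //; apply: LN => //; exact: ne.
  exists p1, q3; rewrite !inE !eqxx ?orbT; split=> //; apply: LN; first exact: ne.
  by apply/negP => p1q3; apply: q23; apply: (lV p1).
apply: (@dominating_reduction _ e es ei F G IH nH (U :|: V) B 2 p1); rewrite ?inE ?p1U //.
- exists (fun x => (x \notin U) : nat) => [x _|x y]; first by case: (_ \notin _).
  rewrite !inE => xS yS xy; have nxy : x <> y by move=> E; rewrite E ei in xy.
  case xU: (x \in U) xS; case yU: (y \in U) yS => //= yV xV _.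
    by have := cU x y xU yU nxy; rewrite /L coE.
  by have := cV x y xV yV nxy; rewrite /L coE.
- move=> [|i] _; rewrite /B /=; split=> //; apply/subsetP => z; rewrite !inE -orbA.
    by case/or3P => /eqP->; rewrite ?p1U ?p2U ?q1V ?orbT.
  by case/or3P => /eqP->; rewrite ?q2V ?q3V ?p3U ?orbT.
- move=> [|[|i]] [|[|j]] //= _ _ ij; rewrite /B /=; try by case: ij.
  by rewrite disjoint_sym; split=> //; case: tch => x [y [? ? ?]]; exists y, x; rewrite es.
- have dom W a b v : linear L W -> a \in W -> b \in W -> a <> b -> v \notin W -> e v a \/ e v b.
    move=> lW aW bW ab vW; have nv c : c \in W -> v <> c by move=> cW E; rewrite E cW in vW.
    case va: (L v a); last by left; apply: LN => //; exact: nv.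
    right; apply: LN; first exact: nv.
    by apply/negP => vb; apply: ab; apply: (lW v).
  move=> [|i] v _; rewrite inE negb_or /B /= => /andP[vU vV].
    by case: (dom U p1 p2 v lU p1U p2U p12 vU) => ?; [exists p1|exists p2]; rewrite ?inE ?eqxx ?orbT.
  by case: (dom V q2 q3 v lV q2V q3V q23 vV) => ?; [exists q2|exists q3]; rewrite ?inE ?eqxx ?orbT.
Qed.

Definition in_triangle y := exists a b, [/\ L y a, L y b & L a b].

(* A set outside [D] without simplicial vertex would be a union of components of
   the complement, because its vertices have only two neighbours there. *)
Lemma elimination (D : {set T}) d0 : d0 \in D -> (forall y, in_triangle y -> y \in D) ->
  exists n, col e (~: D) n /\ exists2 K : {set T}, K \subset ~: D &
    #|K| = n /\ {in K &, forall x y, x <> y -> e x y}.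
Proof.
move=> d0D tD.
suff H (Z : {set T}) : Z \subset ~: D -> exists n, col e Z n /\ exists2 K : {set T}, K \subset Z &
    #|K| = n /\ {in K &, forall x y, x <> y -> e x y} by exact: H.
have [N] := ubnP #|Z|; elim: N => // N IHN in Z *; rewrite ltnS => ZN ZD.
have [->|Z0] := eqVneq Z set0.
  exists 0; split; first by exists (fun _ => 0) => x; rewrite inE.
  by exists set0; rewrite ?sub0set // cards0; split=> // x y; rewrite inE.
have nD y : y \in Z -> y \notin D by move/(subsetP ZD); rewrite inE.
have [y yZ simp] : exists2 y, y \in Z & forall a b, a \in Z -> b \in Z -> L y a -> L y b ->
    a <> b -> L a b.
  apply: contrapT => no.
  have closed y c : y \in Z -> L y c -> c \in Z.
    move=> yZ yc; apply: contrapT => /negP cZ; apply: no; exists y => // a b aZ bZ ya yb ab.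
    by_contra nab; have tri u v : L y u -> L y v -> L u v = false.
      by move=> yu yv; apply/negP => uv; move: (nD y yZ); rewrite tD //; exists u, v.
    case: (CF ya yb yc nab (tri a c ya yc) (tri b c yb yc)) => // E.
      by rewrite -E aZ in cZ.
    by rewrite -E bZ in cZ.
  have /set0Pn[z zZ] := Z0.
  have d0Z : d0 \notin Z by apply/negP => /nD; rewrite d0D.
  have PL := prime_conn Ls (prime_co ei (min_prime es ei F G IH nH)).
  have [u [v [uZ vZ uv]]] := PL.2 Z z d0 (in_setT _) zZ (in_setT _) d0Z.
  move: uZ vZ; rewrite !inE /= andbT => uZ /negP; apply; exact: (closed u).
(* The vertex [y] and its nonneighbours in [Z] are stable, hence one colour class, while [y] extends
   every clique of the remaining set [Z']. *)
pose Z' := [set z in Z | e y z].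
have yZ' : y \notin Z' by rewrite inE ei andbF.
have Z'Z : Z' \subset Z by apply/subsetP => z; rewrite inE => /andP[].
have [||n [[f fn fe] [K KZ [Kn cK]]]] := IHN Z'.
- apply: leq_trans ZN; apply: proper_card; apply/properP; split=> //; by exists y.
- exact: subset_trans Z'Z ZD.
exists n.+1; split.
  exists (fun z => if z \in Z' then f z else n) => [z _|u v uZ vZ uv].
    by case: ifP => // /fn /ltnW; rewrite ltnS.
  case: ifP => uZ'; case: ifP => vZ'.
  - exact: fe.
  - by move=> E; have := fn u uZ'; rewrite E ltnn.
  - by move=> E; have := fn v vZ'; rewrite -E ltnn.
  - move: uZ' vZ'; rewrite !inE uZ vZ /= => yu yv _.
    have nyu : y <> u by move=> E; rewrite E uv in yv.
    have nyv : y <> v by move=> E; rewrite E es uv in yu.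
    have nuv : u <> v by move=> E; rewrite E ei in uv.
    by have := simp u v uZ vZ (coN nyu yu) (coN nyv yv) nuv; rewrite /L coE.
have yK : y \notin K by apply: contra yZ'; exact: subsetP.
have yKe z : z \in K -> e y z by move/(subsetP KZ); rewrite inE => /andP[].
exists (y |: K).
  apply/subsetP => z; rewrite !inE => /orP[/eqP->//|/(subsetP KZ)]; exact: subsetP.
split; first by rewrite cardsU1 yK Kn.
move=> u v; rewrite !inE => /orP[/eqP->|uK] /orP[/eqP->|vK] uv //.
- exact: yKe.
- by rewrite es yKe.
- exact: cK.
Qed.

Lemma co_line_graph_absurd : False.
Proof.
have card3 x y a b : a \in line L x y -> b \in line L x y -> L a b -> L x a -> L x b ->
    2 < #|line L x y|.
  move=> aU bU ab xa xb; have : #|[set x; a; b]| <= #|line L x y|.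
    by apply/subset_leq_card/subsetP => z; rewrite !inE -orbA => /or3P[]/eqP->; rewrite ?eqxx //;
      [move: aU|move: bU]; rewrite inE.
  apply: leq_trans; rewrite -setUA cardsU1 cards2 !inE.
  have -> : a != b by apply: contraTneq ab => ->; rewrite Li.
  have -> : (x == a) = false by apply: contraTF xa => /eqP->; rewrite Li.
  by have -> : (x == b) = false by apply: contraTF xb => /eqP->; rewrite Li.
(* Outside [D] the number of colours equals the size of a clique, so it suffices to treat [D] with
   [m.+1] more colours and [m.+1] more branch sets: one for a single line, two for a pair of
   lines. *)
have finish (D : {set T}) d0 m : d0 \in D -> (forall y, in_triangle y -> y \in D) ->
    (forall n, col e (~: D) n -> col e [set: T] (n + m.+1)) ->
    (forall K : {set T}, K \subset ~: D -> {in K &, forall x y, x <> y -> e x y} ->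
      model e [set: T] (#|K| + m.+1)) -> False.
  move=> d0D tD colD modD; have [n [cn [K KD [Kn cK]]]] := elimination d0D tD.
  by apply: nH; exists (n + m.+1); [exact: colD|rewrite -Kn; exact: modD].
have stableD (D : {set T}) n : clique L D -> col e (~: D) n -> col e [set: T] (n + 1).
  move=> cD [f fn fe]; rewrite addn1; exists (fun z => if z \in D then n else f z) => [z _|u v _ _ uv].
    by case: ifPn => // zD; rewrite ltnS ltnW // fn // inE.
  case: ifPn => uD; case: ifPn => vD.
  - have nuv : u <> v by move=> E; rewrite E ei in uv.
    by have := cD u v uD vD nuv; rewrite /L coE.
  - by move=> E; have := fn v; rewrite inE -E ltnn => /(_ vD).
  - by move=> E; have := fn u; rewrite inE E ltnn => /(_ uD).
  - by apply: fe; rewrite ?inE.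
have cm (K : {set T}) : {in K &, forall x y, x <> y -> e x y} -> model e [set: T] #|K|.+1.
  exact: (clique_model es ei F G IH nH).
have one_line U d0 : clique L U -> d0 \in U -> (forall y, in_triangle y -> y \in U) -> False.
  move=> cU d0U tU; apply: (finish U d0 0) => // [n|K KU cK].
    exact: stableD.
  by rewrite addn1; exact: cm.
have tri_line y a b : L y a -> L y b -> L a b ->
    exists U : {set T}, [/\ clique L U, linear L U, y \in U & 2 < #|U|].
  move=> ya yb ab; exists (line L y a); split; [exact: line_clique|exact: line_linear|exact: mem_line1|].
  apply: (card3 y a a b) => //; [exact: mem_line2|exact: mem_line3].
pose big U := [/\ clique L U, linear L U & 2 < #|U|].
have [[t0 [a0 [b0 [ta tb ab]]]]|notri] := pselect (exists t, in_triangle t); last first.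
  have /card_gt0P[a _] : 0 < #|T| by apply: leq_trans (card_gt2 es ei F G IH nH).
  apply: (one_line [set a] a); rewrite ?inE //.
    by move=> x y; rewrite !inE => /eqP-> /eqP->.
  by move=> y ty; case: notri; exists y.
have [U [cU lU _ U2]] := tri_line t0 a0 b0 ta tb ab.
have /card_gt0P[u0 u0U] : 0 < #|U| by apply: leq_trans U2.
have [tU|] := pselect (forall y, in_triangle y -> y \in U); first exact: (one_line U u0).
move=> /existsNP[y] /not_implyP[[a [b [ya yb yab]]] /negP yU].
have [V [cV lV yV V2]] := tri_line y a b ya yb yab.
(* Disjoint lines with three elements each would be private in full, contrary to
   [two_large_lines]. *)
have meet W W' : big W -> big W' -> exists2 z, z \in W & z \in W'.
  move=> [cW lW W2] [cW' lW' W2']; apply: contrapT => no.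
  have dis (A B : {set T}) : (forall z, z \in A -> z \notin B) -> A :\: B = A.
    by move=> H; apply/setP => z; rewrite inE; case zA: (z \in A); rewrite ?andbF ?andbT ?H.
  apply: (two_large_lines cW lW cW' lW'); rewrite dis // => z zW; apply/negP => zW'; apply: no; by exists z.
have [x xU xV] := meet U V (And3 cU lU U2) (And3 cV lV V2).
have UV z : z \in U -> z \in V -> z = x by move=> zU zV; apply: (linear_meet cV lU yV yU).
have [u [uU ux _]] := ex_third x x U2; have [v [vV vx _]] := ex_third x x V2.
move/eqP: ux => ux; move/eqP: vx => vx.
have Nx w : L x w -> w \in U :|: V.
  move=> xw; rewrite inE; apply/orP.
  by have := two_lines Ls CF cU lU cV lV UV xU xV uU ux vV vx xw.
(* A third large line [W] would meet [U] and [V] away from [x], and the three lines would be the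
   vertices of a triangle of the root graph; here this contradicts the linearity of [U]. *)
have tD z : in_triangle z -> z \in U :|: V.
  move=> [c [d [zc zd cd]]]; apply/negPn/negP; rewrite inE negb_or => /andP[zU zV].
  have [W [cW lW zW W2]] := tri_line z c d zc zd cd.
  have xW : x \notin W.
    apply/negP => xW; have nxz : x <> z by move=> E; rewrite -E xU in zU.
    by have := Nx z (cW x z xW zW nxz); rewrite inE (negbTE zU) (negbTE zV).
  have [w1 w1W w1U] := meet W U (And3 cW lW W2) (And3 cU lU U2).
  have [w2 w2W w2V] := meet W V (And3 cW lW W2) (And3 cV lV V2).
  have n1 : w1 <> x by move=> E; rewrite -E w1W in xW.
  have n2 : w2 <> x by move=> E; rewrite -E w2W in xW.
  have w2U : w2 \notin U by apply/negP => w2U; exact: n2 (UV w2 w2U w2V).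
  have n12 : w1 <> w2 by move=> E; rewrite -E w1U in w2U.
  by apply: n1; apply: (lU w2) => //; [exact: cW (nesym n12)|exact: cV n2].
apply: (finish (U :|: V) x 1) => [||n [f fn fe]|K KD cK] //; first by rewrite inE xU.
  have c1 : col e (~: V) (n + 1).
    rewrite addn1; exists (fun z => if z \in U then n else f z) => [z|s t].
      by rewrite inE => zV; case: ifPn => // zU; rewrite ltnS ltnW // fn // !inE negb_or zU.
    rewrite !inE => sV tV st; case: ifPn => sU; case: ifPn => tU.
    - have nst : s <> t by move=> E; rewrite E ei in st.
      by have := cU s t sU tU nst; rewrite /L coE.
    - by move=> E; have := fn t; rewrite !inE -E negb_or tU tV ltnn => /(_ isT).
    - by move=> E; have := fn s; rewrite !inE E negb_or sU sV ltnn => /(_ isT).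
    - by apply: fe; rewrite ?inE ?negb_or ?sU ?sV ?tU ?tV.
  by have := stableD V _ cV c1; rewrite -addnA.
(* All [L]-neighbours of [x] lie in [U :|: V], so [x] sees all of [K] in the graph. It supplies one
   of the two additional branch sets, and [clique_model] the other. *)
have xK : x \notin K by apply/negP => /(subsetP KD); rewrite !inE xU.
have -> : #|K| + 2 = #|x |: K|.+1 by rewrite cardsU1 xK addn2.
apply: cm => s t; have xe k : k \in K -> e x k.
  move=> kK; have := subsetP KD k kK; rewrite inE => kD; apply: LN.
    by move=> E; rewrite E kK in xK.
  by apply/negP => /Nx; rewrite (negbTE kD).
rewrite !inE => /orP[/eqP->|sK] /orP[/eqP->|tK] st //.
- exact: xe.
- by rewrite es xe.
- exact: cK.
Qed.

End CoLineGraph.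

(** * Vizing's theorem *)

(** With all degrees at most two, a path whose ends [a] and [b] have degree at most one fills its
    component; so [c] would be an inner vertex, with two neighbours. *)
Lemma three_ends (V : finType) (k : rel V) a b c :
  (forall x y z t, k x y -> k x z -> k x t -> [\/ y = z, y = t | z = t]) -> symmetric k ->
  (forall x y z, x \in [:: a; b; c] -> k x y -> k x z -> y = z) ->
  connect k a b -> connect k a c -> uniq [:: a; b; c] -> False.
Proof.
move=> k2 ks k1 /connectP[p0 p0k p0b] ac.
rewrite /= !inE andbT negb_or => /andP[/andP[ab nac] bc].
case/shortenP: p0k p0b => p pk pu _ pb {p0}.
have inner y : y \in p -> y = b \/ exists z t, [/\ z \in a :: p, t \in a :: p, k y z, k y t & z <> t].
  move=> yp; move: pk pu pb; case/splitPr: yp => p1 [|t p2] pk pu pb.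
    by left; move: pb; rewrite cats1 last_rcons.
  move: pk; rewrite cat_path /= => /and4P[_ k1' k2' _]; right; exists (last a p1), t.
  split=> //.
  - by have := mem_last a p1; rewrite !inE mem_cat => /orP[]->; rewrite ?orbT.
  - by rewrite inE mem_cat !inE eqxx !orbT.
  - by rewrite ks.
  - move=> E; move: pu; rewrite (cat_uniq (a :: p1)) => /and3P[_ /hasPn/(_ t) H _].
    by have := H; rewrite !inE eqxx orbT -E => /(_ isT); have := mem_last a p1; rewrite inE => ->.
have closed x y : x \in a :: p -> k x y -> y \in a :: p.
  rewrite inE => /orP[/eqP->|xp] xy.
    case: p pk pb {pu inner} => [|z p] /=; first by move=> _ E; rewrite E eqxx in ab.
    by move=> /andP[az _] _; rewrite (k1 a y z) ?inE ?eqxx ?orbT.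
  case: (inner x xp) => [xb|[z [t [zp tp xz xt zt]]]]; last first.
    by case: (k2 x y z t xy xz xt) => [->|->|].
  move: pk pu pb {inner}; case/splitPr: xp => p1 p2; rewrite xb => pk pu pb.
  have bz : k b (last a p1) by move: pk; rewrite cat_path /= ks => /and3P[].
  have -> : y = last a p1 by apply: (k1 b); rewrite ?inE ?eqxx ?orbT // -xb.
  by have := mem_last a p1; rewrite !inE mem_cat => /orP[]->; rewrite ?orbT.
have /connectP[q qk qc] := ac.
have cp : c \in a :: p.
  suff gen q' x : x \in a :: p -> path k x q' -> last x q' \in a :: p.
    by rewrite qc; apply: gen => //; exact: mem_head.
  elim: q' x => //= y q' IHq x xp /andP[xy qk']; apply: IHq => //; exact: closed xy.
move: cp; rewrite inE eq_sym (negbTE nac) /= => cp.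
case: (inner c cp) => [cb|[z [t [_ _ cz ct zt]]]]; first by rewrite cb eqxx in bc.
by apply: zt; apply: (k1 c); rewrite ?inE ?eqxx ?orbT.
Qed.

Lemma path_sub_tail (V : eqType) (k k' : rel V) x s :
  {in x :: s & s, forall y z, k y z -> k' y z} -> path k x s -> path k' x s.
Proof.
elim: s x => //= y s IH x H /andP[xy ys]; apply/andP; split.
  by apply: H; rewrite ?inE ?eqxx.
by apply: IH ys => a b aS bS; apply: H; rewrite inE ?aS ?bS orbT.
Qed.

Section Vizing.
Variables (V : finType) (r : rel V) (d : nat).
Hypotheses (rs : symmetric r) (ri : irreflexive r) (rd : forall u, #|[set v | r u v]| <= d).

Notation C := 'I_d.+1.
Implicit Types (c : V -> V -> option C) (u v w x y z : V) (a b : C).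

(** A partial edge colouring of [r]: [None] stands for an edge not yet coloured and for every
    non-edge. *)
Definition proper c := [/\ forall x y, c x y = c y x,
  forall x y a, c x y = Some a -> r x y &
  forall x y z a, c x y = Some a -> c x z = Some a -> y = z].

Definition missing c x a := [forall y, c x y != Some a].

(** Coloured edges stay coloured but may change their colour, as shifting a fan and swapping a Kempe
    chain do. *)
Definition extends c c' := forall x y, c x y -> c' x y.

Lemma missingP c x a y : missing c x a -> c x y <> Some a.
Proof. by move=> /forallP/(_ y)/eqP. Qed.

Lemma ex_missing c x : proper c -> exists a, missing c x a.
Proof.
move=> [_ cr cu]; apply/existsP; apply: contraT; rewrite negb_exists => /forallP H.
have /fin_all_exists[g gP] a : exists y, c x y = Some a.
  by have := H a; rewrite negb_forall => /existsP[y /negPn/eqP]; exists y.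
have gi : injective g by move=> a b E; move: (gP a); rewrite E gP => -[].
have := rd x; rewrite leqNgt => /negP; case.
rewrite -[d.+1]card_ord -(card_imset _ gi); apply: subset_leq_card.
by apply/subsetP => _ /imsetP[a _ ->]; rewrite inE; apply: cr (gP a).
Qed.

Definition update c u v o : V -> V -> option C := fun x y =>
  if ((x == u) && (y == v)) || ((x == v) && (y == u)) then o else c x y.

(** A step of a Vizing fan at [u]: the colour of [uy] is missing at the preceding fan vertex [x] and
    can be moved to the edge [ux]. *)
Definition fan_step c u x y := [exists a, (c u y == Some a) && missing c x a].

Lemma proper_update c u v a : proper c -> r u v -> missing c u a -> missing c v a ->
  proper (update c u v (Some a)).
Proof.
move=> [cs cr cu] uv ua va; rewrite /update; split=> [x y|x y b|x y z b].
- by rewrite orbC; case: ifP; rewrite // [(x == u) && _]andbC [(x == v) && _]andbC => ->.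
- by case: ifP => [/orP[]/andP[/eqP-> /eqP->] _|_]; [|rewrite rs|exact: cr].
- have nuv : u <> v by move=> E; rewrite E ri in uv.
  have no w : ((x == u) && (y == v)) || ((x == v) && (y == u)) \/
      ((x == u) && (z == v)) || ((x == v) && (z == u)) -> c x w <> Some a.
    by case=> /orP[]/andP[/eqP-> _]; exact: missingP.
  case: ifP => [h1|_]; case: ifP => [h2|_].
  + move=> _ _; case/orP: h1 => /andP[/eqP xu /eqP->]; case/orP: h2 => /andP[/eqP xv /eqP->] //.
      by case: nuv; rewrite -xu -xv.
    by case: nuv; rewrite -xu -xv.
  + by move=> [<-] /no; case; left.
  + by move=> + [ab]; rewrite -ab => /no; case; right.
  + exact: cu.
Qed.

Lemma proper_erase c u v : proper c -> proper (update c u v None).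
Proof.
move=> [cs cr cu]; rewrite /update; split=> [x y|x y b|x y z b].
- by rewrite orbC; case: ifP; rewrite // [(x == u) && _]andbC [(x == v) && _]andbC => ->.
- by case: ifP => // _; exact: cr.
- by case: ifP => // _; case: ifP => // _; exact: cu.
Qed.

(* The colours of the fan are shifted towards its origin [v]. *)
Lemma fan_shift s c u v b : proper c -> r u v -> c u v = None ->
  path (fan_step c u) v s -> uniq (v :: s) -> missing c u b -> missing c (last v s) b ->
  exists c', [/\ proper c', extends c c' & c' u v].
Proof.
elim: s => [|w s IH] in c v *; move=> pc uv cuv /= ps us ub lb.
  exists (update c u v (Some b)); split; first exact: proper_update.
  - by move=> x y; rewrite /update; case: ifP.
  - by rewrite /update !eqxx.
move: ps => /andP[/existsP[a /andP[/eqP cuw va]] ps].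
have [cs cr cu] := pc.
move: us; rewrite inE negb_or -andbA => /and3P[vw vs us].
have uw : r u w by apply: cr cuw.
have nuv : u != v by apply: contraTneq uv => ->; rewrite ri.
have nuw : u != w by apply: contraTneq uw => ->; rewrite ri.
(* The colour [a] of [uw] is moved to [uv], after which [uw] is the uncoloured edge of the shorter
   fan that starts at [w]. *)
pose c0 := update c u w None.
have c0uv : c0 u v = None.
  by rewrite /c0 /update cuv; case: ifP.
have pc0 : proper c0 by exact: proper_erase.
have sub0 x y a' : c0 x y = Some a' -> c x y = Some a' by rewrite /c0 /update; case: ifP.
have c0ua : missing c0 u a.
  apply/forallP => y; apply/eqP => E; have Ey := cu u y w a (sub0 _ _ _ E) cuw.
  by move: E; rewrite Ey /c0 /update !eqxx.
have c0va : missing c0 v a by apply/forallP => y; apply/eqP => /sub0; exact: missingP.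
pose c1 := update c0 u v (Some a).
have pc1 : proper c1 by exact: proper_update.
have c1uw : c1 u w = None.
  by rewrite /c1 /c0 /update !eqxx eq_sym (negbTE vw) (negbTE nuv) /=.
have keep x y a' : x != u -> x != v -> missing c x a' -> missing c1 x a'.
  move=> xu xv /forallP H; apply/forallP => z; rewrite /c1 /update (negbTE xu) (negbTE xv) /=.
  by rewrite /c0 /update; case: ifP.
have nu y : y \in w :: s -> y != u.
  rewrite inE => /orP[/eqP->|ys]; first by rewrite eq_sym.
  have : exists a, c u y = Some a.
    elim: s w ps ys {IH vw vs us uw nuw c0 c0uv pc0 sub0 c0ua c0va c1 pc1 c1uw keep cuw lb} => //= t s IHs w.
    move=> /andP[/existsP[a' /andP[/eqP ta' _]] ps]; rewrite inE => /orP[/eqP->|]; first by exists a'.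
    exact: IHs ps.
  by move=> [a' /cr]; apply: contraTneq => ->; rewrite ri.
have nv y : y \in w :: s -> y != v.
  by rewrite inE => /orP[/eqP->|ys]; [rewrite eq_sym|apply: contraNneq vs => <-].
have [| | |c' [pc' ext c'uw]] := IH c1 w pc1 uw c1uw _ us.
- apply: path_sub_tail ps => x y xs ys /existsP[a' /andP[/eqP cuy xa']]; apply/existsP; exists a'.
  have yws : y \in w :: s by rewrite inE ys orbT.
  rewrite keep ?nu ?nv // andbT; apply/eqP; rewrite -cuy /c1 /c0 /update !eqxx.
  have -> : (y == v) = false by apply/negbTE/nv.
  have -> : (y == w) = false by apply/negbTE; apply: contraTneq ys => ->; case/andP: us.
  by rewrite (negbTE nuv) (negbTE nuw).
- apply/forallP => z; apply/eqP; rewrite /c1 {1}/update; case: ifP => _.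
    by move=> [ab]; rewrite -ab in ub; exact: (missingP ub) cuw.
  by move/sub0; exact: missingP.
- by apply: keep => //; [exact: nu (mem_last _ _)|exact: nv (mem_last _ _)].
exists c'; split=> //; last by apply: ext; rewrite /c1 /update !eqxx.
move=> x y cxy; have [/orP[]/andP[/eqP-> /eqP->] //|nxy] := boolP (((x == u) && (y == w)) || ((x == w) && (y == u))).
  by have [cs' _ _] := pc'; rewrite cs'.
apply: ext; rewrite /c1 {1}/update; case: ifP => // _.
by rewrite /c0 /update (negbTE nxy).
Qed.

Definition swap a b : option C -> option C := fun o =>
  if o == Some a then Some b else if o == Some b then Some a else o.

Lemma swapK a b : involutive (swap a b).
Proof.
move=> o; rewrite /swap; have [->|oa] := eqVneq o (Some a).
  by rewrite eqxx; case: eqP => [[->]|].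
have [->|ob] := eqVneq o (Some b); first by rewrite eqxx.
by rewrite (negbTE oa) (negbTE ob).
Qed.

Lemma swapS a b o : (swap a b o : bool) = o.
Proof. by rewrite /swap; case: eqVneq => [->//|_]; case: eqVneq => [->|]. Qed.

Definition kempe_rel c a b : rel V := fun x y => (c x y == Some a) || (c x y == Some b).

Definition kempe c a b z : V -> V -> option C := fun x y =>
  if connect (kempe_rel c a b) z x then swap a b (c x y) else c x y.

Lemma kempe_sym c a b : proper c -> symmetric (kempe_rel c a b).
Proof. by move=> [cs _ _] x y; rewrite /kempe_rel cs. Qed.

(** An edge coloured [a] or [b] has both ends in the component or neither, and [swap] fixes all
    other colours; so testing only the end [x] in [kempe] still gives a symmetric colouring. *)
Lemma kempe_proper c a b z : proper c -> proper (kempe c a b z).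
Proof.
move=> pc; have [cs cr cu] := pc; have ks := kempe_sym a b pc; split.
- move=> x y; rewrite /kempe [c y x]cs.
  have [xy|xy] := boolP (kempe_rel c a b x y).
    have -> // : connect (kempe_rel c a b) z x = connect (kempe_rel c a b) z y.
    apply/idP/idP => H; apply: connect_trans H (connect1 _) => //; by rewrite ks.
  have -> : swap a b (c x y) = c x y; last by rewrite !if_same.
  by move: xy; rewrite /kempe_rel /swap; do 2 case: eqP.
- move=> x y a'; rewrite /kempe; case: ifP => _; last exact: cr.
  move=> E; have : c x y by rewrite -(swapS a b) E.
  by case E' : (c x y) => [a''|//] _; exact: cr E'.
- move=> x y w a'; rewrite /kempe; case: ifP => _; last exact: cu.
  move=> E1 E2; have E3 : c x y = swap a b (Some a') by rewrite -E1 swapK.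
  have E4 : c x w = swap a b (Some a') by rewrite -E2 swapK.
  by case: (swap a b (Some a')) E3 E4 (swapS a b (Some a')) => [a''|]; [move=> E3 E4 _; exact: cu E3 E4|].
Qed.

Lemma kempe_extends c a b z : extends c (kempe c a b z).
Proof. by move=> x y; rewrite /kempe; case: ifP; rewrite ?swapS. Qed.

Lemma kempe_out c a b z x y : ~~ connect (kempe_rel c a b) z x -> kempe c a b z x y = c x y.
Proof. by rewrite /kempe => /negbTE->. Qed.

Lemma kempe_missing_out c a b z x a' : ~~ connect (kempe_rel c a b) z x ->
  missing c x a' -> missing (kempe c a b z) x a'.
Proof. by move=> zx /forallP H; apply/forallP => y; rewrite kempe_out. Qed.

Lemma kempe_missing_other c a b z x a' : a' != a -> a' != b ->
  missing c x a' -> missing (kempe c a b z) x a'.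
Proof.
move=> na nb /forallP H; apply/forallP => y; rewrite /kempe /swap; case: ifP => _ //.
case: ifP => _; first by apply: contra nb => /eqP[->].
by case: ifP => _ //; apply: contra na => /eqP[->].
Qed.

Lemma kempe_missing_in c a b z : missing c z b -> missing (kempe c a b z) z a.
Proof.
move=> /forallP H; apply/forallP => y; rewrite /kempe connect0 /swap (negbTE (H y)).
case: (eqVneq (c z y) (Some a)) => [E|//]; apply/eqP => -[ba].
by have := H y; rewrite E ba eqxx.
Qed.

(** The fan grows until the colour [b] missing at its end [vs] leads back to a fan vertex [w]. Then
    [vs] and the vertex [v1] before [w] both miss [b], while [u] misses [a], so each of the three is
    an end of its [a]/[b] chain and they cannot share one component. Swapping a chain at [v1] or
    [vs] away from [u] makes [a] missing there and at [u], and the fan up to that vertex is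
    shifted. *)
Lemma fan_color s c u v : proper c -> r u v -> c u v = None ->
  path (fan_step c u) v s -> uniq (v :: s) ->
  exists c', [/\ proper c', extends c c' & c' u v].
Proof.
have [n] := ubnP (#|V| - size s); elim: n s => // n IHn s; rewrite ltnS => sn pc uv cuv ps us.
have [cs cr cu] := pc.
have [b lb] := ex_missing (last v s) pc; have [a ua] := ex_missing u pc.
have [ub|] := boolP (missing c u b); first exact: fan_shift ps us ub lb.
rewrite negb_forall => /existsP[w /negPn/eqP uw].
have wv : w != v by apply: contraTneq isT => E; rewrite -E uw in cuv.
have nab : b != a by apply: contraTneq ua => <-; apply/negP => /(missingP (y := w)).
have [ws|ws] := boolP (w \in s); last first.
  apply: (IHn (rcons s w)) => //.
  - rewrite size_rcons; apply: leq_trans sn.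
    have : size (v :: s) <= #|V| by rewrite -(card_uniqP us) max_card.
    by move=> /= sV; rewrite subnS prednK // subn_gt0.
  - rewrite rcons_path ps; apply/existsP; exists b; by rewrite uw eqxx.
  - by rewrite -rcons_cons rcons_uniq us inE negb_or wv ws.
move: ps us lb sn; case/splitPr: ws => s1 s2 ps us lb _.
move: (ps); rewrite cat_path /= => /and3P[ps1 /existsP[b' /andP[/eqP uw' l1b]] ps2].
move: uw'; rewrite uw => -[bb]; rewrite -{b'}bb in l1b.
move: lb; rewrite last_cat /= => lb.
have us1 : uniq (v :: s1) by move: us; rewrite (cat_uniq (v :: s1)) => /and3P[].
have ws1 : w \notin s1.
  by move: us; rewrite (cat_uniq (v :: s1)) => /and3P[_ /hasPn/(_ w)]; rewrite !inE eqxx negb_or => /(_ isT)/andP[].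
have ws2 : w \notin s2.
  by move: us; rewrite (cat_uniq (v :: s1)) => /and4P[].
pose k := kempe_rel c a b.
have ks : symmetric k by exact: kempe_sym.
have csym : connect_sym k by exact: sym_connect_sym.
pose vs := last w s2; pose v1 := last v s1.
have nvs : v1 != vs.
  move: us; rewrite (cat_uniq (v :: s1)) => /and3P[_ /hasPn H _].
  have := H vs (mem_last w s2); apply: contraNneq => <-; exact: mem_last.
have inr x : x \in v :: s1 ++ w :: s2 -> r u x.
  rewrite inE => /orP[/eqP->//|]; elim: (s1 ++ w :: s2) (v) ps => //= y t IHt x0 /andP[/existsP[a' /andP[/eqP uy _]] pt].
  rewrite inE => /orP[/eqP->|]; [exact: cr uy|exact: IHt pt].
have uin x : x \in v :: s1 ++ w :: s2 -> u != x.
  by move/inr; apply: contraTneq => <-; rewrite ri.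
have v1in : v1 \in v :: s1 ++ w :: s2.
  by have := mem_last v s1; rewrite !inE mem_cat => /orP[]->; rewrite ?orbT.
have vsin : vs \in v :: s1 ++ w :: s2.
  by rewrite inE mem_cat (mem_last w s2) !orbT.
have step_keep z x y : ~~ connect k z u -> y != w -> fan_step c u x y -> fan_step (kempe c a b z) u x y.
  move=> zu yw /existsP[a' /andP[/eqP uy xa']]; apply/existsP; exists a'.
  rewrite kempe_out // uy eqxx /=; apply: kempe_missing_other => //.
    by apply/eqP => E; rewrite E in uy; exact: missingP ua uy.
  by apply: contraNneq yw => E; apply/eqP; apply: (cu u y w b); rewrite // -E.
have path1 z : ~~ connect k z u -> path (fan_step (kempe c a b z) u) v s1.
  move=> zu; apply: path_sub_tail ps1 => x y _ ys; apply: step_keep => //.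
  by apply: contraNneq ws1 => <-.
have cn z : ~~ connect k z u -> kempe c a b z u v = None by move=> zu; rewrite kempe_out.
have fin c1 : (exists c', [/\ proper c', extends c1 c' & c' u v]) -> extends c c1 ->
    exists c', [/\ proper c', extends c c' & c' u v].
  by move=> [c' [p' e' u']] e1; exists c'; split=> // x y /e1/e'.
(* After a swap at [v1] the colour [b] of [uw] may be present at [v1], so only the fan before [w] is
   shifted. *)
have [v1u|v1u] := boolP (connect k v1 u); last first.
  apply: (fin (kempe c a b v1)); last exact: kempe_extends.
  apply: (@fan_shift s1 _ u v a) => //.
  - exact: kempe_proper.
  - exact: cn.
  - exact: path1.
  - exact: kempe_missing_out.
  - exact: kempe_missing_in.
have vsu : ~~ connect k vs u.
  apply/negP => vsu; apply: (@three_ends V k u v1 vs) => //.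
  - move=> x y z t; rewrite /k /kempe_rel.
    do 3 case/orP => /eqP ?; by [constructor 1; apply: (cu x y z a)|constructor 1; apply: (cu x y z b)|
      constructor 2; apply: (cu x y t a)|constructor 2; apply: (cu x y t b)|
      constructor 3; apply: (cu x z t a)|constructor 3; apply: (cu x z t b)].
  - move=> x y z; rewrite !inE /k /kempe_rel => H.
    have one a1 a2 : missing c x a1 -> forall y, (c x y == Some a1) || (c x y == Some a2) -> c x y = Some a2.
      by move=> /forallP m1 y'; rewrite (negbTE (m1 y')) => /eqP.
    have two a1 a2 y' : (c x y' == Some a1) || (c x y' == Some a2) -> (c x y' == Some a2) || (c x y' == Some a1).
      by rewrite orbC.
    case/or3P: H => /eqP xE.
    + have m : missing c x a by rewrite xE.
      by move=> /(one a b m) e1 /(one a b m) e2; exact: cu e1 e2.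
    + have m : missing c x b by rewrite xE.
      by move=> /two/(one b a m) e1 /two/(one b a m) e2; exact: cu e1 e2.
    + have m : missing c x b by rewrite xE.
      by move=> /two/(one b a m) e1 /two/(one b a m) e2; exact: cu e1 e2.
  - by rewrite csym.
  - by rewrite csym.
  - by rewrite /= !inE negb_or (uin v1) // (uin vs) // nvs.
(* The component of [vs] avoids [v1], so [b] stays missing at [v1] and the fan step from [v1] to [w]
   survives the swap. *)
have vsv1 : ~~ connect k vs v1.
  by apply: contra vsu => H; apply: connect_trans H v1u.
apply: (fin (kempe c a b vs)); last exact: kempe_extends.
apply: (@fan_shift (s1 ++ w :: s2) _ u v a) => //.
- exact: kempe_proper.
- exact: cn.
- rewrite cat_path /= path1 //=; apply/andP; split.
    apply/existsP; exists b; rewrite kempe_out // uw eqxx /=.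
    exact: kempe_missing_out.
  apply: path_sub_tail ps2 => x y _ ys; apply: step_keep => //.
  by apply: contraNneq ws2 => <-.
- exact: kempe_missing_out.
- by rewrite last_cat /=; apply: kempe_missing_in.
Qed.

Theorem vizing : exists c : V -> V -> C, (forall x y, c x y = c y x) /\
  forall x y z, r x y -> r x z -> c x y = c x z -> y = z.
Proof.
have [c [pc full]] : exists c, proper c /\ forall x y, r x y -> c x y.
  suff H (E : seq (V * V)) : exists c, proper c /\ forall x y, (x, y) \in E -> r x y -> c x y.
    have [c [pc Hc]] := H (enum {: V * V}); exists c; split=> // x y; apply: Hc.
    by rewrite mem_enum.
  elim: E => [|[u v] E [c [pc Hc]]]; first by exists (fun _ _ => None); split.
  have [uv|nuv] := boolP (r u v); last first.
    exists c; split=> // x y; rewrite inE => /orP[/eqP[-> ->]|]; last exact: Hc.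
    by rewrite (negbTE nuv).
  case cuv : (c u v) => [a|].
    exists c; split=> // x y; rewrite inE => /orP[/eqP[-> ->] _|]; last exact: Hc.
    by rewrite cuv.
  have [//|//|c' [pc' ext c'uv]] := @fan_color [::] c u v pc uv cuv.
  exists c'; split=> // x y; rewrite inE => /orP[/eqP[-> ->] //|xyE xy].
  by apply: ext; apply: Hc.
have [cs cr cu] := pc.
exists (fun x y => odflt ord0 (c x y)); split=> [x y|x y z xy xz]; first by rewrite cs.
have := full x y xy; have := full x z xz.
case xyE: (c x y) => [a|//]; case xzE: (c x z) => [b|//] _ _ /= E.
by apply: (cu x y z a); rewrite // E.
Qed.

End Vizing.

(** * Line graphs and the conclusion *)

Section LineGraph.
Variables (T : finType) (e : rel T).
Hypotheses (es : symmetric e) (ei : irreflexive e).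
Hypotheses (F : fork_free e) (G : kite_free e).
Hypothesis IH : forall (r : rel T) (A : {set T}), symmetric r -> irreflexive r ->
  A <> [set: T] -> fork_free (restr r A) -> kite_free (restr r A) -> hadwiger r A.
Hypothesis nH : ~ hadwiger e [set: T].
Hypotheses (CF : claw_free e) (DF : diamond_free e).

Let line_eq x y z : e x y -> e x z -> e y z -> line e x y = line e x z.
Proof.
move=> xy xz yz.
have sub y' z' : e x y' -> e x z' -> e y' z' -> line e x y' \subset line e x z'.
  move=> xy' xz' yz'; apply/subsetP => w; rewrite !inE => /or3P[->//|/eqP->|/andP[wx wy]].
    by rewrite [e y' x]es xy' yz' !orbT.
  rewrite wx /=; have [->|wz] := eqVneq w z'; first by rewrite orbT.
  rewrite (_ : e w z') ?orbT //; by_contra wz'; case/eqP: wz.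
  by apply: (DF (p := x) (q := y')); adjacency.
by apply/eqP; rewrite eqEsubset !sub //; adjacency.
Qed.

Let line_sym x y : line e x y = line e y x.
Proof. by apply/setP => w; rewrite !inE orbCA [_ && e w x]andbC. Qed.

(* The vertices of the root graph are the lines; a vertex [x] of the line graph
   is the edge joining the two lines through it. *)
Lemma line_graph_absurd : False.
Proof.
have two x : exists p : T * T, [/\ e x p.1, e x p.2, p.1 <> p.2 & e p.1 p.2 = false].
  apply: contrapT => no; apply: (no_simplicial es ei F G IH nH (x := x)) => a b; rewrite !inE.
  move=> xa xb ab; by_contra nab; apply: no; by exists (a, b).
have {two}[p pP] := fin_all_exists two.
pose U x := line e x (p x).1; pose V x := line e x (p x).2.
have UV x : U x <> V x.
  have [xa xb ab nab] := pP x => E; have := mem_line2 e x (p x).2; rewrite -/(V x) -E !inE.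
  rewrite [_ == x]eq_sym; case/or3P => [/eqP E'|/eqP E'|/andP[_]].
  - by rewrite -E' ei in xb.
  - exact: ab.
  - by rewrite es nab.
(* A neighbour of [x] that sees neither of the nonadjacent vertices [(p x).1] and [(p x).2] would
   form a claw with them; so only two lines pass through [x]. *)
have through x y : e x y -> line e x y = U x \/ line e x y = V x.
  have [xa xb ab nab] := pP x => xy.
  have [->|/eqP ya] := eqVneq y (p x).1; first by left.
  have [->|/eqP yb] := eqVneq y (p x).2; first by right.
  case ya': (e y (p x).1); first by left; apply: line_eq.
  case yb': (e y (p x).2); first by right; apply: line_eq.
  by case: (CF xy xa xb ya' yb' nab).
pose other x W := if W == U x then V x else U x.
have otherP x y : e x y -> line e x y <> other x (line e x y) /\
    forall z, z \in other x (line e x y) -> z <> x -> e x z -> line e x z = other x (line e x y).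
  move=> xy; have [xa xb _ _] := pP x.
  have ends t : e x t -> forall z, z \in line e x t -> z <> x -> e x z -> line e x z = line e x t.
    move=> xt z; rewrite inE => /or3P[/eqP->|/eqP->//|/andP[_ zt]] // zx xz.
    by apply: line_eq.
  rewrite /other; case: eqVneq => [->|/eqP ne]; first by split; [exact: UV|exact: ends].
  by split=> //; exact: ends.
pose r (W Z : {set T}) := (W != Z) && [exists x, ((W == U x) && (Z == V x)) || ((W == V x) && (Z == U x))].
have rs : symmetric r.
  move=> W Z; rewrite /r eq_sym; congr (_ && _); apply: eq_existsb => x.
  by rewrite orbC; congr (_ || _); rewrite andbC.
have ri : irreflexive r by move=> W; rewrite /r eqxx.
have r_other x y : e x y -> r (line e x y) (other x (line e x y)).
  move=> xy; have [/eqP ne _] := otherP x y xy; rewrite /r ne /=; apply/existsP; exists x.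
  rewrite /other; case: eqVneq => [_|nU]; first by rewrite eqxx.
  by case: (through x y xy) => E; [rewrite E eqxx in nU|rewrite E !eqxx orbT].
have cl0 : clique e set0 by move=> x; rewrite inE.
have [M cM maxM] := ex_maxset cl0.
have Ucl x : clique e (U x) by apply: line_clique => //; case: (pP x).
have Vcl x : clique e (V x) by apply: line_clique => //; case: (pP x).
(* The root edges at [W] are elements of the clique [W], so the degree of [W] is at most the size of
   a largest clique [M]. This gives Vizing's [#|M|.+1] colours, as many as [clique_model] yields
   branch sets. *)
have rd W : #|[set Z | r W Z]| <= #|M|.
  have [/existsP[Z0]|] := boolP [exists Z, r W Z]; last first.
    rewrite negb_exists => /forallP no; rewrite (eq_card0 (A := [set Z | r W Z])) // => Z.
    by rewrite inE; apply/negbTE.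
  move=> /andP[_ /existsP[x0 Wx0]].
  have cW : clique e W by case/orP: Wx0 => /andP[/eqP-> _].
  apply: leq_trans (maxM W cW); apply: leq_trans (leq_imset_card (fun x => other x W) W).
  apply: subset_leq_card; apply/subsetP => Z; rewrite inE => /andP[WZ /existsP[x Wx]].
  apply/imsetP; exists x.
    by case/orP: Wx => /andP[/eqP-> _]; exact: mem_line1.
  rewrite /other; case/orP: Wx => /andP[/eqP WE /eqP->]; first by rewrite WE eqxx.
  by rewrite WE; case: eqVneq => // E; case: (UV x).
have [c [cs cu]] := vizing rs ri rd.
apply: nH; exists #|M|.+1; last exact: (clique_model es ei F G IH nH cM).
exists (fun x => val (c (U x) (V x))) => [x _|x y _ _ xy]; first exact: ltn_ord.
have color x1 y1 : e x1 y1 -> c (U x1) (V x1) = c (line e x1 y1) (other x1 (line e x1 y1)).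
  rewrite /other; case: eqVneq => [->//|nU] x1y1.
  by case: (through x1 y1 x1y1) => E; [rewrite E eqxx in nU|rewrite E cs].
have yx : e y x by rewrite es.
move/val_inj; rewrite (color x y xy) (color y x yx) [line e y x]line_sym => E.
have [ne1 H1] := otherP x y xy; have := r_other y x yx; have := r_other x y xy.
rewrite [line e y x]line_sym => r1 r2; have OO := cu _ _ _ r1 r2 E.
(* Equal colours force the second lines of [x] and [y] to coincide. Then [y] lies on both lines
   through [x], which would therefore be equal. *)
have yO : y \in other x (line e x y).
  by rewrite OO /other; case: ifP => _; exact: mem_line1.
by case: ne1; apply: H1 => // yx'; rewrite yx' ei in xy.
Qed.

End LineGraph.

(** * Induction on the number of vertices and passage to minors of [sgraph] *)

Lemma hadwiger_subtype (T : finType) (e : rel T) (A : {set T}) :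
  hadwiger (fun x y : {x | x \in A} => e (val x) (val y)) [set: {x | x \in A}] -> hadwiger e A.
Proof.
move=> [n [f fn fe] M]; exists n.
  exists (fun x => if insub x is Some y then f y else 0) => [x xA|x y xA yA xy].
    by rewrite insubT; apply: fn.
  by rewrite !insubT; apply: fe.
apply: (model_blowup (C := fun y : {x | x \in A} => [set val y])) M => [x _|x y _ _ xy|x y _ _ xy].
- by split; [exact: conn1|rewrite sub1set; exact: valP].
- by rewrite disjoints1 inE; apply/eqP => /val_inj.
- by exists (val x), (val y); rewrite !inE.
Qed.

Lemma restr_val (T : finType) (e : rel T) (A : {set T}) (x y : {x | x \in A}) :
  restr e A (val x) (val y) = e (val x) (val y).
Proof. by case: x y => [x xA] [y yA]; rewrite /restr /= xA yA. Qed.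

Theorem fork_kite_free_hadwiger (T : finType) (e : rel T) : symmetric e -> irreflexive e ->
  fork_free e -> kite_free e -> hadwiger e [set: T].
Proof.
have [n] := ubnP #|T|; elim: n T e => // n IHn T e; rewrite ltnS => Tn es ei F G.
apply: contrapT => nH.
have IH (r : rel T) (A : {set T}) : symmetric r -> irreflexive r ->
    A <> [set: T] -> fork_free (restr r A) -> kite_free (restr r A) -> hadwiger r A.
  move=> rs ri AT Fr Gr; apply: hadwiger_subtype; apply: IHn => [| | |h a b c d|p q x y z].
  - rewrite card_sig; apply: leq_trans Tn; rewrite -cardsT; apply: proper_card.
    rewrite properEneq subsetT andbT; apply/eqP => E; apply: AT; apply/setP => x.
    by move/setP/(_ x): E; rewrite !inE.
  - by move=> x y; exact: rs.
  - by move=> x; exact: ri.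
  - by move: (Fr (val h) (val a) (val b) (val c) (val d)); rewrite !restr_val => H *; apply/val_inj/H.
  - by move: (Gr (val p) (val q) (val x) (val y) (val z)); rewrite !restr_val.
have P := min_prime es ei F G IH nH.
have [[CF DF]|[CF DF]] := prime_structure es ei F G P.
  exact: (line_graph_absurd es ei F G IH nH CF DF).
exact: (co_line_graph_absurd es ei F G IH nH CF DF).
Qed.

Lemma conn_image (T T' : finType) (e : rel T) (e' : rel T') (p : T -> T') (S : {set T}) :
  {in S &, forall x y, e x y -> p x <> p y -> e' (p x) (p y)} -> conn e S -> conn e' (p @: S).
Proof.
move=> pe [/set0Pn[x0 x0S] cS]; split.
  by apply/set0Pn; exists (p x0); apply: imset_f.
move=> U _ _ /imsetP[x xS ->] xU /imsetP[y yS ->] yU.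
have [||u [v [uU vU uv]]] := cS (p @^-1: U) x y xS _ yS; rewrite ?inE //.
move: uU vU; rewrite !inE => /andP[uS pu] /andP[pv vS]; exists (p u), (p v).
rewrite !inE pu pv !imset_f //; split=> //; apply: pe => // E.
by rewrite -E pu in pv.
Qed.

(** By induction on the number of vertices: a vertex outside all branch sets is deleted, and an edge
    inside a branch set is contracted. When neither is possible, the branch sets are single vertices
    that exhaust the graph, and any two of them touch. *)
Lemma model_minor (H : sgraph) n : model (@adj H) [set: H] n -> minor (complete n) H.
Proof.
have [m] := ubnP #|H|; elim: m H => // m IHm H; rewrite ltnS => Hm [B B1 B2].
have cardC (v : H) : #|{: {x : H | x \in [set~ v]}}| < m.
  rewrite card_sig; apply: leq_trans Hm; rewrite (@eq_card _ _ [set~ v]) //.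
  by rewrite cardsC1 prednK // (cardD1 v).
have dis i j x : i < n -> j < n -> x \in B i -> x \in B j -> i = j.
  move=> iN jN xi xj; apply/eqP/negPn/negP => /eqP ij.
  by have [/disjointFr/(_ xi)] := B2 i j iN jN ij; rewrite xj.
have [[v vB]|cover] := pselect (exists v, forall i, i < n -> v \notin B i).
  apply: (minor_del_vertex (v := v)); apply: IHm; first exact: cardC.
  have inC i x : i < n -> x \in B i -> x \in [set~ v].
    by move=> iN xB; rewrite !inE; apply: contraNneq (vB i iN) => <-.
  exists (fun i => [set x : del_vertex v | val x \in B i]) => [i iN|i j iN jN ij].
    have [[/set0Pn[x xB] cB] _] := B1 i iN; split; last exact: subsetT.
    split=> [|U a b]; first by apply/set0Pn; exists (exist _ x (inC i x iN xB)); rewrite inE.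
    rewrite !inE => aB aU bB bU.
    have mem (z : del_vertex v) : (val z \in val @: U) = (z \in U).
      by rewrite mem_imset //; exact: val_inj.
    have [||u [w [uU wU uw]]] := cB (val @: U) (val a) (val b) aB _ bB; rewrite ?mem //.
    move: uU wU; rewrite in_setI in_setD => /andP[uB uU] /andP[wU wB].
    pose u' : del_vertex v := exist _ u (inC i u iN uB).
    pose w' : del_vertex v := exist _ w (inC i w iN wB).
    exists u', w'; rewrite !inE -(mem u') -(mem w') /= uB wB uU wU; split=> //.
  have [_ [x [y [xB yB xy]]]] := B2 i j iN jN ij; split.
    apply/pred0P => z /=; apply/negP; rewrite !inE => /andP[zi zj].
    exact: ij (dis i j (val z) iN jN zi zj).
  exists (exist _ x (inC i x iN xB)), (exist _ y (inC j y jN yB)).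
  by rewrite !inE.
have [[i [iN Bi]]|single] := pselect (exists i, i < n /\ 1 < #|B i|).
  have [cB _] := B1 i iN; have /card_gt0P[v vB] : 0 < #|B i| by apply: ltnW.
  have [u uB vu] := conn_nbr cB Bi vB; have uv : adj u v by rewrite adj_sym.
  apply: (minor_contract uv); apply: IHm; first exact: cardC.
  have uC : u \in [set~ v] by rewrite !inE; apply: contraTneq uv => ->; rewrite adj_irrefl.
  (* The contraction map: the default value of [insubd] sends [v] to [u], and all other vertices
     stay. *)
  pose p (x : H) : contract u v := insubd (exist _ u uC) x.
  have pv : val (p v) = u by rewrite val_insubd !inE eqxx.
  have pN x : x != v -> val (p x) = x by move=> xv; rewrite val_insubd !inE xv.
  have pe x y : adj x y -> p x <> p y -> adj (p x) (p y).
    move=> xy pxy; rewrite /= /contract_rel; have -> /= : p x != p y by apply/eqP.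
    have [xv|xv] := eqVneq x v; have [yv|yv] := eqVneq y v.
    - by rewrite xv yv adj_irrefl in xy.
    - by rewrite xv pv (pN y) // eqxx -xv xy orbT.
    - by rewrite yv pv (pN x) // eqxx -yv xy !orbT.
    - by rewrite !pN // xy.
  have pinj j k x y : j < n -> k < n -> x \in B j -> y \in B k -> p x = p y -> j = k.
    move=> jN kN xj yk /(congr1 val).
    have [xv|xv] := eqVneq x v; have [yv|yv] := eqVneq y v.
    - by rewrite xv in xj; rewrite yv in yk => _; apply: (dis _ _ v).
    - rewrite xv in xj *; rewrite pv pN // => uy; rewrite -uy in yk.
      by rewrite (dis j i v) //; apply: (dis _ _ u).
    - rewrite yv in yk *; rewrite pv pN // => xu; rewrite xu in xj.
      by rewrite (dis k i v) //; apply: (dis _ _ u).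
    - by rewrite !pN // => xy; rewrite xy in xj; apply: (dis _ _ y).
  exists (fun j => p @: B j) => [j jN|j k jN kN jk].
    have [cBj _] := B1 j jN; split; last exact: subsetT.
    by apply: conn_image cBj => x y _ _; exact: pe.
  have [_ [x [y [xB yB xy]]]] := B2 j k jN kN jk; split.
    apply/pred0P => z /=; apply/negP => /andP[/imsetP[a aB ->] /imsetP[b bB ab]].
    exact: jk (pinj j k a b jN kN aB bB ab).
  exists (p x), (p y); rewrite !imset_f //; split=> //; apply: pe => // pxy.
  exact: jk (pinj j k x y jN kN xB yB pxy).
have /fin_all_exists[f fP] (i : 'I_n) : exists x, B i = [set x].
  have [[/set0Pn[x xB] _] _] := B1 i (ltn_ord i).
  apply/cards1P; rewrite eqn_leq; apply/andP; split; last by apply/card_gt0P; exists x.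
  by rewrite leqNgt; apply/negP => Bi; apply: single; exists i.
have fi : injective f.
  move=> i j E; apply/val_inj/(dis i j (f i)) => //; first by rewrite fP inE.
  by rewrite E fP inE.
apply: minor_iso; exists f => [|i j].
  apply: inj_card_bij => //; rewrite -[X in _ <= X](card_imset _ fi); apply: subset_leq_card.
  apply/subsetP => x _; apply: contrapT => nx; apply: cover; exists x => i iN; apply/negP => xB.
  apply: nx; apply/imsetP; exists (Ordinal iN) => //; apply/set1P.
  by rewrite -(fP (Ordinal iN)).
rewrite /= /complete_rel; case: eqVneq => [->|ij]; first by rewrite adj_irrefl.
have [|_ [x [y []]]] := B2 i j (ltn_ord i) (ltn_ord j); first by move/val_inj/eqP; rewrite (negbTE ij).
by rewrite !fP !inE => /eqP-> /eqP->.
Qed.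

Lemma induced_embedding (H G : sgraph) (g : H -> G) : injective g ->
  (forall x y, adj (g x) (g y) = adj x y) -> exists A : {set G}, isomorphic (induced A) H.
Proof.
move=> gi ga; exists [set g x | x : H].
have gA x : g x \in [set g x | x : H] by apply: imset_f.
pose g' x : induced [set g x | x : H] := exist _ (g x) (gA x).
have g'i : injective g' by move=> x y /(congr1 val) /gi.
have [|f fK gK] := inj_card_bij g'i.
  by rewrite card_sig (@eq_card _ _ [set g x | x : H]) // card_imset.
exists f; first by exists g'.
by move=> x y; rewrite -{2}(gK x) -{2}(gK y) /= /induced_rel /= ga.
Qed.

Section Fork.
Variable G : sgraph.
Hypothesis hG : free (fun H : sgraph => H = fork \/ H = antifork) G.

Lemma free_fork_free : fork_free (@adj G).
Proof.
move=> h a b c d ha hb hc cd ab ac bc hd ad bd; apply/eqP/negPn/negP => nab.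
(* The list follows the numbering of [fork]: centre 0, leaves 1 and 2, subdividing vertex 3, its end
   4. *)
pose g (x : fork) := nth h [:: h; a; b; c; d] (val x).
have es := @adj_sym G; have ei := @adj_irrefl G.
have ga x y : adj (g x) (g y) = adj x y.
  move: x y => [[|[|[|[|[|x]]]]] Hx] // [[|[|[|[|[|y]]]]] Hy] //; rewrite /g /fork_rel /= ?ei //; by first [adjacency | rewrite es].
have gi : injective g.
  have ne (u v : G) : adj u v -> u != v by apply: contraTneq => ->; rewrite ei.
  have nac : a != c by apply: contraFneq ad => ->.
  have nbc : b != c by apply: contraFneq bd => ->.
  have nhd : h != d by apply: contraFneq ad => <-; rewrite es.
  have nad : a != d by apply: contraFneq hd => <-.
  have nbd : b != d by apply: contraFneq hd => <-.
  have U : uniq [:: h; a; b; c; d].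
    by rewrite /= !inE !negb_or nab nac nbc nhd nad nbd (ne _ _ ha) (ne _ _ hb) (ne _ _ hc) (ne _ _ cd).
  move=> x y /eqP; rewrite /g nth_uniq //; by [move/eqP/val_inj|exact: ltn_ord].
have [A iso] := induced_embedding gi ga.
exact: (hG (or_introl erefl) iso).
Qed.

Lemma free_kite_free : kite_free (@adj G).
Proof.
move=> p q x y z pq px py qx qy xy zx zy zp zq.
(* In this order the nonadjacent pairs [zp], [zq], [zy] and [yx] of the kite fall on the edges 01,
   02, 03 and 34 of the fork. *)
pose g (i : antifork) := nth z [:: z; p; q; y; x] (val i).
have es := @adj_sym G; have ei := @adj_irrefl G.
have ga i j : adj (g i) (g j) = adj i j.
  move: i j => [[|[|[|[|[|i]]]]] Hi] // [[|[|[|[|[|j]]]]] Hj] //;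
    rewrite /g /= /compl_rel /= /fork_rel /= ?ei //; by first [adjacency | rewrite es].
have gi : injective g.
  have ne (u v : G) : adj u v -> u != v by apply: contraTneq => ->; rewrite ei.
  have nxy : x != y by apply: contraFneq zy => <-.
  have nzy : z != y by apply: contraTneq zx => ->; rewrite es xy.
  have nzp : z != p by apply: contraFneq zq => ->.
  have nzq : z != q by apply: contraFneq zp => ->; rewrite es.
  have U : uniq [:: z; p; q; y; x].
    rewrite /= !inE !negb_or nzy nzp nzq [y == x]eq_sym nxy.
    by rewrite (ne _ _ pq) (ne _ _ py) (ne _ _ px) (ne _ _ qx) (ne _ _ qy) (ne _ _ zx).
  move=> i j /eqP; rewrite /g nth_uniq //; by [move/eqP/val_inj|exact: ltn_ord].
have [A iso] := induced_embedding gi ga.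
exact: (hG (or_intror erefl) iso).
Qed.

End Fork.

Theorem theorem1p2 (G : sgraph)
  (hG : free (fun H : sgraph => H = fork \/ H = antifork) G) :
  chi G <= had G.
Proof.
have [n [f fn fe] M] := fork_kite_free_hadwiger (@adj_sym G) (@adj_irrefl G)
  (free_fork_free hG) (free_kite_free hG).
apply: (@leq_trans n).
  rewrite /chi; case: ex_minnP => k _; apply; apply/existsP.
  exists [ffun x => Ordinal (fn x (in_setT x))]; apply/forallP => x; apply/forallP => y.
  by apply/implyP => xy; rewrite !ffunE; apply/eqP => -[]; exact: fe.
by rewrite /had; case: ex_maxnP => k _; apply; apply/asboolP/model_minor.
Qed.
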